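(* Fix an integer $n\ge1$ and let $\psi:\mathcal F(\mathbb C^{n\times n})^U\to\mathcal F(\mathbb C^n)_{\mathrm{alt}}$ be the map $\psi(F)=c\,\Delta\cdot F|_D$. For $\lambda\in\Pi$ let $$e_\lambda(z)=\sqrt{\frac{\delta!}{(\lambda+\delta)!}}\;\chi_\lambda(z)\in\mathcal F(\mathbb C^{n\times n})^U.$$ If $\psi$ is well defined and unitary, then $(e_\lambda)_{\lambda\in\Pi}$ is an orthonormal basis of $\mathcal F(\mathbb C^{n\times n})^U$. Conversely, if $(e_\lambda)_{\lambda\in\Pi}$ is an orthonormal basis of $\mathcal F(\mathbb C^{n\times n})^U$, then $\psi$ is well defined and unitary.
   Context: $U$ is the group of $n\times n$ unitary matrices. $\mathcal F(\mathbb C^{n\times n})$ is the Hilbert space of holomorphic functions $F$ on the space $\mathbb C^{n\times n}$ of complex $n\times n$ matrices with $\pi^{-n^2}\int|F(z)|^2e^{-\mathrm{Tr}(z^*z)}dz<\infty$ ($dz$ Lebesgue measure), with inner product $\langle F,G\rangle=\pi^{-n^2}\int\overline{F(z)}G(z)e^{-\mathrm{Tr}(z^*z)}dz$. $\mathcal F(\mathbb C^{n\times n})^U$ is the closed subspace of those $F$ with $F(u^{-1}zu)=F(z)$ for all $u\in U$ and all $z$. $\mathcal F(\mathbb C^n)$ is the Hilbert space of holomorphic functions $F$ on $\mathbb C^n$ with $\pi^{-n}\int|F(z)|^2e^{-|z|^2}dz<\infty$, with inner product $\langle F,G\rangle=\pi^{-n}\int\overline{F(z)}G(z)e^{-|z|^2}dz$.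 $\mathcal F(\mathbb C^n)_{\mathrm{alt}}$ is the closed subspace of those $F$ with $F(z_1,\dots,z_n)=\mathrm{sgn}(\sigma)F(z_{\sigma^{-1}(1)},\dots,z_{\sigma^{-1}(n)})$ for all $\sigma\in S_n$. $D\subseteq\mathbb C^{n\times n}$ is the set of complex diagonal matrices, identified with $\mathbb C^n$ via the diagonal entries. $\Delta(x)=\prod_{i<j}(x_j-x_i)$ for $x\in D\cong\mathbb C^n$, and $c=\left(\prod_{p=1}^{n}p!\right)^{-1/2}$. ''Well defined'' means that $c\,\Delta\cdot F|_D\in\mathcal F(\mathbb C^n)_{\mathrm{alt}}$ for every $F\in\mathcal F(\mathbb C^{n\times n})^U$. Unitary means a surjective linear isometry. $\Pi=\{\lambda\in\mathbb N_0^n:\lambda_1\ge\lambda_2\ge\dots\ge\lambda_n\}$, $\delta=(n-1,n-2,\dots,0)$, and $\mu!=\mu_1!\cdots\mu_n!$ for $\mu\in\mathbb N_0^n$. $a_\mu(x_1,\dots,x_n)=\det[x_i^{\mu_j}]_{i,j=1}^n$, and $s_\lambda=a_{\lambda+\delta}/a_\delta$ is the Schur polynomial. For $x\in\mathbb C^{n\times n}$ with eigenvalues $x_1,\dots,x_n$ (with multiplicity), $\chi_\lambda(x)=s_\lambda(x_1,\dots,x_n)$; this is a conjugation-invariant polynomial in the entries of $x$. *)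

(* Defs.v *)
From HB Require Import structures.
From mathcomp Require Import all_boot all_order all_algebra all_fingroup.
From mathcomp Require Import all_classical all_reals all_analysis.
From mathcomp Require Import complex.
From mathcomp Require mpoly.
(* some names and notations of mpoly clash with those of all_analysis *)
Import (canonicals) mpoly.

Set Implicit Arguments.
Unset Strict Implicit.
Unset Printing Implicit Defensive.

Import Order.TTheory GRing.Theory Num.Theory.
Import numFieldNormedType.Exports.

Local Open Scope classical_set_scope.
Local Open Scope sesquilinear_scope.
Local Open Scope ring_scope.

Section power_measure.
Local Open Scope ereal_scope.
Context d (T : measurableType d) (R : realType).
Variable mu : {sigma_finite_measure set T -> \bar R}.

Definition cons_pair n (p : T * n.-tuple T) : n.+1.-tuple T :=
  [the n.+1.-tuple T of p.1 :: p.2].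

Definition uncons_pair n (t : n.+1.-tuple T) : T * n.-tuple T :=
  (thead t, [tuple of behead t]).

Lemma uncons_pairK n : cancel (@uncons_pair n) (@cons_pair n).
Proof. by move=> t; rewrite [RHS]tuple_eta; apply: val_inj. Qed.

Lemma cons_pairK n : cancel (@cons_pair n) (@uncons_pair n).
Proof. by move=> [x t]; congr pair; apply: val_inj. Qed.

Lemma measurable_cons_pair n : measurable_fun setT (@cons_pair n).
Proof. exact: measurable_cons. Qed.

Lemma measurable_uncons_pair n : measurable_fun setT (@uncons_pair n).
Proof.
apply/measurable_fun_pairP; split; first exact: measurable_tnth.
exact: measurable_behead.
Qed.

Section cons_measure.
Variables (n : nat) (nu : {sigma_finite_measure set (n.-tuple T) -> \bar R}).

Definition cons_measure : set (n.+1.-tuple T) -> \bar R :=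
  pushforward (mu \x nu) (@cons_pair n).

Let cons_measure0 : cons_measure set0 = 0.
Proof. by rewrite /cons_measure /pushforward preimage_set0 measure0. Qed.

Let cons_measure_ge0 A : 0 <= cons_measure A.
Proof. by rewrite /cons_measure /pushforward measure_ge0. Qed.

Let cons_measure_sigma_additive : semi_sigma_additive cons_measure.
Proof.
move=> F mF tF mUF; rewrite /cons_measure /pushforward preimage_bigcup.
have mpre B : measurable B -> measurable (@cons_pair n @^-1` B).
  by move=> mB; rewrite -[X in measurable X]setTI; exact: measurable_cons_pair.
apply: measure_semi_sigma_additive.
- by move=> i; exact: mpre.
- apply/trivIsetP => /= i j _ _ ij; rewrite -preimage_setI.
  by move/trivIsetP : tF => /(_ _ _ _ _ ij) ->//; rewrite preimage_set0.
- by rewrite -preimage_bigcup; exact: mpre.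
Qed.

HB.instance Definition _ := isMeasure.Build _ _ _ cons_measure
  cons_measure0 cons_measure_ge0 cons_measure_sigma_additive.

Let cons_measure_sigma_finite : sigma_finite setT cons_measure.
Proof.
have /sigma_finiteP[F [TF ndF Foo]] := sigma_finiteT mu.
have /sigma_finiteP[G [TG ndG Goo]] := sigma_finiteT nu.
exists (fun i => @uncons_pair n @^-1` (F i `*` G i)).
  rewrite -preimage_bigcup (_ : \bigcup_i _ = setT) ?preimage_setT //.
  apply/seteqP; split=> // -[x y] _.
  have [i _ Fix] : (\bigcup_i F i) x by rewrite -TF.
  have [j _ Gjy] : (\bigcup_i G i) y by rewrite -TG.
  exists (maxn i j) => //; split => /=.
  - by move: x Fix; exact/subsetPset/ndF/leq_maxl.
  - by move: y Gjy; exact/subsetPset/ndG/leq_maxr.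
move=> i; have [mF Fi] := Foo i; have [mG Gi] := Goo i; split.
  rewrite -[X in measurable X]setTI; apply: measurable_uncons_pair => //.
  exact: measurableX.
rewrite /cons_measure /pushforward -comp_preimage (_ : _ \o _ = idfun) //.
  by rewrite [ltLHS]product_measure1E// lte_mul_pinfty// ge0_fin_numE.
by apply/funext => p /=; rewrite cons_pairK.
Qed.

HB.instance Definition _ := Measure_isSigmaFinite.Build _ _ _ cons_measure
  cons_measure_sigma_finite.

End cons_measure.

Fixpoint power_measure n : {sigma_finite_measure set (n.-tuple T) -> \bar R} :=
  match n with
  | 0 => \d_([tuple] : 0.-tuple T)
  | n'.+1 => cons_measure (power_measure n')
  end.

End power_measure.

Section alternants.
Variables (A : comNzRingType) (n : nat).
Implicit Types (x : 'I_n -> A) (mu : 'I_n -> nat).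

Definition alternant x mu : A := \det (\matrix_(i < n, j < n) x i ^+ mu j).

(* indices start at 0, hence delta_j = n - 1 - j *)
Definition delta (j : 'I_n) : nat := (n - j.+1)%N.

Lemma dvd_alternant x mu : exists s : A, alternant x mu = s * alternant x delta.
Proof.
pose P : {poly A} := \prod_(i < n) ('X - (x i)%:P).
have Pmonic : P \is monic by exact: monic_prod_XsubC.
have sP : size P = n.+1 by rewrite size_prod_XsubC /index_enum -enumT size_enum_ord.
pose r j := Pdiv.Ring.rmodp 'X^(mu j) P.
have rx i j : (r j).[x i] = x i ^+ mu j.
  have /(congr1 (fun p => p.[x i])) :=
    Pdiv.RingMonic.rdivp_eq Pmonic 'X^(mu j).
  rewrite hornerD hornerM (_ : P.[x i] = 0) ?mulr0 ?add0r ?hornerXn //.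
  by rewrite horner_prod (bigD1 i) //= hornerXsubC subrr mul0r.
have sr j : (size (r j) <= n)%N.
  by rewrite -ltnS -sP Pdiv.Ring.ltn_rmodpN0 // monic_neq0.
exists (\det (\matrix_(i < n, j < n) (r j)`_(delta i))).
rewrite mulrC /alternant -det_mulmx; congr (\det _).
apply/matrixP => i j; rewrite !mxE -rx (horner_coef_wide _ (sr j)).
rewrite (reindex_inj rev_ord_inj); apply: eq_bigr => k _.
by rewrite !mxE mulrC.
Qed.

End alternants.

(* [R[i]], declared as a numClosedFieldType so that the normed-space structures
   of numFieldNormedType apply to it and to matrices over it *)
Definition Cplx (R : realType) : numClosedFieldType := R[i].

Section fock.
Variable R : realType.
Local Notation C := (Cplx R).

Definition Cre (z : C) : R := complex.Re z.
Definition Cim (z : C) : R := complex.Im z.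
Definition RtoC (x : R) : C := (x%:C)%C.

Section fock_space.
Variables m n : nat.
Local Notation mn2 := (m * n + m * n)%N.
Local Notation fct := ('M[C]_(m, n) -> C).
Implicit Types (F G : fct) (z : 'M[C]_(m, n)).

(* Lebesgue measure on R^(2mn); the first mn coordinates are the real parts and
   the last mn the imaginary parts of the entries of a matrix *)
Definition leb :
    {sigma_finite_measure set (mn2.-tuple (measurableTypeR R)) -> \bar R} :=
  power_measure lebesgue_measure mn2.

Definition mx_of (t : mn2.-tuple (measurableTypeR R)) : 'M[C]_(m, n) :=
  \matrix_(i, j) Complex (tnth t (lshift (m * n) (mxvec_index i j)))
                         (tnth t (rshift (m * n) (mxvec_index i j))).

Definition holomorphic F : Prop := forall z, differentiable F z.

(* for m = 1, z is a row vector and this is exp (- |z|^2) *)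
Definition gauss z : R := expR (- Cre (\tr (z ^t* *m z))).

Definition fock : set fct := [set F | holomorphic F /\
  ((pi ^- (m * n))%:E *
   \int[leb]_(t in setT) (Cre (`|F (mx_of t)| ^+ 2) * gauss (mx_of t))%:E
   < +oo)%E].

Definition Cintegral (f : fct) : C :=
  Complex (\int[leb]_(t in setT) Cre (f (mx_of t)))
          (\int[leb]_(t in setT) Cim (f (mx_of t))).

Definition inner F G : C := RtoC (pi ^- (m * n)) *
  Cintegral (fun z => (F z)^* * G z * RtoC (gauss z)).

Definition fnorm F : R := Num.sqrt (Cre (inner F F)).

(* the last clause says that the finite linear span of e is dense in H *)
Definition is_onb (I : eqType) (H : set fct) (e : I -> fct) : Prop :=
  [/\ forall i, H (e i),
      forall i j, inner (e i) (e j) = (i == j)%:R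
    & forall F, H F -> forall eps : R, 0 < eps ->
        exists (s : seq I) (a : I -> C),
          fnorm (fun z => F z - \sum_(i <- s) a i * e i z) < eps].

End fock_space.

Definition unitary_map m n p q (H : set ('M[C]_(m, n) -> C))
    (K : set ('M[C]_(p, q) -> C))
    (T : ('M[C]_(m, n) -> C) -> ('M[C]_(p, q) -> C)) : Prop :=
  [/\ forall (a : C) F G, H F -> H G ->
        T (fun z => a * F z + G z) = (fun x => a * T F x + T G x),
      forall F, H F -> fnorm (T F) = fnorm F
    & forall G, K G -> exists2 F, H F & T F = G].

Section psi.
Variable n : nat.

Definition fockU : set ('M[C]_n -> C) := [set F | fock F /\
  forall u : 'M[C]_n, u \is unitarymx ->
    forall z, F (invmx u *m z *m u) = F z].

(* C^n is the space of row vectors *)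
Definition fock_alt : set ('rV[C]_n -> C) := [set F | fock F /\
  forall (s : 'S_n) z, F z = (-1) ^+ s * F (\row_i z 0 (s^-1%g i))].

Definition vandermonde (x : 'rV[C]_n) : C :=
  \prod_(i < n) \prod_(j < n | (i < j)%N) (x 0 j - x 0 i).

Definition psi_const : R :=
  (Num.sqrt (\prod_(1 <= p < n.+1) p`!)%:R)^-1.

Definition psi (F : 'M[C]_n -> C) : 'rV[C]_n -> C :=
  fun x => RtoC psi_const * vandermonde x * F (diag_mx x).

End psi.

Section schur.
Variable n : nat.

Definition partitions := {l : n.-tuple nat | sorted geq l}.

Definition mfact (mu : 'I_n -> nat) : nat := \prod_(i < n) (mu i)`!.

Definition add_delta (l : partitions) (j : 'I_n) : nat := (tnth (val l) j + delta j)%N.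

Definition mpvar (i : 'I_n) : mpoly.mpoly n C := mpoly.mpolyX C (mpoly.mnm1 i).

(* a_(l + delta) / a_delta: the polynomial ring is an integral domain and the
   division is exact by schurP, so the default value 0 is never used *)
Definition schur (l : partitions) : mpoly.mpoly n C :=
  xget 0 [set s | alternant mpvar (add_delta l) = s * alternant mpvar (@delta n)].

Lemma schurP l : alternant mpvar (add_delta l) = schur l * alternant mpvar (@delta n).
Proof.
have [s sP] := dvd_alternant mpvar (add_delta l).
by rewrite /schur; case: xgetP => [? _ ->|/(_ s)] /=.
Qed.

(* listed with multiplicity, in an arbitrary order; Schur polynomials are
   symmetric *)
Definition eigenvalues (x : 'M[C]_n) : seq C :=
  sval (closed_field_poly_normal (char_poly x)).

Lemma eigenvaluesP (x : 'M[C]_n) :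
  char_poly x = \prod_(a <- eigenvalues x) ('X - a%:P).
Proof.
rewrite /eigenvalues; case: closed_field_poly_normal => r /= {1}->.
by rewrite (monicP (char_poly_monic x)) scale1r.
Qed.

Definition chi (l : partitions) (x : 'M[C]_n) : C :=
  mpoly.meval (fun i : 'I_n => (eigenvalues x)`_i) (schur l).

Definition schur_basis (l : partitions) : 'M[C]_n -> C := fun z =>
  RtoC (Num.sqrt ((mfact (@delta n))%:R / (mfact (add_delta l))%:R)) * chi l z.

End schur.

End fock.

Arguments fockU : clear implicits.
Arguments fock_alt : clear implicits.

(* Main.v *)
(* By Cauchy's formula, an entire function of one variable has a Taylor expansion
   with geometric error bounds.  Hence, for F in a Fock space, the component of F
   of degree k in one matrix entry is a limit of averages of F over the rotations
   of this entry by roots of unity of order 2^N.  Rotations preserve the Gaussian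
   measure, so Bessel's inequality holds for these components; it bounds the
   values of F by its norm, which gives completeness, and it shows that monomials
   span a dense subspace.

   The map psi sends e_l to a_(l+delta) / sqrt(n! (l+delta)!) up to a sign.
   Expanding determinants into monomials shows that these functions are
   orthonormal, and antisymmetrizing approximations by monomials shows that they
   span a dense subspace of the alternating functions.  If psi is unitary, the
   basis is pulled back along psi.  If (e_l) is a basis, psi is isometric on its
   span, and since point evaluations are continuous, limits in norm on both
   sides correspond to each other under psi. *)

From HB Require Import structures.
Require Import Defs.
From mathcomp Require Import all_boot all_order all_algebra all_fingroup.
From mathcomp Require Import all_classical all_reals all_analysis.
From mathcomp Require Import measurable_realfun complex.
From mathcomp Require Import ring lra zify.
From mathcomp Require mpoly.
Import (canonicals) mpoly.

Set Implicit Arguments.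
Unset Strict Implicit.
Unset Printing Implicit Defensive.

Import Order.TTheory GRing.Theory Num.Theory.
Import numFieldNormedType.Exports.

Local Open Scope classical_set_scope.
Local Open Scope ring_scope.

(** * Complex-valued functions of a real variable *)

(** [holomorphic] provides a differential at each point but no continuity of it, so Cauchy's formula
    is reached by Goursat's subdivision. The subdivision runs in the coordinates w = z + e^s (e^(i
    th) - z), where dw / (w - z) has coefficient 1 along s: all regions are rectangles, and
    contracting the circle to z means letting s tend to minus infinity.

    Averages over roots of unity are finite sums of rotated copies of F. Their holomorphy,
    measurability and norm bounds are immediate, so no integral depending on a parameter occurs;
    large N is handled afterwards by Fatou's lemma or by locally uniform convergence. The orders are
    powers of 2 because such roots come from iterated square roots.

    Lebesgue measure is treated one coordinate at a time: rotations and permutations are composed of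
    shears and sign changes, and Gaussian moments come from integration by parts in the real and in
    the imaginary part of one entry.

    Complex estimates are often made for the two real components separately and lose a factor 2,
    which no limit argument notices. *)

Section complex_modulus.
Variable R : realType.
Local Notation C := (Cplx R).
Implicit Types (z w : C) (x y : R).

(** The norm of [C] takes values in [C], whose order is partial. Its real part moves all estimates
    to [R], where arithmetic tactics apply. *)
Definition cabs z : R := Cre `|z|.

Lemma CreD z w : Cre (z + w) = Cre z + Cre w.
Proof. by case: z w => [? ?] [? ?]. Qed.
Lemma CimD z w : Cim (z + w) = Cim z + Cim w.
Proof. by case: z w => [? ?] [? ?]. Qed.
Lemma CreN z : Cre (- z) = - Cre z. Proof. by case: z. Qed.
Lemma CimN z : Cim (- z) = - Cim z. Proof. by case: z. Qed.
Lemma CreB z w : Cre (z - w) = Cre z - Cre w.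
Proof. by rewrite CreD CreN. Qed.
Lemma CimB z w : Cim (z - w) = Cim z - Cim w.
Proof. by rewrite CimD CimN. Qed.
Lemma CreM z w : Cre (z * w) = Cre z * Cre w - Cim z * Cim w.
Proof. by case: z w => [? ?] [? ?]. Qed.
Lemma CimM z w : Cim (z * w) = Cre z * Cim w + Cim z * Cre w.
Proof. by case: z w => [? ?] [? ?]. Qed.
Lemma Cre_conj z : Cre z^* = Cre z. Proof. by case: z. Qed.
Lemma Cim_conj z : Cim z^* = - Cim z. Proof. by case: z. Qed.

Lemma Ceq z w : Cre z = Cre w -> Cim z = Cim w -> z = w.
Proof. by case: z w => [a b] [c d] /= -> ->. Qed.

Lemma RtoCD x y : RtoC (x + y) = RtoC x + RtoC y.
Proof. by apply: Ceq; rewrite /= ?addr0. Qed.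
Lemma RtoCM x y : RtoC (x * y) = RtoC x * RtoC y.
Proof. by apply: Ceq; rewrite /= ?mul0r ?mulr0 ?subr0 ?addr0. Qed.
Lemma RtoCN x : RtoC (- x) = - RtoC x.
Proof. by apply: Ceq; rewrite /= ?oppr0. Qed.
Lemma RtoCB x y : RtoC (x - y) = RtoC x - RtoC y.
Proof. by rewrite RtoCD RtoCN. Qed.
Lemma RtoCX x n : RtoC (x ^+ n) = RtoC x ^+ n.
Proof. by elim: n => // n IH; rewrite !exprS RtoCM IH. Qed.
Lemma RtoC1 : RtoC 1 = 1 :> C. Proof. by []. Qed.
Lemma RtoC0 : RtoC 0 = 0 :> C. Proof. by []. Qed.
Lemma RtoC_nat n : RtoC n%:R = n%:R :> C.
Proof. by elim: n => // n IH; rewrite -natr1 RtoCD IH -natr1. Qed.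
Lemma Cre_sum I (s : seq I) (P : pred I) (f : I -> C) :
  Cre (\sum_(i <- s | P i) f i) = \sum_(i <- s | P i) Cre (f i).
Proof. exact: (big_morph _ CreD). Qed.
Lemma CreZ x z : Cre (RtoC x * z) = x * Cre z.
Proof. by rewrite CreM /= mul0r subr0. Qed.
Lemma CimZ x z : Cim (RtoC x * z) = x * Cim z.
Proof. by rewrite CimM /= mul0r addr0. Qed.
Lemma Cre_eqE z : z = RtoC (Cre z) + 'i * RtoC (Cim z).
Proof. by case: z => a b; apply: Ceq; rewrite /= ?mul1r ?mul0r ?mulr0 ?subr0 ?addr0 ?add0r ?mulr1. Qed.

Lemma normC_cabs z : `|z| = RtoC (cabs z).
Proof. by case: z => a b; rewrite /cabs normc_def /=. Qed.

Lemma cabsE z : cabs z = Num.sqrt (Cre z ^+ 2 + Cim z ^+ 2).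
Proof. by rewrite /cabs normc_def /=. Qed.

Lemma cabs_ge0 z : 0 <= cabs z. Proof. by rewrite cabsE sqrtr_ge0. Qed.

Lemma cabs_sqr z : cabs z ^+ 2 = Cre z ^+ 2 + Cim z ^+ 2.
Proof. by rewrite cabsE sqr_sqrtr // addr_ge0 // sqr_ge0. Qed.

Lemma cabsM z w : cabs (z * w) = cabs z * cabs w.
Proof. by rewrite {1}/cabs normrM !normC_cabs -RtoCM. Qed.

Lemma cabs0 : cabs 0 = 0. Proof. by rewrite /cabs normr0. Qed.
Lemma cabs1 : cabs 1 = 1. Proof. by rewrite /cabs normr1. Qed.
Lemma cabsN z : cabs (- z) = cabs z. Proof. by rewrite /cabs normrN. Qed.
Lemma cabs_conj z : cabs z^* = cabs z. Proof. by rewrite /cabs norm_conjC. Qed.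
Lemma cabsC z w : cabs (z - w) = cabs (w - z). Proof. by rewrite -cabsN opprB. Qed.
Lemma cabsX z n : cabs (z ^+ n) = cabs z ^+ n.
Proof. by elim: n => [|n IH]; rewrite ?expr0 ?cabs1 // !exprS cabsM IH. Qed.

Lemma cabsD z w : cabs (z + w) <= cabs z + cabs w.
Proof.
have := ler_normD z w; rewrite !normC_cabs -RtoCD lecE /= => /andP[_].
by [].
Qed.
Lemma cabsB z w : cabs (z - w) <= cabs z + cabs w.
Proof. by rewrite -[cabs w]cabsN cabsD. Qed.
Lemma cabs_eq0 z : cabs z = 0 -> z = 0.
Proof. by move=> z0; apply/eqP; rewrite -normr_eq0 normC_cabs z0. Qed.
Lemma cabs_gt0 z : (0 < cabs z) = (z != 0).
Proof.
rewrite lt0r cabs_ge0 andbT; congr (~~ _); apply/eqP/eqP => [/cabs_eq0 //|->].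
exact: cabs0.
Qed.
Lemma cabs_RtoC x : cabs (RtoC x) = `|x|.
Proof. by rewrite cabsE /= expr0n addr0 sqrtr_sqr. Qed.
Lemma cabs_i : cabs 'i = 1.
Proof. by rewrite /cabs normCi. Qed.
Lemma cabsV z : cabs z^-1 = (cabs z)^-1.
Proof.
have [->|z0] := eqVneq z 0; first by rewrite invr0 cabs0 invr0.
have : cabs (z * z^-1) = 1 by rewrite divff // cabs1.
rewrite cabsM => /(canRL (mulKf _)) ->; rewrite ?mulr1 //.
by rewrite gt_eqF // cabs_gt0.
Qed.
Lemma cabs_sum I (s : seq I) (P : pred I) (f : I -> C) :
  cabs (\sum_(i <- s | P i) f i) <= \sum_(i <- s | P i) cabs (f i).
Proof.
elim/big_rec2: _ => [|i y1 y2 _ h]; first by rewrite cabs0.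
by rewrite (le_trans (cabsD _ _)) // lerD2l.
Qed.
Lemma Cre_le_cabs z : `|Cre z| <= cabs z.
Proof. by rewrite cabsE -sqrtr_sqr ler_wsqrtr // lerDl sqr_ge0. Qed.
Lemma Cim_le_cabs z : `|Cim z| <= cabs z.
Proof. by rewrite cabsE -sqrtr_sqr ler_wsqrtr // lerDr sqr_ge0. Qed.
Lemma cabs_le z : cabs z <= `|Cre z| + `|Cim z|.
Proof.
rewrite {1}(Cre_eqE z) (le_trans (cabsD _ _)) //.
by rewrite cabsM cabs_i mul1r !cabs_RtoC.
Qed.
Lemma conjC_mul z : z^* * z = RtoC (cabs z ^+ 2).
Proof. by rewrite mulrC -normCK normC_cabs RtoCX. Qed.
Lemma Cre_norm2 z : Cre (`|z| ^+ 2) = cabs z ^+ 2.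
Proof. by rewrite normC_cabs -RtoCX. Qed.

(** The form in which equalities are drawn from limits: a difference with arbitrarily small
    modulus. *)
Lemma cabs_lt_eq0 z : (forall e, 0 < e -> cabs z <= e) -> z = 0.
Proof.
move=> h; apply: cabs_eq0; apply/eqP; rewrite eq_le cabs_ge0 andbT.
by apply/ler_addgt0Pr => e e0; rewrite add0r h.
Qed.

End complex_modulus.

(** Dividing a tolerance by [v + 1] rather than by [v] avoids the case [v = 0] whenever a factor [v]
    has to be absorbed. *)
Lemma ler_div_succ (R : realType) (e x v : R) : 0 <= e -> 0 <= x -> 0 <= v ->
  e / (v + 1) * (x * v) <= e * x.
Proof.
move=> e0 x0 v0; have v1 : 0 < v + 1 by rewrite ltr_wpDl.
rewrite (_ : _ * _ = e * x * (v / (v + 1))); last by field; rewrite gt_eqF.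
by rewrite -[leRHS]mulr1 ler_wpM2l ?mulr_ge0 // ler_pdivrMr // mul1r lerDl.
Qed.

Section real_variable.
Variable R : realType.
Local Notation C := (Cplx R).
Implicit Types (G g : R -> C) (x y a b B : R).

(** Continuity, and derivatives in the next definition, are asked of the two components, because the
    mean value theorem and the fundamental theorem of calculus are applied to real functions. *)
Definition ccont g := continuous (fun x => Cre (g x)) /\ continuous (fun x => Cim (g x)).

Definition cder G x (d : C) :=
  is_derive x 1 (fun x => Cre (G x)) (Cre d) /\
  is_derive x 1 (fun x => Cim (G x)) (Cim d).

Lemma cder_cst (c : C) x : cder (fun=> c) x 0.
Proof. by split; apply: is_derive_cst. Qed.

Lemma cderD G1 G2 x d1 d2 : cder G1 x d1 -> cder G2 x d2 ->
  cder (fun x => G1 x + G2 x) x (d1 + d2).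
Proof.
move=> [a1 b1] [a2 b2]; split.
  by rewrite CreD (_ : (fun x => _) = (fun x => Cre (G1 x)) + (fun x => Cre (G2 x)));
    [exact: is_deriveD|apply/funext => y; rewrite CreD].
by rewrite CimD (_ : (fun x => _) = (fun x => Cim (G1 x)) + (fun x => Cim (G2 x)));
    [exact: is_deriveD|apply/funext => y; rewrite CimD].
Qed.

Lemma cderN G x d : cder G x d -> cder (fun x => - G x) x (- d).
Proof.
move=> [a1 b1]; split.
  by rewrite CreN (_ : (fun x => _) = - (fun x => Cre (G x)));
    [exact: is_deriveN|apply/funext => y; rewrite CreN].
by rewrite CimN (_ : (fun x => _) = - (fun x => Cim (G x)));
    [exact: is_deriveN|apply/funext => y; rewrite CimN].
Qed.

Lemma cderB G1 G2 x d1 d2 : cder G1 x d1 -> cder G2 x d2 ->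
  cder (fun x => G1 x - G2 x) x (d1 - d2).
Proof. by move=> h1 h2; apply: cderD => //; apply: cderN. Qed.

Lemma cderM G1 G2 x d1 d2 : cder G1 x d1 -> cder G2 x d2 ->
  cder (fun x => G1 x * G2 x) x (d1 * G2 x + G1 x * d2).
Proof.
move=> [a1 b1] [a2 b2]; split.
  rewrite (_ : (fun x => _) = (fun x => Cre (G1 x)) * (fun x => Cre (G2 x))
     - (fun x => Cim (G1 x)) * (fun x => Cim (G2 x))); last first.
    by apply/funext => y; rewrite CreM.
  apply: is_derive_eq (is_deriveB (is_deriveM a1 a2) (is_deriveM b1 b2)) _.
  by rewrite CreD !CreM /GRing.scale /=; ring.
rewrite (_ : (fun x => _) = (fun x => Cre (G1 x)) * (fun x => Cim (G2 x))
     + (fun x => Cim (G1 x)) * (fun x => Cre (G2 x))); last first.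
  by apply/funext => y; rewrite CimM.
apply: is_derive_eq (is_deriveD (is_deriveM a1 b2) (is_deriveM b1 a2)) _.
by rewrite CimD !CimM /GRing.scale /=; ring.
Qed.

Lemma cderZ (c : C) G x d : cder G x d -> cder (fun x => c * G x) x (c * d).
Proof.
by move=> h; have := cderM (cder_cst c x) h; rewrite mul0r add0r.
Qed.

Lemma cderZr (c : C) G x d : cder G x d -> cder (fun x => G x * c) x (d * c).
Proof.
by move=> h; have := cderM h (cder_cst c x); rewrite mulr0 addr0.
Qed.

Lemma cder_ext G1 G2 x d : (forall x, G1 x = G2 x) -> cder G1 x d -> cder G2 x d.
Proof. by move=> /funext ->. Qed.

Lemma cder_eq0 G : (forall x, cder G x 0) -> forall x y, G x = G y.
Proof.
move=> h x y; apply: Ceq.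
  by apply: (@is_derive_0_is_cst _ (fun x => Cre (G x))) => z; have [] := h z.
by apply: (@is_derive_0_is_cst _ (fun x => Cim (G x))) => z; have [] := h z.
Qed.

Lemma cder_uniq G1 G2 g : (forall x, cder G1 x (g x)) -> (forall x, cder G2 x (g x)) ->
  G1 0 = G2 0 -> forall x, G1 x = G2 x.
Proof.
move=> h1 h2 e x; apply/eqP; rewrite -subr_eq0; apply/eqP.
rewrite -[RHS](subrr (G2 0)) -{1}e.
apply: (@cder_eq0 (fun x => G1 x - G2 x)) => y.
by have := cderB (h1 y) (h2 y); rewrite subrr.
Qed.

Lemma is_derive_continuous (f df : R -> R) :
  (forall x, is_derive x 1 f (df x)) -> continuous f.
Proof.
by move=> h x; apply: differentiable_continuous; apply/derivable1_diffP; case: (h x).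
Qed.

Lemma ccont_cst (c : C) : ccont (fun=> c).
Proof. by split=> x; apply: cvg_cst. Qed.

Lemma ccontD g h : ccont g -> ccont h -> ccont (fun x => g x + h x).
Proof.
move=> [g1 g2] [h1 h2]; split=> x.
  by rewrite (_ : (fun x => _) = (fun x => Cre (g x) + Cre (h x))); [apply: cvgD; [exact: g1|exact: h1]|apply/funext => y; rewrite CreD].
by rewrite (_ : (fun x => _) = (fun x => Cim (g x) + Cim (h x))); [apply: cvgD; [exact: g2|exact: h2]|apply/funext => y; rewrite CimD].
Qed.

Lemma ccontM g h : ccont g -> ccont h -> ccont (fun x => g x * h x).
Proof.
move=> [g1 g2] [h1 h2]; split=> x.
  rewrite (_ : (fun x => _) = (fun x => Cre (g x) * Cre (h x) - Cim (g x) * Cim (h x))).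
    by apply: cvgB; apply: cvgM; [exact: g1|exact: h1|exact: g2|exact: h2].
  by apply/funext => y; rewrite CreM.
rewrite (_ : (fun x => _) = (fun x => Cre (g x) * Cim (h x) + Cim (g x) * Cre (h x))).
  by apply: cvgD; apply: cvgM; [exact: g1|exact: h2|exact: g2|exact: h1].
by apply/funext => y; rewrite CimM.
Qed.

Lemma ccont_sum I (s : seq I) (F : I -> R -> C) :
  (forall i, ccont (F i)) -> ccont (fun x => \sum_(i <- s) F i x).
Proof.
move=> h; elim: s => [|i s IH].
  rewrite (_ : (fun x => _) = fun=> 0); first exact: ccont_cst.
  by apply/funext => x; rewrite big_nil.
rewrite (_ : (fun x => _) = fun x => F i x + \sum_(j <- s) F j x).
  exact: ccontD.
by apply/funext => x; rewrite big_cons.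
Qed.

Lemma cder_ccont G g : (forall x, cder G x (g x)) -> ccont G.
Proof.
move=> h; split.
  by apply: (@is_derive_continuous _ (fun x => Cre (g x))) => x; case: (h x).
by apply: (@is_derive_continuous _ (fun x => Cim (g x))) => x; case: (h x).
Qed.

Lemma MVT_bound (f df : R -> R) a b B : a <= b ->
  (forall x, is_derive x 1 f (df x)) ->
  (forall x, a <= x <= b -> `|df x| <= B) -> `|f b - f a| <= B * (b - a).
Proof.
move=> ab h hB.
have [c cab ->] := @MVT_segment _ f df a b ab (fun x _ => h x)
   (@continuous_subspaceT _ _ _ _ (is_derive_continuous h)).
rewrite normrM [`|b - a|]ger0_norm ?subr_ge0 // ler_wpM2r ?subr_ge0 //.
by apply: hB; rewrite in_itv /= in cab.
Qed.

(** The mean value theorem fails for complex values. It is applied to both components, and adding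
    the two bounds costs the factor 2 that reappears in the Cauchy estimates. *)
Lemma cder_bound G g a b B : a <= b -> (forall x, cder G x (g x)) ->
  (forall x, a <= x <= b -> cabs (g x) <= B) ->
  cabs (G b - G a) <= 2 * B * (b - a).
Proof.
move=> ab h hB; rewrite (le_trans (cabs_le _)) // -mulrA mulr2n mulrDl mul1r.
rewrite CreB CimB; apply: lerD.
  apply: (@MVT_bound (fun x => Cre (G x)) (fun x => Cre (g x))) => // [x|x /hB]; first by case: (h x).
  exact/le_trans/Cre_le_cabs.
apply: (@MVT_bound (fun x => Cim (G x)) (fun x => Cim (g x))) => // [x|x /hB]; first by case: (h x).
exact/le_trans/Cim_le_cabs.
Qed.

(** Starting the integral at [- b] keeps 0 and the negative arguments to the right of the lower
    limit; subtracting the value at 0 normalizes the result. *)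
Lemma antiderivative_itv (f : R -> R) b : continuous f -> 0 < b ->
  exists F : R -> R, F 0 = 0 /\ forall x, - b < x < b -> is_derive x 1 F (f x).
Proof.
move=> cf b0.
pose F0 x : R := \int[lebesgue_measure]_(t in [set` `[- b, x]]) f t.
exists (fun x => F0 x - F0 0); split=> [|x /andP[bx xb]]; first by rewrite subrr.
have intf : (@lebesgue_measure R).-integrable `[- b, b] (EFin \o f).
  apply: continuous_compact_integrable; first exact: segment_compact.
  exact: continuous_subspaceT.
have [dF F'] := @continuous_FTC1_closed R f (- b) x b xb intf bx (cf x).
have : is_derive x 1 F0 (f x) by apply: DeriveDef; [exact: dF|rewrite -derive1E].
move=> h; rewrite -[f x]subr0.
exact: is_deriveB.
Qed.

(** Primitives on growing intervals are glued: two of them vanish at 0 and have the same derivative,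
    so they agree on the smaller interval. *)
Lemma antiderivative (f : R -> R) : continuous f ->
  exists F : R -> R, F 0 = 0 /\ forall x, is_derive x 1 F (f x).
Proof.
move=> cf.
have /choice[G hG] : forall n : nat, exists F : R -> R, F 0 = 0 /\
    forall x, - n.+1%:R < x < n.+1%:R -> is_derive x 1 F (f x).
  by move=> n; apply: antiderivative_itv.
have GG m n x : `|x| < m.+1%:R -> `|x| < n.+1%:R -> G m x = G n x.
  move=> xm xn.
  have D y : `|y| <= `|x| -> is_derive y 1 (G m - G n) 0.
    move=> yx; rewrite -[0](subrr (f y)); apply: is_deriveB.
      by apply: (hG m).2; rewrite -ltr_norml (le_lt_trans yx).
    by apply: (hG n).2; rewrite -ltr_norml (le_lt_trans yx).
  have E0 : (G m - G n) 0 = 0 by rewrite /= !fctE (hG m).1 (hG n).1 subrr.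
  suff : (G m - G n) x = 0 by rewrite /= !fctE => /eqP; rewrite subr_eq0 => /eqP.
  have Z u v : u <= v -> (forall y, u <= y <= v -> `|y| <= `|x|) ->
      (G m - G n) v = (G m - G n) u.
    move=> uv yx.
    have d1 y : y \in `]u, v[%R -> is_derive y 1 (G m - G n) 0.
      by rewrite in_itv /= => /andP[uy yv]; apply: D; rewrite yx // !ltW.
    have d2 : {within `[u, v], continuous (G m - G n)}.
      apply: derivable_within_continuous => y; rewrite in_itv /= => uyv.
      by have [] := D y (yx _ uyv).
    have [c _] := MVT_segment uv d1 d2.
    by rewrite mul0r => /eqP; rewrite subr_eq0 => /eqP.
  have [x0|x0] := leP 0 x.
    rewrite (Z 0) // => y /andP[y0 yx]; rewrite !ger0_norm //.
  rewrite -(Z _ 0) // ?ltW // => y /andP[y0 yx].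
  by rewrite !ler0_norm ?lerN2 // ltW.
(* The interval used at [x] depends on [x]. By [GG] this choice is immaterial, and near [x] the
   glued function is the single primitive [G (k x)]. *)
pose k (x : R) : nat := Num.bound `|x|.
exists (fun x => G (k x) x); split=> [|x]; first by case: (hG (k 0)).
have kx : `|x| < (k x).+1%:R.
  by rewrite (lt_le_trans (archi_boundP (normr_ge0 x))) // ler_nat.
have nx : `|y| @[y --> x] --> `|x| by apply: cvg_norm; exact: cvg_id.
apply: (@near_eq_is_derive _ _ _ (G (k x))).
- near=> y; apply: GG.
    by near: y; exact: (cvgr_lt _ nx _ kx).
  by rewrite (lt_le_trans (archi_boundP (normr_ge0 y))) // ler_nat.
- by apply: (hG _).2; rewrite -ltr_norml.
Unshelve. all: by end_near.
Qed.

Lemma cprim_exists g : ccont g -> exists G, G 0 = 0 /\ forall x, cder G x (g x).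
Proof.
move=> [/antiderivative[F1 [F10 h1]] /antiderivative[F2 [F20 h2]]].
exists (fun x => Complex (F1 x) (F2 x) : C); split=> [|x].
  by rewrite F10 F20.
split; [exact: h1|exact: h2].
Qed.

(** [cprim g x] stands for the integral of [g] from 0 to [x]. Characterized by its derivative, it is
    linear by uniqueness of primitives and needs no integration theory for complex values. The
    default [g] occurs only if there is no primitive. *)
Definition cprim g : R -> C :=
  xget g [set G | G 0 = 0 /\ forall x, cder G x (g x)].

Lemma cprim0 g : ccont g -> cprim g 0 = 0.
Proof. by move=> /cprim_exists[G hG]; rewrite /cprim; case: xgetP => [? _ []|/(_ G)]. Qed.

Lemma cprimP g x : ccont g -> cder (cprim g) x (g x).
Proof. by move=> /cprim_exists[G hG]; rewrite /cprim; case: xgetP => [? _ []|/(_ G)]. Qed.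

Lemma cprimE G g x : ccont g -> G 0 = 0 -> (forall x, cder G x (g x)) -> cprim g x = G x.
Proof.
move=> gc G0 hG; apply: (@cder_uniq _ _ g) => // [y|]; first exact: cprimP.
by rewrite cprim0.
Qed.

Lemma cprimD g h x : ccont g -> ccont h ->
  cprim (fun x => g x + h x) x = cprim g x + cprim h x.
Proof.
move=> gc hc; apply: (@cprimE (fun x => cprim g x + cprim h x)).
- exact: ccontD.
- by rewrite !cprim0 // addr0.
- by move=> y; apply: cderD; exact: cprimP.
Qed.

Lemma cprimZ (c : C) g x : ccont g -> cprim (fun x => c * g x) x = c * cprim g x.
Proof.
move=> gc; apply: (@cprimE (fun x => c * cprim g x)).
- by apply: ccontM => //; exact: ccont_cst.
- by rewrite !cprim0 // mulr0.
- by move=> y; apply: cderZ; exact: cprimP.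
Qed.

Lemma cprim_sum I (s : seq I) (F : I -> R -> C) x : (forall i, ccont (F i)) ->
  cprim (fun x => \sum_(i <- s) F i x) x = \sum_(i <- s) cprim (F i) x.
Proof.
move=> h; elim: s => [|i s IH].
  rewrite big_nil; apply: (@cprimE (fun=> 0)) => //.
    exact: ccont_sum.
  by move=> y; rewrite big_nil; exact: cder_cst.
rewrite big_cons -IH -cprimD //; last exact: ccont_sum.
by congr cprim; apply/funext => y; rewrite big_cons.
Qed.

Lemma cprim_bound g x B : ccont g -> 0 <= x ->
  (forall y, 0 <= y <= x -> cabs (g y) <= B) -> cabs (cprim g x) <= 2 * B * x.
Proof.
move=> gc x0 hB; have := cder_bound x0 (fun y => cprimP y gc) hB.
by rewrite cprim0 // !subr0.
Qed.

End real_variable.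

(** * Bisection of rectangles and entire functions of one variable *)

Section goursat.
Variable R : realType.
Local Notation C := (Cplx R).

(** [P x y s] speaks of the rectangle with lower left corner (x, y) and sides [s * p], [s * q]. A
    failing rectangle has a failing quarter; nested failing quarters shrink to a point, around which
    the second premise excludes failure. *)
Lemma bisection (p q : R) (P : R -> R -> R -> Prop) : 0 <= p -> 0 <= q ->
  (forall x y s, 0 < s -> P x y (s / 2) -> P (x + s / 2 * p) y (s / 2) ->
    P x (y + s / 2 * q) (s / 2) -> P (x + s / 2 * p) (y + s / 2 * q) (s / 2) ->
    P x y s) ->
  (forall x y, exists2 d, 0 < d & forall x' y' s, 0 < s < d ->
    x' <= x <= x' + s * p -> y' <= y <= y' + s * q -> P x' y' s) ->
  forall x y s, 0 < s -> P x y s.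
Proof.
move=> p0 q0 Pq Ploc x0 y0 s0 s0_gt0; apply: contrapT => nP.
(* [u] is the corner of a failing quarter of [c]; (0, 0) is a dummy for the cases with contradictory
   premises. *)
have step (c : R * R * R) : exists u : R * R, 0 < c.2 -> ~ P c.1.1 c.1.2 c.2 ->
    [/\ ~ P u.1 u.2 (c.2 / 2), c.1.1 <= u.1 <= c.1.1 + c.2 / 2 * p &
      c.1.2 <= u.2 <= c.1.2 + c.2 / 2 * q].
  case: c => -[x y] s /=; have [s_gt0|_] := boolP (0 < s); last by exists (0, 0).
  have hp : 0 <= s / 2 * p by rewrite mulr_ge0 // divr_ge0 // ltW.
  have hq : 0 <= s / 2 * q by rewrite mulr_ge0 // divr_ge0 // ltW.
  have [P1|P1] := pselect (P x y (s / 2)); last first.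
    by exists (x, y) => _ _ /=; rewrite !lexx !lerDl hp hq.
  have [P2|P2] := pselect (P (x + s / 2 * p) y (s / 2)); last first.
    by exists (x + s / 2 * p, y) => _ _ /=; rewrite !lexx !lerDl hp hq.
  have [P3|P3] := pselect (P x (y + s / 2 * q) (s / 2)); last first.
    by exists (x, y + s / 2 * q) => _ _ /=; rewrite !lexx !lerDl hp hq.
  have [P4|P4] := pselect (P (x + s / 2 * p) (y + s / 2 * q) (s / 2)); last first.
    by exists (x + s / 2 * p, y + s / 2 * q) => _ _ /=; rewrite !lexx !lerDl hp hq.
  by exists (0, 0) => _ []; apply: Pq.
have [nx hnx] := choice step.
pose u := fix u n := if n is n'.+1 then (nx (u n'), (u n').2 / 2) else (x0, y0, s0).
have us n : (u n).2 = s0 / 2 ^+ n.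
  elim: n => [|n /= ->]; first by rewrite divr1.
  by rewrite exprSr invfM mulrA.
have us0 n : 0 < (u n).2 by rewrite us divr_gt0 // exprn_gt0.
have uP n : ~ P (u n).1.1 (u n).1.2 (u n).2.
  by elim: n => //= n IH; case: (hnx (u n) (us0 n) IH).
have usS n : (u n.+1).2 = (u n).2 / 2 by [].
have ux n : (u n).1.1 <= (u n.+1).1.1 <= (u n).1.1 + (u n).2 / 2 * p.
  by case: (hnx (u n) (us0 n) (uP n)).
have uy n : (u n).1.2 <= (u n.+1).1.2 <= (u n).1.2 + (u n).2 / 2 * q.
  by case: (hnx (u n) (us0 n) (uP n)).
(* Left ends never decrease and right ends never increase, so the supremum of the left ends lies in
   all the intervals. *)
have cross (v : nat -> R) r : 0 <= r ->
    (forall n, v n <= v n.+1 <= v n + (u n).2 / 2 * r) ->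
    exists X, forall n, v n <= X <= v n + (u n).2 * r.
  move=> r0 hv.
  have vi m k : v m <= v (m + k)%N.
    elim: k => [|k IH]; first by rewrite addn0.
    by rewrite addnS (le_trans IH) //; case/andP: (hv (m + k)%N).
  have vd m k : v (m + k)%N + (u (m + k)%N).2 * r <= v m + (u m).2 * r.
    elim: k => [|k IH]; first by rewrite addn0.
    rewrite addnS (le_trans _ IH) //.
    case/andP: (hv (m + k)%N) => _ h.
    rewrite usS; rewrite -lerBrDr; apply: (le_trans h); lra.
  have vv m n : v m <= v n + (u n).2 * r.
    rewrite (le_trans (vi m n)) // (le_trans _ (vd n m)) // addnC.
    by rewrite lerDl mulr_ge0 // ltW.
  exists (sup (range v)) => n; apply/andP; split.
    apply: ub_le_sup; last by exists n.
    by exists (v 0 + (u 0).2 * r) => _ [m _ <-].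
  apply: ge_sup; first by exists (v 0); exists 0.
  by move=> _ [m _ <-].
have [X hX] := cross (fun n => (u n).1.1) p p0 ux.
have [Y hY] := cross (fun n => (u n).1.2) q q0 uy.
have [d d0 hd] := Ploc X Y.
have [n hn] : exists n, (u n).2 < d.
  exists (Num.bound (s0 / d)).
  rewrite us ltr_pdivrMr ?exprn_gt0 // mulrC -ltr_pdivrMr //.
  apply: (lt_trans (archi_boundP _)); first by rewrite divr_ge0 // ltW.
  by rewrite -natrX ltr_nat ltn_expl.
apply: (uP n); apply: hd => //; first by rewrite us0.
Qed.

(** Complex differentiability without continuity of the derivative: exactly what a differentiable
    function of several variables gives on a complex line. *)
Definition entire (f : C -> C) := forall t0 : C, exists d : C, forall e : R, 0 < e ->
  exists2 r : R, 0 < r & forall t, cabs (t - t0) < r ->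
    cabs (f t - f t0 - d * (t - t0)) <= e * cabs (t - t0).

Lemma entire_continuous f t0 (e : R) : entire f -> 0 < e ->
  exists2 r : R, 0 < r & forall t, cabs (t - t0) < r -> cabs (f t - f t0) < e.
Proof.
move=> /(_ t0)[d hd] e0; have [r r0 hr] := hd 1 ltr01.
have D0 : 0 < cabs d + 1 by rewrite ltr_wpDl // cabs_ge0.
exists (Num.min r (e / (cabs d + 1))); first by rewrite lt_min r0 divr_gt0.
move=> t; rewrite lt_min => /andP[/hr h1].
rewrite ltr_pdivlMr // => h2; apply: le_lt_trans h2.
rewrite (_ : f t - f t0 = (f t - f t0 - d * (t - t0)) + d * (t - t0)); last by ring.
rewrite (le_trans (cabsD _ _)) // cabsM; move: h1; rewrite mul1r => h1.
rewrite [leRHS](_ : _ = cabs (t - t0) + cabs d * cabs (t - t0)) ?lerD2r //; ring.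
Qed.

Lemma nbhs_dist_lt (x r : R) : 0 < r -> \forall y \near x, `|y - x| < r.
Proof.
move=> r0; apply: filterS (nbhsx_ballx x r r0) => y.
by rewrite -ball_normE /= distrC.
Qed.

Lemma ccontP (g : R -> C) :
  (forall x (e : R), 0 < e -> exists2 r : R, 0 < r &
    forall y, `|y - x| < r -> cabs (g y - g x) < e) -> ccont g.
Proof.
move=> h; split=> x; apply/cvgrPdist_lt => e e0; have [r r0 hr] := h x e e0.
  apply: filterS (nbhs_dist_lt x r0) => y yx.
  by rewrite -CreB (le_lt_trans (Cre_le_cabs _)) // cabsC hr.
apply: filterS (nbhs_dist_lt x r0) => y yx.
by rewrite -CimB (le_lt_trans (Cim_le_cabs _)) // cabsC hr.
Qed.

Definition cis (x : R) : C := Complex (cos x) (sin x).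

Lemma cis_conj x : (cis x)^* * cis x = 1.
Proof.
rewrite conjC_mul cabs_sqr /= cos2Dsin2 //.
Qed.

Lemma cabs_cis x : cabs (cis x) = 1.
Proof. by rewrite cabsE /= cos2Dsin2 sqrtr1. Qed.

Lemma cder_cis x : cder cis x ('i * cis x).
Proof.
split.
  have := @is_derive_cos R x; rewrite CreM /=. by rewrite mul0r mul1r sub0r.
have := @is_derive_sin R x; rewrite CimM /=; by rewrite mul0r mul1r add0r.
Qed.

Lemma cis2pi : cis (2 * pi) = cis 0.
Proof. by rewrite /cis mulrC mulr_natr cos2pi sin2pi cos0 sin0. Qed.

Lemma cis_lip x y : cabs (cis x - cis y) <= 2 * `|x - y|.
Proof.
wlog : x y / y <= x.
  move=> h; have [/h //|/ltW /h] := leP y x.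
  by rewrite cabsC distrC.
move=> yx; rewrite [`|_|]ger0_norm ?subr_ge0 //.
have := @cder_bound _ cis (fun x => 'i * cis x) y x 1 yx (@cder_cis).
by rewrite mulr1; apply => t _; rewrite cabsM cabs_i cabs_cis mulr1.
Qed.

End goursat.

(** * Cauchy's formula and Taylor expansions of entire functions *)

Section cauchy.
Variable R : realType.
Local Notation C := (Cplx R).

Section kernel.
Variables (f : C -> C) (z : C).
Hypothesis fE : entire f.
Hypothesis z1 : cabs z < 1.

Let m : R := 1 - cabs z.
Let m0 : 0 < m. Proof. by rewrite subr_gt0. Qed.

Lemma cabs_cis_sub th : m <= cabs (cis th - z).
Proof.
rewrite lerBlDr -(cabs_cis th) -[X in cabs X <= _](subrK z); exact: cabsD.
Qed.

Lemma cis_sub_neq0 th : cis th - z != 0.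
Proof. by rewrite -cabs_gt0 (lt_le_trans m0) // cabs_cis_sub. Qed.

(** With w - z = e^s (cis th - z), the form dw / (w - z) equals ds + [kap th] dth. Letting s go from
    0 to minus infinity contracts the unit circle to [z]. *)
Let kap (th : R) : C := 'i * cis th / (cis th - z).
Let w (s th : R) : C := z + RtoC (expR s) * (cis th - z).

Let kap_bound th : cabs (kap th) <= m^-1.
Proof.
rewrite /kap !cabsM cabs_i cabs_cis !mul1r cabsV.
by rewrite lef_pV2 ?cabs_cis_sub // posrE ?(lt_le_trans m0) // cabs_cis_sub.
Qed.

Let w_sub s th : w s th - z = RtoC (expR s) * (cis th - z).
Proof. by rewrite /w; ring. Qed.

Let kap_mul s th : (w s th - z) * kap th = RtoC (expR s) * ('i * cis th).
Proof. by rewrite w_sub /kap; field; exact: cis_sub_neq0. Qed.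

Let cder_exp (c : C) s : cder (fun s => RtoC (expR s) * c) s (RtoC (expR s) * c).
Proof.
apply: cderZr; split; first exact: is_derive_expR.
exact: is_derive_cst.
Qed.

Let cder_w1 th s : cder (w^~ th) s (w s th - z).
Proof.
by rewrite w_sub -[X in cder _ _ X]add0r; apply: cderD; [exact: cder_cst|exact: cder_exp].
Qed.

Let cder_w2 s th : cder (w s) th ((w s th - z) * kap th).
Proof.
rewrite kap_mul -[X in cder _ _ X]add0r; apply: cderD; first exact: cder_cst.
apply: cderZ; rewrite -[X in cder _ _ X]subr0.
by apply: cderB; [exact: cder_cis|exact: cder_cst].
Qed.

Let exp_lip S (s s' : R) : s <= S -> s' <= S -> `|expR s - expR s'| <= expR S * `|s - s'|.
Proof.
wlog : s s' / s' <= s.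
  move=> h; have [/h //|/ltW ss' sS s'S] := leP s' s.
  by rewrite distrC [`|s - s'|]distrC; apply: h.
move=> ss' sS s'S; rewrite [`|s - s'|]ger0_norm ?subr_ge0 //.
apply: (@MVT_bound _ expR expR) => // t /andP[_ ts].
by rewrite ger0_norm ?expR_ge0 // ler_expR (le_trans ts).
Qed.

Let w_lip S s th s' th' : s <= S -> s' <= S ->
  cabs (w s th - w s' th') <= 2 * expR S * (`|s - s'| + `|th - th'|).
Proof.
move=> sS s'S.
rewrite (_ : w s th - w s' th' = RtoC (expR s - expR s') * (cis th - z) +
   RtoC (expR s') * (cis th - cis th')); last by rewrite RtoCB /w; ring.
rewrite [leRHS]mulrDr (le_trans (cabsD _ _)) // lerD // cabsM cabs_RtoC.
  rewrite mulrC -mulrA ler_pM //; first exact: cabs_ge0.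
    by rewrite (le_trans (cabsB _ _)) // cabs_cis (_ : 2 = 1 + 1 :> R) // lerD2l ltW.
  exact: exp_lip.
rewrite [2 * _]mulrC -mulrA ger0_norm ?expR_ge0 // ler_pM ?expR_ge0 ?cabs_ge0 //.
  by rewrite ler_expR.
exact: cis_lip.
Qed.

Let w_cont1 th s (e : R) : 0 < e -> exists2 r : R, 0 < r &
  forall s', `|s' - s| < r -> cabs (w s' th - w s th) < e.
Proof.
move=> e0; have E0 : 0 < 2 * expR (s + 1) by rewrite mulr_gt0 // expR_gt0.
exists (Num.min 1 (e / (2 * expR (s + 1)))); first by rewrite lt_min ltr01 divr_gt0.
move=> s'; rewrite lt_min ltr_pdivlMr // => /andP[h1 h2].
have := @w_lip (s + 1) s' th s th; rewrite subrr normr0 addr0 => h.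
rewrite (le_lt_trans (h _ _)) ?lerDl //; last by rewrite mulrC.
by move: h1; rewrite ltr_norml => /andP[_ h1]; lra.
Qed.

Let w_cont2 s th (e : R) : 0 < e -> exists2 r : R, 0 < r &
  forall th', `|th' - th| < r -> cabs (w s th' - w s th) < e.
Proof.
move=> e0; have E0 : 0 < 2 * expR s by rewrite mulr_gt0 // expR_gt0.
exists (e / (2 * expR s)); first by rewrite divr_gt0.
move=> th'; rewrite ltr_pdivlMr // => h2.
have := @w_lip s s th' s th; rewrite subrr normr0 add0r => h.
by rewrite (le_lt_trans (h _ _)) // mulrC.
Qed.

Let ccont_fw1 th : ccont (fun s => f (w s th)).
Proof.
apply: ccontP => s e e0; have [r r0 hr] := entire_continuous (w s th) fE e0.
have [r' r'0 hr'] := w_cont1 th s r0.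
by exists r' => // y /hr' /hr.
Qed.

Let kap_cont th (e : R) : 0 < e -> exists2 r : R, 0 < r &
  forall th', `|th' - th| < r -> cabs (kap th' - kap th) < e.
Proof.
move=> e0; exists (e * m ^+ 2 / 2); first by rewrite divr_gt0 // mulr_gt0 // exprn_gt0.
move=> t; rewrite ltr_pdivlMr // => h.
rewrite (_ : kap t - kap th = 'i * z * (cis th - cis t) / ((cis t - z) * (cis th - z))); last first.
  by rewrite /kap; field; rewrite !cis_sub_neq0.
rewrite cabsM cabsV ltr_pdivrMr; last by rewrite cabs_gt0 mulf_neq0 // cis_sub_neq0.
apply: (@lt_le_trans _ _ (e * m ^+ 2)); last first.
  by rewrite ler_wpM2l ?(ltW e0) // cabsM expr2 ler_pM ?(ltW m0) // cabs_cis_sub.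
apply: le_lt_trans h; rewrite !cabsM cabs_i mul1r -[leRHS]mul1r ler_pM ?cabs_ge0 ?(ltW z1) //.
by rewrite (le_trans (cis_lip _ _)) // distrC mulrC.
Qed.

Let ccont_kap : ccont kap. Proof. exact: ccontP. Qed.

Let ccont_fw2 s : ccont (fun th => f (w s th) * kap th).
Proof.
apply: ccontM => //; apply: ccontP => x d d0.
have [r r0 hr] := entire_continuous (w s x) fE d0.
have [r' r'0 hr'] := w_cont2 s x r0.
by exists r' => // y /hr' /hr.
Qed.

Let H (th : R) : R -> C := cprim (fun s => f (w s th)).
Let V (s : R) : R -> C := cprim (fun th => f (w s th) * kap th).
Let K : R -> C := cprim kap.

(* the integral of f(w) dw / (w - z) around a rectangle, in the coordinates
   w = z + e^s (e^(i th) - z) *)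
Let circ s1 s2 t1 t2 : C := (H t1 s2 - H t1 s1) - (H t2 s2 - H t2 s1) +
   ((V s2 t2 - V s2 t1) - (V s1 t2 - V s1 t1)).

(** For an affine function in place of [f] the circulation vanishes, because [L] below is a
    primitive. Only the deviation of [f] from its tangent at [w0] remains; it is small of order l,
    on sides of length of order l. *)
Let circ_local (p q : R) : 0 <= p -> 0 <= q -> forall e, 0 < e -> forall s0 t0 : R,
  exists2 d, 0 < d & forall s' t' l, 0 < l < d ->
    s' <= s0 <= s' + l * p -> t' <= t0 <= t' + l * q ->
    cabs (circ s' (s' + l * p) t' (t' + l * q)) <= e * l ^+ 2.
Proof.
move=> p0 q0 e e0 s0 t0.
(* On a small rectangle s stays below [S], and [D * l] bounds the distance from [w] to [w0]. In [M]
   the two sides along s contribute [4 * D * p], those along th [4 * (D / m) * q], as [m^-1] bounds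
   [kap]. *)
pose S := s0 + 1; pose w0 := w s0 t0; pose D := 2 * expR S * (p + q).
have D0 : 0 <= D by rewrite mulr_ge0 ?addr_ge0 // mulr_ge0 // expR_ge0.
pose M := 4 * D * p + 4 * (D / m) * q.
have M0 : 0 <= M.
  by rewrite addr_ge0 // mulr_ge0 // mulr_ge0 // divr_ge0 // ltW.
have [fd hfd] := fE w0.
pose e1 := e / (M + 1).
have M1 : 0 < M + 1 by rewrite ltr_wpDl.
have e10 : 0 < e1 by rewrite divr_gt0.
have [r r0 hr] := hfd e1 e10.
exists (Num.min (1 / (p + 1)) (r / (D + 1))).
  by rewrite lt_min !divr_gt0 // ltr_wpDl.
move=> s' t' l; rewrite lt_min => /and3P[l0 lp lr] /andP[s1 s2] /andP[t1 t2].
have lp1 : l * p <= 1.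
  rewrite ltr_pdivlMr in lp; last by rewrite ltr_wpDl.
  by rewrite mulrDr mulr1 in lp; lra.
have lD : D * l < r.
  rewrite ltr_pdivlMr in lr; last by rewrite ltr_wpDl.
  by rewrite mulrDr mulr1 in lr; rewrite mulrC; lra.
have lp0 : 0 <= l * p by rewrite mulr_ge0 // ltW.
have lq0 : 0 <= l * q by rewrite mulr_ge0 // ltW.
have wD s t : s' <= s <= s' + l * p -> t' <= t <= t' + l * q ->
    cabs (w s t - w0) <= D * l.
  move=> /andP[a1 a2] /andP[a3 a4].
  rewrite (le_trans (@w_lip S _ _ _ _ _ _)) //; [rewrite /S; lra|by rewrite /S lerDl|].
  rewrite /D -[leRHS]mulrA ler_wpM2l // ?mulr_ge0 ?expR_ge0 //.
  rewrite mulrDl [p * l]mulrC [q * l]mulrC lerD //; rewrite ler_norml; apply/andP; split; lra.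
(* Since w - w0 = (w - z) - (w0 - z), the tangent is a constant plus a multiple of w - z. Against dw
   / (w - z) the constant 1 has the primitive [RtoC s + K t], and w - z has the primitive [w]. *)
pose L s t : C := (f w0 - fd * (w0 - z)) * (RtoC s + K t) + fd * w s t.
have E s t : s' <= s <= s' + l * p -> t' <= t <= t' + l * q ->
    cabs (f (w s t) - (f w0 + fd * (w s t - w0))) <= e1 * (D * l).
  move=> a1 a2; have b := wD _ _ a1 a2.
  have -> : f (w s t) - (f w0 + fd * (w s t - w0)) = f (w s t) - f w0 - fd * (w s t - w0) by ring.
  rewrite (le_trans (hr _ _)) ?ler_wpM2l ?(ltW e10) //.
  exact: le_lt_trans lD.
have cL1 t s : cder (L^~ t) s (f w0 + fd * (w s t - w0)).
  have -> : f w0 + fd * (w s t - w0) = (f w0 - fd * (w0 - z)) * (1 + 0) + fd * (w s t - z) by ring.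
  apply: cderD; apply: cderZ => //; apply: cderD; last exact: cder_cst.
  by split; [exact: is_derive_id|exact: is_derive_cst].
have cL2 s t : cder (L s) t ((f w0 + fd * (w s t - w0)) * kap t).
  have -> : (f w0 + fd * (w s t - w0)) * kap t =
    (f w0 - fd * (w0 - z)) * (0 + kap t) + fd * ((w s t - z) * kap t) by ring.
  apply: cderD; apply: cderZ => //; apply: cderD; first exact: cder_cst.
  exact: cprimP.
have hH t : t' <= t <= t' + l * q ->
    cabs ((H t (s' + l * p) - L (s' + l * p) t) - (H t s' - L s' t)) <= 2 * (e1 * (D * l)) * (l * p).
  move=> ht.
  have -> : 2 * (e1 * (D * l)) * (l * p) = 2 * (e1 * (D * l)) * (s' + l * p - s') by ring.
  apply: (@cder_bound _ (fun s => H t s - L s t)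
     (fun s => f (w s t) - (f w0 + fd * (w s t - w0)))).
  - by rewrite lerDl.
  - by move=> s; apply: cderB => //; exact: cprimP.
  - by move=> s hs; apply: E.
have hV s : s' <= s <= s' + l * p ->
    cabs ((V s (t' + l * q) - L s (t' + l * q)) - (V s t' - L s t')) <= 2 * (e1 * (D * l) / m) * (l * q).
  move=> hs.
  have -> : 2 * (e1 * (D * l) / m) * (l * q) = 2 * (e1 * (D * l) / m) * (t' + l * q - t') by ring.
  apply: (@cder_bound _ (fun t => V s t - L s t)
     (fun t => f (w s t) * kap t - (f w0 + fd * (w s t - w0)) * kap t)).
  - by rewrite lerDl.
  - by move=> t; apply: cderB => //; exact: cprimP.
  - by move=> t ht; rewrite -mulrBl cabsM ler_pM ?cabs_ge0 ?kap_bound // E.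
pose h1 := H t' (s' + l * p) - L (s' + l * p) t' - (H t' s' - L s' t').
pose h2 := H (t' + l * q) (s' + l * p) - L (s' + l * p) (t' + l * q) - (H (t' + l * q) s' - L s' (t' + l * q)).
pose v1 := V (s' + l * p) (t' + l * q) - L (s' + l * p) (t' + l * q) - (V (s' + l * p) t' - L (s' + l * p) t').
pose v2 := V s' (t' + l * q) - L s' (t' + l * q) - (V s' t' - L s' t').
have -> : circ s' (s' + l * p) t' (t' + l * q) = (h1 - h2) + (v1 - v2).
  by rewrite /circ /h1 /h2 /v1 /v2; ring.
have b1 : cabs h1 <= 2 * (e1 * (D * l)) * (l * p) by apply: hH; lra.
have b2 : cabs h2 <= 2 * (e1 * (D * l)) * (l * p) by apply: hH; lra.
have b3 : cabs v1 <= 2 * (e1 * (D * l) / m) * (l * q) by apply: hV; lra.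
have b4 : cabs v2 <= 2 * (e1 * (D * l) / m) * (l * q) by apply: hV; lra.
have -> : e * l ^+ 2 = (M + 1) * e1 * l ^+ 2.
  by rewrite /e1; field; rewrite gt_eqF.
have c0 : 0 <= e1 * l ^+ 2 by rewrite mulr_ge0 ?sqr_ge0 // ltW.
apply: (@le_trans _ _ (M * (e1 * l ^+ 2))); last first.
  by rewrite -[(M + 1) * e1 * _]mulrA ler_wpM2r // lerDl.
have -> : M * (e1 * l ^+ 2) = (2 * (e1 * (D * l)) * (l * p) + 2 * (e1 * (D * l)) * (l * p))
   + (2 * (e1 * (D * l) / m) * (l * q) + 2 * (e1 * (D * l) / m) * (l * q)).
  by rewrite /M; ring.
by rewrite (le_trans (cabsD _ _)) // lerD // (le_trans (cabsB _ _)) // lerD.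
Qed.

(** Circulation is additive under quartering, and four bounds e (l/2)^2 add up to e l^2. Bisection
    thus gives the bound e at scale 1, for every e. *)
Let circ0 s1 s2 t1 t2 : s1 <= s2 -> t1 <= t2 -> circ s1 s2 t1 t2 = 0.
Proof.
move=> s12 t12; apply: cabs_lt_eq0 => e e0.
pose p := s2 - s1; pose q := t2 - t1.
have p0 : 0 <= p by rewrite subr_ge0.
have q0 : 0 <= q by rewrite subr_ge0.
have := @bisection R p q
  (fun s t l => cabs (circ s (s + l * p) t (t + l * q)) <= e * l ^+ 2) p0 q0 _
  (circ_local p0 q0 e0) s1 t1 1 ltr01.
have -> : s1 + 1 * p = s2 by rewrite /p; ring.
have -> : t1 + 1 * q = t2 by rewrite /q; ring.
rewrite expr1n mulr1; apply.
move=> x y l l0 a1 a2 a3 a4.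
pose h := l / 2.
have E1 : x + l * p = x + h * p + h * p by rewrite /h; field.
have E2 : y + l * q = y + h * q + h * q by rewrite /h; field.
rewrite -/h -/p -/q in a1 a2 a3 a4 *.
have -> : circ x (x + l * p) y (y + l * q) =
  (circ x (x + h * p) y (y + h * q) + circ (x + h * p) (x + h * p + h * p) y (y + h * q))
  + (circ x (x + h * p) (y + h * q) (y + h * q + h * q) +
  circ (x + h * p) (x + h * p + h * p) (y + h * q) (y + h * q + h * q)).
  by rewrite E1 E2 /circ; move: H V => H' V'; ring.
have -> : e * l ^+ 2 = (e * h ^+ 2 + e * h ^+ 2) + (e * h ^+ 2 + e * h ^+ 2).
  by rewrite /h; field.
apply: le_trans (cabsD _ _) _; apply: lerD.
  by apply: le_trans (cabsD _ _) _; apply: lerD; [exact: a1|exact: a2].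
by apply: le_trans (cabsD _ _) _; apply: lerD; [exact: a3|exact: a4].
Qed.

(** The sides at angles 0 and 2 pi cancel by periodicity, so the angular integral is the same for
    all s <= 0; for very negative s the argument of [f] is close to [z]. The kernel integral on the
    right stays unevaluated: it will be expanded together with the left side. *)
Lemma cauchy_kernel :
  cprim (fun th => f (cis th) * ('i * cis th / (cis th - z))) (2 * pi) =
  f z * cprim (fun th => 'i * cis th / (cis th - z)) (2 * pi).
Proof.
have pi2 : 0 <= 2 * pi :> R by rewrite mulr_ge0 // pi_ge0.
have -> : cprim (fun th => f (cis th) * ('i * cis th / (cis th - z))) = V 0.
  by congr cprim; apply/funext => th; rewrite /w expR0 (_ : z + _ = cis th) // RtoC1; ring.
have V00 s : V s 0 = 0 by rewrite /V cprim0.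
have HH : H (2 * pi) = H 0.
  by congr cprim; apply/funext => th; rewrite /w cis2pi.
have VV s : s <= 0 -> V 0 (2 * pi) = V s (2 * pi).
  move=> s0; have := circ0 s0 pi2.
  rewrite /circ HH subrr add0r !V00 !subr0 => /eqP.
  by rewrite subr_eq0 => /eqP.
rewrite -/kap -/K.
apply/eqP; rewrite -subr_eq0; apply/eqP; apply: cabs_lt_eq0 => e e0.
pose M := 2 / m * (2 * pi).
have M0 : 0 <= M by rewrite mulr_ge0 // divr_ge0 // ltW.
have M1 : 0 < M + 1 by rewrite ltr_wpDl.
have [r r0 hr] := entire_continuous z fE (divr_gt0 e0 M1).
(* This makes [expR s * 2 < r], while [cis th - z] has modulus at most 2. *)
pose s := Num.min 0 (ln (r / 4)).
have r4 : 0 < r / 4 by rewrite divr_gt0.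
have es : expR s * 2 < r.
  have : expR s <= r / 4 by rewrite -[leRHS]lnK ?posrE // ler_expR /s ge_min lexx orbT.
  lra.
rewrite (VV s) /s ?ge_min ?lexx // -/s.
have -> : V s (2 * pi) - f z * K (2 * pi) =
   (V s (2 * pi) - f z * K (2 * pi)) - (V s 0 - f z * K 0).
  by rewrite V00 /K cprim0 // mulr0 !subr0.
have := @cder_bound _ (fun t => V s t - f z * K t)
   (fun t => f (w s t) * kap t - f z * kap t) 0 (2 * pi) (e / (M + 1) / m) pi2.
move=> h; rewrite (le_trans (h _ _)) //.
- by move=> t; apply: cderB; [exact: cprimP|apply: cderZ; exact: cprimP].
- move=> t _; rewrite -mulrBl cabsM ler_pM ?cabs_ge0 ?kap_bound // ltW // hr //.
  rewrite w_sub cabsM cabs_RtoC ger0_norm ?expR_ge0 // (le_lt_trans _ es) //.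
  rewrite ler_wpM2l ?expR_ge0 // (le_trans (cabsB _ _)) // cabs_cis.
  by rewrite (_ : 2 = 1 + 1 :> R) // lerD2l ltW.
- rewrite subr0 (_ : _ * (2 * pi) = e * (M / (M + 1))); last first.
    by rewrite [in RHS](_ : M / (M + 1) = 2 / m * (2 * pi) / (M + 1)) //; field; rewrite !gt_eqF.
  by rewrite -[leRHS]mulr1 ler_wpM2l ?(ltW e0) // ler_pdivrMr // mul1r lerDl.
Qed.

Lemma ccont_kernel : ccont (fun th => 'i * cis th / (cis th - z)).
Proof. exact: ccont_kap. Qed.

End kernel.

End cauchy.

(** * Taylor expansions with geometric remainders *)

Section taylor.
Variable R : realType.
Local Notation C := (Cplx R).

Lemma cabs_exp_small (x : R) : 0 <= x < 1 -> forall e, 0 < e -> exists n, x ^+ n < e.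
Proof.
move=> /andP[x0 x1] e e0.
have /cvgrPdist_lt /(_ e e0) [n _ hn] : (fun n => x ^+ n) @ \oo --> (0 : R).
  by apply: cvg_expr; rewrite ger0_norm.
exists n; have := hn n (leqnn n).
by rewrite sub0r normrN ger0_norm // exprn_ge0.
Qed.

Lemma ccont_cis : ccont (@cis R).
Proof. exact: (cder_ccont (@cder_cis R)). Qed.

Lemma ccont_conjX k : ccont (fun th => (cis th : C)^* ^+ k).
Proof.
elim: k => [|k IH]; first exact: ccont_cst.
rewrite (_ : (fun th => _) = fun th => (cis th : C)^* * (cis th)^* ^+ k); last first.
  by apply/funext => th; rewrite exprS.
apply: ccontM => //; split.
  exact: (ccont_cis).1.
move=> x /=; apply: continuousN; exact: (ccont_cis).2.
Qed.

Lemma cder_conj_cis (x : R) : cder (fun th => (cis th : C)^*) x (- 'i * (cis x)^*).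
Proof.
have [h1 h2] := cder_cis x; split.
  rewrite (_ : Cre _ = Cre ('i * cis x)) //.
  by rewrite CreM CreM CreN CimN Cre_conj Cim_conj /=; ring.
rewrite (_ : Cim (- 'i * (cis x)^*) = - Cim ('i * cis x)); last first.
  by rewrite !CimM CreN CimN Cre_conj Cim_conj /=; ring.
exact: is_deriveN.
Qed.

Lemma cder_conjX_cis k (x : R) :
  cder (fun th => (cis th : C)^* ^+ k) x (- 'i * k%:R * (cis x)^* ^+ k).
Proof.
elim: k => [|k IH]; first by rewrite mulr0 mul0r; exact: cder_cst.
apply: (@cder_ext _ (fun th => (cis th : C)^* * (cis th)^* ^+ k)).
  by move=> y; rewrite exprS.
have -> : - 'i * k.+1%:R * (cis x : C)^* ^+ k.+1 =
   (- 'i * (cis x)^*) * (cis x)^* ^+ k + (cis x)^* * (- 'i * k%:R * (cis x)^* ^+ k).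
  by rewrite exprS -natr1; ring.
by apply: cderM => //; exact: cder_conj_cis.
Qed.

Lemma cprim_conjX_cis k : (0 < k)%N ->
  cprim (fun th => (cis th : C)^* ^+ k) (2 * pi) = 0.
Proof.
move=> k0; have k0' : k%:R != 0 :> C by rewrite pnatr_eq0 -lt0n.
pose c : C := 'i / k%:R.
pose G th : C := c * (cis th)^* ^+ k - c * (cis 0)^* ^+ k.
rewrite (@cprimE _ G); first by rewrite /G cis2pi subrr.
- exact: ccont_conjX.
- by rewrite /G subrr.
- move=> x; rewrite -[X in cder _ _ X]subr0; apply: cderB; last exact: cder_cst.
  have -> : (cis x : C)^* ^+ k = c * (- 'i * k%:R * (cis x)^* ^+ k).
    have -> : c * (- 'i * k%:R * (cis x)^* ^+ k) = - ('i * 'i) * (cis x)^* ^+ k.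
      by rewrite /c; field.
    by rewrite -expr2 sqrCi opprK mul1r.
  by apply: cderZ; exact: cder_conjX_cis.
Qed.

(** The squared modulus is continuous on [-pi, pi], and every point of the circle is [cis] of plus
    or minus the arc cosine of its real part. The bound [g c + 1] comes from x <= x^2 + 1. *)
Lemma entire_bounded_circle (f : C -> C) : entire f ->
  exists B, forall t, cabs t = 1 -> cabs (f t) <= B.
Proof.
move=> fE.
have fc : ccont (fun th => f (cis th)).
  apply: ccontP => x e e0; have [r r0 hr] := entire_continuous (cis x) fE e0.
  exists (r / 2); first by rewrite divr_gt0.
  move=> y hy; apply: hr; rewrite (le_lt_trans (cis_lip _ _)) //.
  by rewrite mulrC -ltr_pdivlMr.
pose g th := Cre (f (cis th)) ^+ 2 + Cim (f (cis th)) ^+ 2.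
have gc : continuous g.
  move=> x; apply: cvgD; rewrite /GRing.exp /=.
    by apply: cvgM; exact: (fc.1).
  by apply: cvgM; exact: (fc.2).
have pipi : - pi <= pi :> R by rewrite ge0_cp // pi_ge0.
have [c _ hc] := EVT_max pipi (continuous_subspaceT gc).
exists (g c + 1) => t t1.
have [th /andP[th1 th2] ->] : exists2 th, - pi <= th <= pi & t = cis th.
  have t2 : Cre t ^+ 2 + Cim t ^+ 2 = 1 by rewrite -cabs_sqr t1 expr1n.
  have tx : -1 <= Cre t <= 1.
    by rewrite -ler_norml -[leRHS]t1 Cre_le_cabs.
  have sE : sin (acos (Cre t)) = `|Cim t|.
    by rewrite sin_acos // -t2 addrC addKr sqrtr_sqr.
  have [i0|i0] := leP 0 (Cim t).
    exists (acos (Cre t)).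
      by rewrite acos_lepi // andbT (le_trans _ (acos_ge0 tx)) // oppr_le0 pi_ge0.
    by apply: Ceq => /=; rewrite ?acosK ?sE ?ger0_norm.
  exists (- acos (Cre t)).
    by rewrite lerN2 acos_lepi //= (le_trans _ (pi_ge0 _)) // oppr_le0 acos_ge0.
  by apply: Ceq => /=; rewrite ?cosN ?sinN ?acosK ?sE ?ltr0_norm ?opprK.
have : cabs (f (cis th)) ^+ 2 <= g c.
  by rewrite cabs_sqr; apply: hc; rewrite in_itv /= th1.
have := cabs_ge0 (f (cis th)); have := sqr_ge0 (cabs (f (cis th)) - 1); nra.
Qed.

Lemma geo_tail_le (x B : R) N M : 0 <= x < 1 -> 0 <= B ->
  \sum_(N <= k < N + M) B * x ^+ k <= B * x ^+ N / (1 - x).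
Proof.
move=> /andP[x0 x1] B0; have d0 : 0 < 1 - x by rewrite subr_gt0.
rewrite -{1}[N]add0n big_addn addKn ler_pdivlMr // mulr_suml.
have -> : \sum_(0 <= i < M) B * x ^+ (i + N) * (1 - x) = B * x ^+ N * (1 - x ^+ M).
  elim: M => [|M IH]; first by rewrite big_geq // subrr mulr0.
  by rewrite big_nat_recr //= IH exprD exprS; ring.
rewrite -[leRHS]mulr1 ler_wpM2l ?mulr_ge0 ?exprn_ge0 // lerBlDr lerDl.
exact: exprn_ge0.
Qed.

(** The coefficients are the Fourier integrals of [f] on the unit circle. The geometric expansion of
    the Cauchy kernel is stopped after finitely many terms, so series and integrals are never
    interchanged. The factor 2 is that of [cprim_bound]. *)
Lemma taylor_disc1 (f : C -> C) (B : R) : entire f ->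
  (forall t, cabs t = 1 -> cabs (f t) <= B) ->
  exists a : nat -> C, (forall k, cabs (a k) <= 2 * B) /\
    forall z N, cabs z < 1 ->
      cabs (f z - \sum_(k < N) a k * z ^+ k) <= 2 * B * cabs z ^+ N / (1 - cabs z).
Proof.
move=> fE fB.
have pi0 : 0 < 2 * pi :> R by rewrite mulr_gt0 // pi_gt0.
have pi0' := ltW pi0.
have B0 : 0 <= B by rewrite (le_trans (cabs_ge0 (f 1))) // fB // cabs1.
have fc : ccont (fun th => f (cis th)).
  apply: ccontP => x e e0; have [r r0 hr] := entire_continuous (cis x) fE e0.
  exists (r / 2); first by rewrite divr_gt0.
  move=> y hy; apply: hr; rewrite (le_lt_trans (cis_lip _ _)) //.
  by rewrite mulrC -ltr_pdivlMr.
have fck k : ccont (fun th => f (cis th) * (cis th)^* ^+ k).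
  by apply: ccontM => //; exact: ccont_conjX.
pose A k := cprim (fun th => f (cis th) * (cis th)^* ^+ k) (2 * pi).
pose a k := RtoC (2 * pi)^-1 * A k.
have ab k : cabs (a k) <= 2 * B.
  rewrite /a cabsM cabs_RtoC ger0_norm ?invr_ge0 // mulrC ler_pdivrMr //.
  apply: cprim_bound => // y _.
  by rewrite cabsM cabsX cabs_conj cabs_cis expr1n mulr1 fB // cabs_cis.
exists a; split=> // z N z1.
have m0 : 0 < 1 - cabs z by rewrite subr_gt0.
(* This bound still contains [cabs (f z)], not yet controlled by [B]. It only makes the remainder
   after many terms negligible; the terms from [N] on are then summed with the coefficient
   bounds. *)
have main M : cabs (f z - \sum_(k < M.+1) a k * z ^+ k) <=
    2 * (cabs (f z) + B) / (1 - cabs z) * cabs z ^+ M.+1.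
  pose rho th : C := 'i * cis th / (cis th - z) * (cis th)^* ^+ M.+1.
  have rc : ccont rho by apply: ccontM; [exact: ccont_kernel|exact: ccont_conjX].
  have rB th : cabs (rho th) <= (1 - cabs z)^-1.
    rewrite !cabsM cabsX cabs_conj cabs_cis cabs_i cabsV expr1n !mul1r mulr1.
    rewrite lef_pV2 ?cabs_cis_sub // posrE ?(lt_le_trans m0) // cabs_cis_sub //.
  have kE th : 'i * cis th / (cis th - z) =
      \sum_(k < M.+1) 'i * z ^+ k * (cis th)^* ^+ k + z ^+ M.+1 * rho th.
    have n0 := cis_sub_neq0 z1 th; have cc := cis_conj th.
    elim: (M.+1) @rho {rc rB} => [|K IH] /=; first by rewrite big_ord0 add0r !expr0 mulr1 mul1r.
    rewrite big_ord_recr /= {1}IH -addrA; congr (_ + _).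
    (* One step of the geometric series: conjugation inverts [cis th], so the kernel is ['i] plus
       [z * (cis th)^*] times itself. *)
    have : 'i * cis th / (cis th - z) = 'i + z * (cis th)^* * ('i * cis th / (cis th - z)).
      apply: (mulIf n0); rewrite mulrDl divfK //.
      have -> : z * (cis th)^* * ('i * cis th / (cis th - z)) * (cis th - z) =
        'i * z * ((cis th)^* * cis th) by field.
      by rewrite cc; ring.
    move=> e; rewrite {1}e !exprS; ring.
  have cker : ccont (fun th => 'i * cis th / (cis th - z)) by exact: ccont_kernel.
  have c1 : forall i : 'I_M.+1, ccont (fun th => 'i * z ^+ i * (f (cis th) * (cis th)^* ^+ i)).
    by move=> i; apply: ccontM => //; exact: ccont_cst.
  have c1' : forall i : 'I_M.+1, ccont (fun th => 'i * z ^+ i * (cis th)^* ^+ i).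
    by move=> i; apply: ccontM; [exact: ccont_cst|exact: ccont_conjX].
  have c2 : ccont (fun th => f (cis th) * rho th) by exact: ccontM.
  have := cauchy_kernel fE z1.
  have -> : (fun th => f (cis th) * ('i * cis th / (cis th - z))) =
     (fun th => \sum_(k < M.+1) 'i * z ^+ k * (f (cis th) * (cis th)^* ^+ k) +
        z ^+ M.+1 * (f (cis th) * rho th)).
    apply/funext => th; rewrite kE mulrDr mulr_sumr; congr (_ + _); last by ring.
    by apply: eq_bigr => k _; ring.
  have -> : (fun th => 'i * cis th / (cis th - z)) =
     (fun th => \sum_(k < M.+1) 'i * z ^+ k * (cis th)^* ^+ k + z ^+ M.+1 * rho th).
    by apply/funext => th; rewrite kE.
  rewrite !cprimD ?cprim_sum ?cprimZ //; last first.
  - by apply: ccontM => //; exact: ccont_cst.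
  - exact: ccont_sum.
  - by apply: ccontM => //; exact: ccont_cst.
  - exact: ccont_sum.
  have -> : \sum_(i < M.+1) cprim (fun th => 'i * z ^+ i * (f (cis th) * (cis th)^* ^+ i)) (2 * pi)
     = 'i * RtoC (2 * pi) * \sum_(k < M.+1) a k * z ^+ k.
    rewrite mulr_sumr; apply: eq_bigr => k _; rewrite cprimZ // -/(A k) /a.
    have -> : 'i * RtoC (2 * pi) * (RtoC (2 * pi)^-1 * A k * z ^+ k) =
      (RtoC (2 * pi) * RtoC (2 * pi)^-1) * ('i * z ^+ k * A k) by ring.
    by rewrite -RtoCM divff ?gt_eqF // mul1r.
  have -> : \sum_(i < M.+1) cprim (fun th => 'i * z ^+ i * (cis th)^* ^+ i) (2 * pi)
     = 'i * RtoC (2 * pi).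
    rewrite big_ord_recl big1 ?addr0 => [|i _]; last first.
      by rewrite cprimZ ?cprim_conjX_cis ?mulr0 //; exact: ccont_conjX.
    apply: (@cprimE _ (fun th => 'i * RtoC th)).
    - by apply: ccontM; [exact: ccont_cst|exact: ccont_conjX].
    - by rewrite RtoC0 mulr0.
    - move=> y; rewrite expr0 -mulrA; apply: cderZ; rewrite expr0 mulr1.
      by split; [exact: is_derive_id|exact: is_derive_cst].
  set S := \sum_(k < _) _; set cf := cprim _ _; set c1_ := cprim _ _ => eq1.
  have bf : cabs cf <= 2 * (B / (1 - cabs z)) * (2 * pi).
    apply: cprim_bound => // y _; rewrite cabsM ler_pM ?cabs_ge0 //.
    by rewrite fB // cabs_cis.
  have b1 : cabs c1_ <= 2 * (1 - cabs z)^-1 * (2 * pi) by apply: cprim_bound.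
  have eq2 : 'i * RtoC (2 * pi) * (f z - S) = z ^+ M.+1 * (cf - f z * c1_).
    have -> : 'i * RtoC (2 * pi) * (f z - S) =
       f z * ('i * RtoC (2 * pi) + z ^+ M.+1 * c1_) - 'i * RtoC (2 * pi) * S - f z * (z ^+ M.+1 * c1_) by ring.
    by rewrite -eq1; ring.
  have : 2 * pi * cabs (f z - S) = cabs z ^+ M.+1 * cabs (cf - f z * c1_).
    by rewrite -cabsX -cabsM -eq2 !cabsM cabs_i mul1r cabs_RtoC ger0_norm.
  move=> eq3; rewrite -(ler_pM2l pi0) eq3.
  have -> : 2 * pi * (2 * (cabs (f z) + B) / (1 - cabs z) * cabs z ^+ M.+1) =
    cabs z ^+ M.+1 * (2 * (B / (1 - cabs z)) * (2 * pi) + cabs (f z) * (2 * (1 - cabs z)^-1 * (2 * pi))).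
    by ring.
  rewrite ler_wpM2l ?exprn_ge0 ?cabs_ge0 // (le_trans (cabsB _ _)) // lerD // cabsM.
  by rewrite ler_wpM2l ?cabs_ge0.
apply/ler_addgt0Pr => e e0.
pose D := 2 * (cabs (f z) + B) / (1 - cabs z).
have D0 : 0 <= D by rewrite divr_ge0 ?(ltW m0) // mulr_ge0 // addr_ge0 // cabs_ge0.
have D1 : 0 < D + 1 by rewrite ltr_wpDl.
have z01 : 0 <= cabs z < 1 by rewrite cabs_ge0.
have [K hK] := cabs_exp_small z01 (divr_gt0 e0 D1).
have := main (N + K)%N; rewrite -/D -addnS => h.
rewrite (_ : f z - _ = (f z - \sum_(k < N + K.+1) a k * z ^+ k) +
   (\sum_(k < N + K.+1) a k * z ^+ k - \sum_(k < N) a k * z ^+ k)); last by ring.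
rewrite (le_trans (cabsD _ _)) // [leLHS]addrC lerD //.
  have -> : \sum_(k < N + K.+1) a k * z ^+ k - \sum_(k < N) a k * z ^+ k =
     \sum_(i < K.+1) a (N + i)%N * z ^+ (N + i).
    by rewrite big_split_ord /= addrAC subrr add0r.
  rewrite (le_trans (cabs_sum _ _ _)) //.
  have B2 : 0 <= 2 * B by rewrite mulr_ge0.
  apply: le_trans (geo_tail_le N K.+1 z01 B2).
  have -> : \sum_(N <= k < N + K.+1) 2 * B * cabs z ^+ k =
      \sum_(i < K.+1) 2 * B * cabs z ^+ (i + N).
    by rewrite -{1}[N]add0n big_addn addKn big_mkord.
  apply: ler_sum => i _.
  by rewrite cabsM cabsX addnC ler_wpM2r ?exprn_ge0 ?cabs_ge0.
rewrite (le_trans h) //.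
have zK : cabs z ^+ (N + K.+1) <= e / (D + 1).
  rewrite (le_trans _ (ltW hK)) // ler_wiXn2l ?cabs_ge0 ?(ltW z1) //.
  by rewrite (leq_trans (leqnSn K)) // leq_addl.
rewrite (le_trans (ler_wpM2l D0 zK)) // mulrCA -[leRHS]mulr1 ler_wpM2l ?(ltW e0) //.
by rewrite ler_pdivrMr // mul1r lerDl.
Qed.

Lemma entire_affine (f : C -> C) (u v : C) : entire f -> entire (fun t => f (u + t * v)).
Proof.
move=> fE t0; have [d hd] := fE (u + t0 * v); exists (d * v) => e e0.
have v0 : 0 < cabs v + 1 by rewrite ltr_wpDl // cabs_ge0.
have [r r0 hr] := hd (e / (cabs v + 1)) (divr_gt0 e0 v0).
exists (r / (cabs v + 1)); first by rewrite divr_gt0.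
move=> t; rewrite ltr_pdivlMr // => h.
have E : u + t * v - (u + t0 * v) = (t - t0) * v by ring.
have := hr (u + t * v); rewrite E cabsM => h'.
rewrite -mulrA [v * _]mulrC (le_trans (h' _)) //.
  by apply: le_lt_trans h; rewrite ler_wpM2l ?cabs_ge0 // lerDl.
by rewrite ler_div_succ ?cabs_ge0 // ltW.
Qed.

Lemma entire_bounded_circle_r (f : C -> C) (r : R) : entire f -> 0 < r ->
  exists B, forall t, cabs t = r -> cabs (f t) <= B.
Proof.
move=> fE r0; have [B hB] := entire_bounded_circle (entire_affine 0 (RtoC r) fE).
exists B => t tr; have r0' : RtoC r != 0 :> C by rewrite -cabs_gt0 cabs_RtoC normr_gt0 gt_eqF.
have := hB (t / RtoC r); rewrite add0r divfK //; apply.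
by rewrite cabsM cabsV cabs_RtoC tr ger0_norm ?(ltW r0) // divff // gt_eqF.
Qed.

(** The unit disc is rescaled to radius [r]. On half the disc [1 - cabs z / r] is at least 1/2,
    which turns [2 * B] into [4 * B] and leaves a purely geometric remainder. *)
Lemma taylor_disc (f : C -> C) (r B : R) : entire f -> 0 < r ->
  (forall t, cabs t = r -> cabs (f t) <= B) ->
  exists a : nat -> C, (forall k, cabs (a k) * r ^+ k <= 2 * B) /\
    forall z N, cabs z <= r / 2 ->
      cabs (f z - \sum_(k < N) a k * z ^+ k) <= 4 * B * (cabs z / r) ^+ N.
Proof.
move=> fE r0 fB.
have r0' : RtoC r != 0 :> C by rewrite -cabs_gt0 cabs_RtoC normr_gt0 gt_eqF.
have cr : cabs (RtoC r) = r by rewrite cabs_RtoC ger0_norm // ltW.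
have [|a [h1 h2]] := @taylor_disc1 _ B (entire_affine 0 (RtoC r) fE).
  by move=> t t1; rewrite add0r fB // cabsM t1 mul1r.
exists (fun k => a k / RtoC r ^+ k); split=> [k|z N zr].
  by rewrite cabsM cabsV cabsX cr divfK // gt_eqF // exprn_gt0.
have zr' : cabs (z / RtoC r) <= 2^-1.
  by rewrite cabsM cabsV cr ler_pdivrMr // mulrC.
have := h2 (z / RtoC r) N; rewrite add0r divfK // => h.
have -> : \sum_(k < N) a k / RtoC r ^+ k * z ^+ k = \sum_(k < N) a k * (z / RtoC r) ^+ k.
  by apply: eq_bigr => k _; rewrite exprMn exprVn; ring.
rewrite (le_trans (h _)) //; first by lra.
have B0 : 0 <= B by rewrite (le_trans (cabs_ge0 (f (RtoC r)))) // fB.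
rewrite cabsM cabsV cr in zr' *.
have x0 : 0 <= (cabs z / r) ^+ N by rewrite exprn_ge0 // divr_ge0 ?cabs_ge0 // ltW.
rewrite ler_pdivrMr; last by lra.
rewrite -subr_ge0 (_ : _ - _ = 2 * B * (cabs z / r) ^+ N * (1 - 2 * (cabs z / r))); last by ring.
by rewrite mulr_ge0 // ?mulr_ge0 //; lra.
Qed.

End taylor.

(** * Holomorphic functions on normed spaces *)

Section complex_limits.
Variable R : realType.
Local Notation C := (Cplx R).
Implicit Types (u v : nat -> C) (l : C).

Definition ctends u l := forall e : R, 0 < e ->
  exists N, forall n, (N <= n)%N -> cabs (u n - l) <= e.

Lemma ctendsD u v l l' : ctends u l -> ctends v l' -> ctends (fun n => u n + v n) (l + l').
Proof.
move=> hu hv e e0; have e2 : 0 < e / 2 by rewrite divr_gt0.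
have [N hN] := hu _ e2; have [N' hN'] := hv _ e2.
exists (maxn N N') => n; rewrite geq_max => /andP[/hN h1 /hN' h2].
rewrite (_ : _ - _ = (u n - l) + (v n - l')); last by ring.
by rewrite (le_trans (cabsD _ _)) // [e]splitr lerD.
Qed.

Lemma ctendsM u v l l' : ctends u l -> ctends v l' -> ctends (fun n => u n * v n) (l * l').
Proof.
move=> hu hv e e0.
pose A := cabs l + 1; pose B := cabs l' + 1.
have A0 : 0 < A by rewrite ltr_wpDl // cabs_ge0.
have B0 : 0 < B by rewrite ltr_wpDl // cabs_ge0.
have [N1 h1] := hu _ (divr_gt0 e0 (mulr_gt0 (ltr0Sn R 1) B0)).
have [N2 h2] := hv _ (divr_gt0 e0 (mulr_gt0 (ltr0Sn R 1) A0)).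
have [N3 h3] := hu _ ltr01.
exists (maxn N1 (maxn N2 N3)) => n; rewrite !geq_max => /and3P[/h1 a1 /h2 a2 /h3 a3].
have un : cabs (u n) <= A.
  by rewrite -[u n](subrK l) (le_trans (cabsD _ _)) // /A addrC lerD2l.
rewrite (_ : _ - _ = (u n - l) * l' + u n * (v n - l')); last by ring.
rewrite (le_trans (cabsD _ _)) // !cabsM.
have b1 : cabs (u n - l) * cabs l' <= e / (2 * B) * B.
  by rewrite ler_pM ?cabs_ge0 // /B lerDl.
have b2 : cabs (u n) * cabs (v n - l') <= A * (e / (2 * A)).
  by rewrite ler_pM ?cabs_ge0.
have b3 : e / (2 * B) * B = e / 2 by field; rewrite gt_eqF.
have b4 : A * (e / (2 * A)) = e / 2 by field; rewrite gt_eqF.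
by rewrite [e]splitr lerD //; [rewrite -b3|rewrite -b4].
Qed.

Lemma ctends_cst l : ctends (fun=> l) l.
Proof. by move=> e e0; exists 0%N => n _; rewrite subrr cabs0 ltW. Qed.

Lemma ctends_uniq u l l' : ctends u l -> ctends u l' -> l = l'.
Proof.
move=> h1 h2; apply/eqP; rewrite -subr_eq0; apply/eqP; apply: cabs_lt_eq0 => e e0.
have e2 : 0 < e / 2 by rewrite divr_gt0.
have [N hN] := h1 _ e2; have [N' hN'] := h2 _ e2.
rewrite (_ : l - l' = (u (maxn N N') - l') - (u (maxn N N') - l)); last by ring.
by rewrite (le_trans (cabsB _ _)) // [e]splitr lerD // ?hN ?hN' ?leq_maxl ?leq_maxr.
Qed.

Lemma ctends_le u l (B : R) : ctends u l ->
  (exists N, forall n, (N <= n)%N -> cabs (u n) <= B) -> cabs l <= B.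
Proof.
move=> h [N hN]; apply/ler_addgt0Pr => e e0; have [N' hN'] := h e e0.
rewrite (_ : l = u (maxn N N') - (u (maxn N N') - l)); last by ring.
by rewrite (le_trans (cabsB _ _)) // lerD ?hN ?hN' ?leq_maxl ?leq_maxr.
Qed.

Lemma ccauchy u : (forall e : R, 0 < e -> exists N, forall n m, (N <= n)%N -> (N <= m)%N ->
  cabs (u n - u m) <= e) -> exists l, ctends u l.
Proof.
move=> hu.
have rc (v : nat -> R) : (forall n m, `|v n - v m| <= cabs (u n - u m)) ->
    exists l : R, forall e : R, 0 < e -> exists N, forall n, (N <= n)%N -> `|v n - l| <= e.
  move=> vu; have /cvg_ex[l hl] : cvgn v.
    apply/cauchy_cvgP/cauchy_exP => e e0; have [N hN] := hu _ (divr_gt0 e0 (ltr0Sn R 1)).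
    exists (v N); exists N => // n /= Nn; rewrite -ball_normE /=.
    rewrite (le_lt_trans (vu _ _)) // (le_lt_trans (hN _ _ _ Nn)) //.
    by rewrite ltr_pdivrMr // mulrDr mulr1 ltrDl.
  exists l => e e0; have /cvgrPdist_le /(_ e e0)[N _ hN] := hl.
  by exists N => n Nn; rewrite distrC; exact: hN.
have [n m|l1 h1] := rc (fun n => Cre (u n)).
  by rewrite -CreB Cre_le_cabs.
have [n m|l2 h2] := rc (fun n => Cim (u n)).
  by rewrite -CimB Cim_le_cabs.
exists (Complex l1 l2) => e e0; have e2 : 0 < e / 2 by rewrite divr_gt0.
have [N hN] := h1 _ e2; have [N' hN'] := h2 _ e2.
exists (maxn N N') => n; rewrite geq_max => /andP[/hN a1 /hN' a2].
by rewrite (le_trans (cabs_le _)) // [e]splitr CreB CimB lerD.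
Qed.

Lemma ctends_cabs u l : ctends u l -> (fun k => cabs (u k)) @ \oo --> cabs l.
Proof.
move=> ul; apply/cvgrPdist_le => e e0; have [N hN] := ul e e0.
exists N => // k /= /hN; apply: le_trans.
rewrite ler_norml; apply/andP; split.
  by rewrite lerNl opprB lerBlDr -[X in cabs X <= _](subrK l) cabsD.
by rewrite lerBlDr cabsC -[X in cabs X <= _](subrK (u k)) cabsD.
Qed.

End complex_limits.

Section holomorphy.
Variable R : realType.
Local Notation C := (Cplx R).
Variable V : normedModType C.
Implicit Types (F : V -> C) (z h : V).

Definition vnorm z : R := Cre `|z|.

Lemma vnormE z : `|z| = RtoC (vnorm z).
Proof. by apply/esym/RRe_real; rewrite ger0_real. Qed.
Lemma vnorm_ge0 z : 0 <= vnorm z.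
Proof. by have := normr_ge0 z; rewrite vnormE ler0c. Qed.
Lemma vnormZ (a : C) z : vnorm (a *: z) = cabs a * vnorm z.
Proof. by rewrite /vnorm normrZ normC_cabs vnormE -RtoCM. Qed.
Lemma vnorm0 : vnorm 0 = 0. Proof. by rewrite /vnorm normr0. Qed.
Lemma vnorm_gt0 z : (0 < vnorm z) = (z != 0).
Proof. by have := normr_gt0 z; rewrite vnormE ltcR. Qed.

Lemma near_vnorm (P : V -> Prop) (r : R) : 0 < r -> (forall h, vnorm h < r -> P h) ->
  \forall h \near (0 : V), P h.
Proof.
move=> r0 hP; apply/nbhs_norm0P; exists (RtoC r); first by rewrite /= ltcR.
by move=> h /=; rewrite vnormE ltcR; exact: hP.
Qed.

Lemma vnorm_near (P : V -> Prop) : (\forall h \near (0 : V), P h) ->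
  exists2 r : R, 0 < r & forall h, vnorm h < r -> P h.
Proof.
move=> /nbhs_norm0P[e /= e0 he].
have ee : e = RtoC (Cre e) by apply/esym/RRe_real; rewrite gtr0_real.
exists (Cre e); first by move: e0; rewrite ee ltcR.
by move=> h hr; apply: he; rewrite /= vnormE ee ltcR.
Qed.

Lemma differentiable_estimate F z : differentiable F z -> forall e : R, 0 < e ->
  exists2 r : R, 0 < r & forall h, vnorm h < r ->
    cabs (F (h + z) - F z - 'd F z h) <= e * vnorm h.
Proof.
move=> /diff_locally /eqaddoP H e e0.
have /H /vnorm_near[r r0 hr] : 0 < RtoC e :> C by rewrite ltcR.
exists r => // h /hr.
rewrite vnormE normC_cabs -RtoCM lecR /= !fctE.
by rewrite opprD addrA.
Qed.

(** [differentiable] asks for a continuous differential, which the bound by [K] provides; the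
    estimate then identifies it with [L]. *)
Lemma estimate_differentiable F z (L : V -> C) (K : R) :
  (forall a h1 h2, L (a *: h1 + h2) = a * L h1 + L h2) ->
  (forall h, cabs (L h) <= K * vnorm h) ->
  (forall e : R, 0 < e -> exists2 r : R, 0 < r & forall h, vnorm h < r ->
    cabs (F (h + z) - F z - L h) <= e * vnorm h) ->
  differentiable F z.
Proof.
move=> Llin LK H.
pose Lm : {linear V -> C} := HB.pack L (GRing.isLinear.Build _ _ _ _ L Llin).
have Lc : continuous Lm.
  apply: bounded_linear_continuous; apply/linear_boundedP.
  exists (RtoC K); split; first by apply/complex_realP; exists K.
  move=> x Kx h; rewrite /Lm /= normC_cabs (le_trans _ (ler_wpM2r (normr_ge0 h) (ltW Kx))) //.
  by rewrite vnormE -RtoCM lecR.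
have Lo : F \o shift z = cst (F z) + Lm +o_ 0 id.
  apply/eqaddoP => e e0.
  have ee : e = RtoC (Cre e) by apply/esym/RRe_real; rewrite gtr0_real.
  have e0' : 0 < Cre e by move: e0; rewrite ee ltcR.
  have [r r0 hr] := H _ e0'.
  apply: near_vnorm r0 _ => h /hr.
  by rewrite vnormE normC_cabs ee -RtoCM lecR /= !fctE opprD addrA.
apply/diff_locallyP; rewrite (diff_unique Lc Lo); split => //.
Qed.

Lemma differentiable_entire_line F z h : (forall z, differentiable F z) ->
  entire (fun t : C => F (z + t *: h)).
Proof.
move=> Fd t0; exists ('d F (z + t0 *: h) h) => e e0.
have h0 : 0 < vnorm h + 1 by rewrite ltr_wpDl // vnorm_ge0.
have [r r0 hr] := differentiable_estimate (Fd (z + t0 *: h)) (divr_gt0 e0 h0).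
exists (r / (vnorm h + 1)); first by rewrite divr_gt0.
move=> t; rewrite ltr_pdivlMr // => ht.
have := hr ((t - t0) *: h).
have -> : (t - t0) *: h + (z + t0 *: h) = z + t *: h.
  by rewrite addrCA -scalerDl subrK.
rewrite linearZ /= vnormZ.
have -> : (t - t0) *: 'd F (z + t0 *: h) h = 'd F (z + t0 *: h) h * (t - t0) by exact: mulrC.
move=> h'.
rewrite (le_trans (h' _)) //.
  by apply: le_lt_trans ht; rewrite ler_wpM2l ?cabs_ge0 // lerDl.
by rewrite ler_div_succ ?cabs_ge0 ?vnorm_ge0 // ltW.
Qed.

(** On the complex line through [z] in direction [h], Taylor's expansion in the disc of radius
    [rho / vnorm h] has the first coefficients [F z] and ['d F z h]. The coefficient bound and the
    second-order remainder give the two conclusions, uniformly in [F] for given [M]. *)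
Lemma cauchy_estimate F z (rho M : R) : (forall z, differentiable F z) -> 0 < rho ->
  (forall h, vnorm h <= rho -> cabs (F (h + z)) <= M) ->
  (forall h, cabs ('d F z h) <= 2 * M / rho * vnorm h) /\
  (forall h, vnorm h <= rho / 2 ->
    cabs (F (h + z) - F z - 'd F z h) <= 4 * M * (vnorm h / rho) ^+ 2).
Proof.
move=> Fd rho0 FM.
suff H h : cabs ('d F z h) <= 2 * M / rho * vnorm h /\ (vnorm h <= rho / 2 ->
    cabs (F (h + z) - F z - 'd F z h) <= 4 * M * (vnorm h / rho) ^+ 2).
  by split=> h; case: (H h).
have [->|] := eqVneq h 0.
  by rewrite linear0 vnorm0 cabs0 mulr0 add0r mul0r expr0n subrr subr0 cabs0 mulr0.
rewrite -vnorm_gt0 => h0.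
have fE := differentiable_entire_line z h Fd.
have r0 : 0 < rho / vnorm h by rewrite divr_gt0.
have [|a [a1 a2]] := taylor_disc fE r0 (B := M).
  by move=> t tr; rewrite addrC FM // vnormZ tr divfK // gt_eqF.
have a0E : a 0%N = F z.
  have := a2 0 1%N; rewrite cabs0 big_ord1 expr0 mulr1 scale0r addr0 mul0r expr1 mulr0.
  move=> H; apply/esym/eqP; rewrite -subr_eq0; apply/eqP; apply: cabs_lt_eq0 => e e0.
  by rewrite (le_trans (H _)) // ?ltW // divr_gt0.
have M0 : 0 <= M.
  by rewrite (le_trans (cabs_ge0 (F (0 + z)))) // FM // vnorm0 ltW.
have a1E : a 1%N = 'd F z h.
  apply/eqP; rewrite -subr_eq0; apply/eqP; apply: cabs_lt_eq0 => e e0.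
  have vh1 : 0 < vnorm h + 1 by rewrite ltr_wpDl // ltW.
  have [r r0' hr] := differentiable_estimate (Fd z) (divr_gt0 e0 (mulr_gt0 (ltr0Sn R 1) vh1)).
  pose Q := 4 * M / (rho / vnorm h) ^+ 2.
  have Q0 : 0 <= Q by rewrite divr_ge0 ?sqr_ge0 // mulr_ge0.
  have Q1 : 0 < Q + 1 by rewrite ltr_wpDl.
  (* Three demands: [RtoC t *: h] lies where the differential approximates [F], [t] lies in the half
     disc of the Taylor bound, and [Q * t <= e / 2]. *)
  pose t := Num.min (r / (vnorm h + 1) / 2) (Num.min (rho / vnorm h / 2) (e / (2 * (Q + 1)))).
  have t0 : 0 < t by rewrite !lt_min !divr_gt0 //= mulr_gt0.
  have t1 : t * vnorm h < r.
    have : t <= r / (vnorm h + 1) / 2 by rewrite /t ge_min lexx.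
    rewrite ler_pdivlMr // ler_pdivlMr // => tt.
    by nra.
  have t2 : t <= rho / vnorm h / 2 by rewrite /t !ge_min lexx !orbT.
  have t3 : Q * t <= e / 2.
    have : t <= e / (2 * (Q + 1)) by rewrite /t !ge_min lexx !orbT.
    rewrite ler_pdivlMr ?mulr_gt0 // => tt; nra.
  have ct : cabs (RtoC t) = t by rewrite cabs_RtoC ger0_norm // ltW.
  have := a2 (RtoC t) 2%N; rewrite ct => /(_ t2).
  rewrite big_ord_recr big_ord1 /= expr0 mulr1 expr1 a0E => b1.
  have := hr (RtoC t *: h); rewrite vnormZ ct => /(_ t1).
  rewrite linearZ /= [_ + z]addrC => b2.
  have b3 : t * cabs (a 1%N - 'd F z h) <= e * t.
    rewrite -{1}ct -cabsM.
    have -> : RtoC t * (a 1%N - 'd F z h) =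
       (F (z + RtoC t *: h) - F z - RtoC t *: 'd F z h) -
       (F (z + RtoC t *: h) - (F z + a 1%N * RtoC t)).
      rewrite (_ : RtoC t *: 'd F z h = RtoC t * 'd F z h) //; ring.
    rewrite (le_trans (cabsB _ _)) // (le_trans (lerD b2 b1)) //.
    have -> : 4 * M * (t / (rho / vnorm h)) ^+ 2 = (Q * t) * t.
      by rewrite /Q; field; rewrite !gt_eqF.
    have : e / (2 * (vnorm h + 1)) * (t * vnorm h) <= e / 2 * t.
      rewrite (_ : e / (2 * (vnorm h + 1)) = e / 2 / (vnorm h + 1)).
        by rewrite ler_div_succ ?vnorm_ge0 // ?divr_ge0 // ltW.
      by field; rewrite gt_eqF.
    have : Q * t * t <= e / 2 * t by rewrite ler_wpM2r // ltW.
    lra.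
  by rewrite mulrC ler_pM2r in b3.
split.
  have := a1 1%N; rewrite expr1 a1E -ler_pdivlMr // => H1.
  rewrite (le_trans H1) // (_ : 2 * M / (rho / vnorm h) = 2 * M / rho * vnorm h) //.
  by field; rewrite !gt_eqF.
move=> hr; have := a2 1 2%N; rewrite cabs1 big_ord_recr big_ord1 /= !expr1n !mulr1 a0E a1E scale1r.
rewrite [z + h]addrC opprD addrA.
rewrite (_ : 1 / (rho / vnorm h) = vnorm h / rho); last by field; rewrite !gt_eqF.
apply.
by rewrite ler_pdivlMr // ler_pdivlMr // mul1r mulrC -ler_pdivlMr.
Qed.

Lemma diffB_apply F G z h : differentiable F z -> differentiable G z ->
  'd (F - G) z h = 'd F z h - 'd G z h.
Proof.
move=> dF dG.
by apply: (etrans (congr1 (fun f : V -> C => f h) (diffB dF dG))).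
Qed.

(** The error form [eps n * W z] with [W] locally bounded is what evaluation bounds supply. Cauchy
    estimates for the differences make the differentials converge to some [L], and the second-order
    remainder bound, uniform in n, survives the limit. *)
Lemma holomorphic_limit (Fn : nat -> V -> C) F (eps : nat -> R) (W : V -> R) :
  (forall n z, differentiable (Fn n) z) ->
  (forall n z, cabs (Fn n z - F z) <= eps n * W z) ->
  (forall n, 0 <= eps n) ->
  (forall e : R, 0 < e -> exists N, forall n, (N <= n)%N -> eps n <= e) ->
  (forall z, exists B : R, exists2 r : R, 0 < r & forall h, vnorm h <= r -> W (h + z) <= B) ->
  forall z, differentiable F z.
Proof.
move=> Fd FnF eps0 eps_lim Wb z.
have ctF y : ctends (fun n => Fn n y) (F y).
  move=> e e0; have W1 : 0 < `|W y| + 1 by rewrite ltr_wpDl.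
  have [N hN] := eps_lim _ (divr_gt0 e0 W1); exists N => n /hN h.
  rewrite (le_trans (FnF _ _)) // (le_trans (ler_wpM2l (eps0 n) (ler_norm _))) //.
  rewrite (le_trans (ler_wpM2r (normr_ge0 _) h)) // -{2}[`|W y|]mul1r.
  by rewrite (le_trans (ler_div_succ (ltW e0) ler01 (normr_ge0 _))) // mulr1.
have [B0 [r0 r00 hB0]] := Wb z.
pose B := Num.max 0 B0.
have B_ge0 : 0 <= B by rewrite /B le_max lexx.
have FB n h : vnorm h <= r0 -> cabs (Fn n (h + z) - F (h + z)) <= eps n * B.
  move=> hr; rewrite (le_trans (FnF _ _)) // ler_wpM2l //.
  by rewrite (le_trans (hB0 _ hr)) // /B le_max lexx orbT.
have [N0 hN0] := eps_lim _ ltr01.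
have [r1 r10 hr1] : exists2 r1 : R, 0 < r1 & forall h, vnorm h < r1 ->
    cabs (Fn N0 (h + z) - Fn N0 z) <= 1.
  have /cvgrPdist_le /(_ (1 : C) ltr01) := differentiable_continuous (Fd N0 z).
  move=> /nbhs_normP[e /= e0 he].
  have ee : e = RtoC (Cre e) by apply/esym/RRe_real; rewrite gtr0_real.
  exists (Cre e) => [|h hr]; first by move: e0; rewrite ee ltcR.
  have /he /= : ball_ Num.norm z e (h + z).
    by rewrite /ball_ /= distrC addrK vnormE ee ltcR.
  by rewrite distrC normC_cabs -RtoC1 lecR.
pose rho := Num.min r0 (r1 / 2).
have rho0 : 0 < rho by rewrite lt_min r00 divr_gt0.
(* A common bound near [z] for all later [Fn n]: each is compared through [F] with [Fn N0], at a
   cost of at most [B] twice, and [Fn N0] varies by at most 1. *)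
pose M := cabs (Fn N0 z) + 1 + 2 * B.
have FM n h : (N0 <= n)%N -> vnorm h <= rho -> cabs (Fn n (h + z)) <= M.
  move=> nN; rewrite le_min => /andP[h1 h2].
  have a1 := FB n h h1; have a2 := FB N0 h h1.
  have a3 : cabs (Fn N0 (h + z) - Fn N0 z) <= 1 by apply: hr1; lra.
  have e1 := hN0 n nN; have e2 := hN0 N0 (leqnn _).
  have a1' : cabs (Fn n (h + z) - F (h + z)) <= B by rewrite (le_trans a1) // ler_piMl.
  have a2' : cabs (Fn N0 (h + z) - F (h + z)) <= B by rewrite (le_trans a2) // ler_piMl.
  rewrite (_ : Fn n (h + z) = (Fn n (h + z) - F (h + z)) - (Fn N0 (h + z) - F (h + z))
     + (Fn N0 (h + z) - Fn N0 z) + Fn N0 z); last by ring.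
  rewrite (le_trans (cabsD _ _)) //.
  have b1 := cabsD (Fn n (h + z) - F (h + z) - (Fn N0 (h + z) - F (h + z))) (Fn N0 (h + z) - Fn N0 z).
  have b2 := cabsB (Fn n (h + z) - F (h + z)) (Fn N0 (h + z) - F (h + z)).
  rewrite /M; lra.
have dFnm n m h : cabs ('d (Fn n) z h - 'd (Fn m) z h) <= 2 * ((eps n + eps m) * B) / rho * vnorm h.
  have Dd y : differentiable (Fn n - Fn m) y by apply: differentiableB.
  have [] := @cauchy_estimate (Fn n - Fn m) z rho ((eps n + eps m) * B) Dd rho0.
    move=> k; rewrite le_min => /andP[h1 h2]; rewrite !fctE.
    rewrite (_ : _ - _ = (Fn n (k + z) - F (k + z)) - (Fn m (k + z) - F (k + z))); last by ring.
    by rewrite (le_trans (cabsB _ _)) // mulrDl lerD // FB.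
  by move=> /(_ h) H _; rewrite -(diffB_apply h (Fd n z) (Fd m z)).
have Llim h : exists l, ctends (fun n => 'd (Fn n) z h) l.
  apply: ccauchy => e e0.
  pose Q := 2 * B / rho * vnorm h.
  have Q0 : 0 <= Q by rewrite mulr_ge0 ?vnorm_ge0 // divr_ge0 ?mulr_ge0 // ltW.
  have Q1 : 0 < Q + 1 by rewrite ltr_wpDl.
  have [N hN] := eps_lim _ (divr_gt0 (divr_gt0 e0 Q1) (ltr0Sn R 1)).
  exists N => n m /hN hn /hN hm; rewrite (le_trans (dFnm _ _ _)) //.
  rewrite (_ : _ * vnorm h = (eps n + eps m) * Q); last by rewrite /Q; ring.
  have : eps n + eps m <= e / (Q + 1) by lra.
  move=> hh; rewrite (le_trans (ler_wpM2r Q0 hh)) // mulrAC -mulrA -[leRHS]mulr1.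
  by rewrite ler_wpM2l ?(ltW e0) // ler_pdivrMr // mul1r lerDl.
have [L hL] := choice Llim.
pose K := 2 * M / rho.
apply: (@estimate_differentiable F z L K).
- move=> a h1 h2; apply: (@ctends_uniq _ (fun n => 'd (Fn n) z (a *: h1 + h2))) => //.
  rewrite (_ : (fun n => _) = fun n => a * 'd (Fn n) z h1 + 'd (Fn n) z h2).
    by apply: ctendsD => //; apply: ctendsM => //; exact: ctends_cst.
  by apply/funext => n; rewrite linearP.
- move=> h; apply: (ctends_le (hL h)); exists N0 => n nN.
  by have [+ _] := @cauchy_estimate (Fn n) z rho M (Fd n) rho0 (fun h => FM n h nN); apply.
- have M0 : 0 <= M by rewrite !addr_ge0 ?cabs_ge0 // mulr_ge0.
  have hlim h : vnorm h <= rho / 2 -> cabs (F (h + z) - F z - L h) <= 4 * M * (vnorm h / rho) ^+ 2.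
    move=> hr; apply: (@ctends_le _ (fun n => Fn n (h + z) - Fn n z - 'd (Fn n) z h)).
      apply: ctendsD; last by rewrite -mulN1r; under eq_fun do rewrite -mulN1r; apply: ctendsM => //; exact: ctends_cst.
      apply: ctendsD; first exact: ctF.
      by rewrite -mulN1r; under eq_fun do rewrite -mulN1r; apply: ctendsM; [exact: ctends_cst|exact: ctF].
    exists N0 => n nN.
    by have [_] := @cauchy_estimate (Fn n) z rho M (Fd n) rho0 (fun h => FM n h nN); apply.
  move=> e e0.
  pose Q := 4 * M / rho ^+ 2.
  have Q0 : 0 <= Q by rewrite divr_ge0 ?sqr_ge0 // mulr_ge0.
  have Q1 : 0 < Q + 1 by rewrite ltr_wpDl.
  exists (Num.min (rho / 2) (e / (Q + 1))); first by rewrite lt_min !divr_gt0.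
  move=> h; rewrite lt_min => /andP[h1]; rewrite ltr_pdivlMr // => h2.
  rewrite (le_trans (hlim _ (ltW h1))) //.
  rewrite (_ : 4 * M * _ = (vnorm h * Q) * vnorm h); last by rewrite /Q; field; rewrite gt_eqF.
  rewrite ler_wpM2r ?vnorm_ge0 //; have := vnorm_ge0 h; nra.
Qed.

End holomorphy.

(** * Lebesgue measure on tuples and Gaussian moments *)

Section tuple_measure.
Variable R : realType.
Local Notation T := (measurableTypeR R).
Local Notation mu := (@lebesgue_measure R).
Local Notation power n := (power_measure mu n).
Local Open Scope ereal_scope.

Lemma integral_powerS n (f : n.+1.-tuple T -> \bar R) :
  measurable_fun setT f -> (forall t, 0 <= f t) ->
  \int[power n.+1]_t f t = \int[(mu \x power n)%E]_p f (cons_pair p).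
Proof.
move=> mf f0; rewrite [LHS](@ge0_integral_pushforward _ _ _ _ _ _ (@measurable_cons_pair _ T n)) //.
Qed.

Lemma integral_powerS1 n (f : n.+1.-tuple T -> \bar R) :
  measurable_fun setT f -> (forall t, 0 <= f t) ->
  \int[power n.+1]_t f t = \int[mu]_x \int[power n]_s f (cons_pair (x, s)).
Proof.
move=> mf f0; rewrite integral_powerS // fubini_tonelli1 //.
by apply: measurableT_comp => //; exact: measurable_cons_pair.
Qed.

Lemma integral_powerS2 n (f : n.+1.-tuple T -> \bar R) :
  measurable_fun setT f -> (forall t, 0 <= f t) ->
  \int[power n.+1]_t f t = \int[power n]_s \int[mu]_x f (cons_pair (x, s)).
Proof.
move=> mf f0; rewrite integral_powerS // fubini_tonelli2 //.
by apply: measurableT_comp => //; exact: measurable_cons_pair.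
Qed.

Definition upd n (t : n.-tuple T) (q : 'I_n) (x : R) : n.-tuple T :=
  [tuple if i == q then x else tnth t i | i < n].

Lemma tnth_upd n (t : n.-tuple T) (q : 'I_n) (x : R) i :
  tnth (upd t q x) i = if i == q then x else tnth t i.
Proof. by rewrite tnth_mktuple. Qed.

Lemma upd_upd n (t : n.-tuple T) (q : 'I_n) (x y : R) : upd (upd t q x) q y = upd t q y.
Proof. by apply: eq_from_tnth => i; rewrite !tnth_upd; case: eqP. Qed.

Lemma tnth_cons0 n (x : T) (s : n.-tuple T) : tnth (cons_pair (x, s)) ord0 = x.
Proof. by []. Qed.

Lemma tnth_consS n (x : T) (s : n.-tuple T) j : tnth (cons_pair (x, s)) (lift ord0 j) = tnth s j.
Proof. by rewrite /cons_pair /= tnthS. Qed.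

Lemma upd_cons0 n (y : R) (s : n.-tuple T) x :
  upd (cons_pair (y, s)) ord0 x = cons_pair (x, s).
Proof.
apply: eq_from_tnth => i; rewrite tnth_upd; case: (unliftP ord0 i) => [j|] -> //.
by rewrite !tnth_consS.
Qed.

Lemma upd_consS n (y : R) (s : n.-tuple T) j x :
  upd (cons_pair (y, s)) (lift ord0 j) x = cons_pair (y, upd s j x).
Proof.
apply: eq_from_tnth => i; rewrite tnth_upd; case: (unliftP ord0 i) => [k|] -> //.
by rewrite !tnth_consS tnth_upd (inj_eq (@lift_inj _ ord0)).
Qed.

Lemma measurable_cons_pair2 n (x : T) :
  measurable_fun setT (fun s : n.-tuple T => cons_pair (x, s)).
Proof.
by apply: (@measurable_cons _ _ _ _ (fun=> x) n (fun s : n.-tuple T => s)).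
Qed.

(** Tonelli's theorem: leading coordinates are peeled off until [q] is the first, which is then
    integrated innermost. This lemma applies one-dimensional identities to a single coordinate, the
    others being parameters. *)
Lemma eq_integral_upd n (q : 'I_n) (f g : n.-tuple T -> \bar R) :
  measurable_fun setT f -> measurable_fun setT g ->
  (forall t, 0 <= f t) -> (forall t, 0 <= g t) ->
  (forall t, \int[mu]_x f (upd t q x) = \int[mu]_x g (upd t q x)) ->
  \int[power n]_t f t = \int[power n]_t g t.
Proof.
elim: n q f g => [|n IH] q f g; first by case: q.
move=> mf mg f0 g0 h; case: (unliftP ord0 q) h => [j|] -> h.
  rewrite !integral_powerS1 //; apply: eq_integral => x _.
  apply: (IH j) => //.
  - by apply: measurableT_comp => //; exact: measurable_cons_pair2.
  - by apply: measurableT_comp => //; exact: measurable_cons_pair2.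
  - move=> t; have := h (cons_pair (x, t)).
    by under eq_integral do rewrite upd_consS; move=> ->; under eq_integral do rewrite upd_consS.
rewrite !integral_powerS2 //; apply: eq_integral => s _.
have := h (@cons_pair _ T n ((0%R : R), s)).
by under eq_integral do rewrite upd_cons0; move=> ->; under eq_integral do rewrite upd_cons0.
Qed.

(** The translated measure agrees with Lebesgue measure on half-open intervals and is therefore
    equal to it. *)
Lemma lebesgue_integral_shift (c : R) (f : T -> \bar R) : measurable_fun setT f ->
  (forall x, 0 <= f x) -> \int[mu]_x f (x + c)%R = \int[mu]_x f x.
Proof.
move=> mf f0.
have ms : measurable_fun [set: T] ((fun x => x + c)%R : T -> T) by exact: measurable_funD.
rewrite -[LHS](@ge0_integral_pushforward _ _ _ _ _ _ ms mu setT f) //.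
apply: eq_measure_integral => //= A mA _; apply/esym/lebesgue_measure_unique => //= _ [[a b]] _ <-.
rewrite /pushforward (_ : _ @^-1` _ = `](a - c)%R, (b - c)%R]%classic); last first.
  by apply/seteqP; split=> x /=; rewrite !in_itv /= ltrBlDr lerBrDr.
rewrite !lebesgue_measure_itv /= !lte_fin ltrD2r; case: ifP => // _.
by rewrite -!EFinB; congr EFin; ring.
Qed.

Lemma lebesgue_integral_opp (f : T -> \bar R) : measurable_fun setT f ->
  (forall x, 0 <= f x) -> \int[mu]_x f (- x)%R = \int[mu]_x f x.
Proof.
move=> mf f0.
have ms : measurable_fun [set: T] (-%R : T -> T) by exact: measurable_funN.
rewrite -[LHS](@ge0_integral_pushforward _ _ _ _ _ _ ms mu setT f) //.
by apply: eq_measure_integral => //= A mA _; exact: lebesgue_measureN.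
Qed.

(** Measure preservation is phrased by integrals of nonnegative functions, so composition is mere
    rewriting; signed functions follow through their positive and negative parts. *)
Definition leb_invariant n (g : n.-tuple T -> n.-tuple T) :=
  measurable_fun setT g /\ forall f : n.-tuple T -> \bar R, measurable_fun setT f ->
    (forall t, 0 <= f t) -> \int[power n]_t f (g t) = \int[power n]_t f t.

Lemma leb_invariant_id n : leb_invariant (@id (n.-tuple T)).
Proof. by split => //; exact: measurable_id. Qed.

Lemma leb_invariant_comp n (g h : n.-tuple T -> n.-tuple T) :
  leb_invariant g -> leb_invariant h -> leb_invariant (g \o h).
Proof.
move=> [mg hg] [mh hh]; split; first exact: measurableT_comp.
move=> f mf f0; rewrite -[RHS]hg // -[RHS]hh //.
exact: measurableT_comp.
Qed.

Lemma measurable_upd n (q : 'I_n) (c : n.-tuple T -> R) : measurable_fun setT c ->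
  measurable_fun setT (fun t => upd t q (c t)).
Proof.
move=> mc; apply/measurable_fun_tnthP => i.
rewrite (_ : _ \o _ = fun t => if i == q then c t else tnth t i).
  by case: (i == q) => //; exact: measurable_tnth.
by apply/funext => t; rewrite /= tnth_upd.
Qed.

(** As [c] ignores the coordinate [q], each fibre is shifted by a constant. Shears and translations
    are both instances. *)
Lemma leb_invariant_shift n (q : 'I_n) (c : n.-tuple T -> R) : measurable_fun setT c ->
  (forall t x, c (upd t q x) = c t) ->
  leb_invariant (fun t => upd t q (tnth t q + c t)%R).
Proof.
move=> mc hc.
have mg : measurable_fun setT (fun t : n.-tuple T => upd t q (tnth t q + c t)%R).
  by apply: measurable_upd; apply: measurable_funD => //; exact: measurable_tnth.
split=> // f mf f0; apply: (@eq_integral_upd _ q) => //.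
  exact: measurableT_comp.
move=> t; under eq_integral do rewrite upd_upd tnth_upd eqxx hc.
rewrite (@lebesgue_integral_shift (c t) (fun x => f (upd t q x))) //.
apply: measurableT_comp => //; apply/measurable_fun_tnthP => i.
rewrite (_ : _ \o _ = fun x => if i == q then x else tnth t i).
  by case: (i == q).
by apply/funext => x; rewrite /= tnth_upd.
Qed.

Lemma leb_invariant_opp n (q : 'I_n) :
  leb_invariant (fun t : n.-tuple T => upd t q (- tnth t q)%R).
Proof.
have mg : measurable_fun setT (fun t : n.-tuple T => upd t q (- tnth t q)%R).
  by apply: measurable_upd; apply: measurable_funN => //; exact: measurable_tnth.
split=> // f mf f0; apply: (@eq_integral_upd _ q) => //.
  exact: measurableT_comp.
move=> t; under eq_integral do rewrite upd_upd tnth_upd eqxx.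
rewrite (@lebesgue_integral_opp (fun x => f (upd t q x))) //.
apply: measurableT_comp => //; apply/measurable_fun_tnthP => i.
rewrite (_ : _ \o _ = fun x => if i == q then x else tnth t i).
  by case: (i == q).
by apply/funext => x; rewrite /= tnth_upd.
Qed.

Lemma leb_invariant_integral n (g : n.-tuple T -> n.-tuple T) (f : n.-tuple T -> \bar R) :
  leb_invariant g -> measurable_fun setT f ->
  \int[power n]_t f (g t) = \int[power n]_t f t.
Proof.
move=> [mg hg] mf; rewrite integralE [RHS]integralE; congr (_ - _).
  rewrite -[RHS](hg f^\+) //; last exact: measurable_funepos.
  by apply: eq_integral => t _; rewrite unlock.
rewrite -[RHS](hg f^\-) //; last exact: measurable_funeneg.
by apply: eq_integral => t _; rewrite unlock.
Qed.

Definition rot2 n (p q : 'I_n) (c s : R) (t : n.-tuple T) : n.-tuple T :=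
  upd (upd t p (c * tnth t p - s * tnth t q)%R) q (s * tnth t p + c * tnth t q)%R.

Lemma leb_invariant_shear n (p q : 'I_n) (a : R) : p != q ->
  leb_invariant (fun t : n.-tuple T => upd t q (tnth t q + a * tnth t p)%R).
Proof.
move=> pq; apply: (@leb_invariant_shift _ q (fun t => a * tnth t p)%R).
  by apply: measurable_funM => //; exact: measurable_tnth.
by move=> t x; rewrite tnth_upd (negbTE pq).
Qed.

Lemma tnth_rot2 n (p q : 'I_n) (c s : R) (t : n.-tuple T) i : p != q ->
  tnth (rot2 p q c s t) i = if i == q then (s * tnth t p + c * tnth t q)%R
    else if i == p then (c * tnth t p - s * tnth t q)%R else tnth t i.
Proof. by move=> pq; rewrite /rot2 !tnth_upd. Qed.

Lemma leb_invariant_rot2 n (p q : 'I_n) (c s : R) : p != q -> (c ^+ 2 + s ^+ 2 = 1)%R ->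
  leb_invariant (@rot2 n p q c s).
Proof.
move=> pq cs; have qp : q != p by rewrite eq_sym.
have [c1|c1] := eqVneq c (-1)%R.
  have s0 : s = 0%R by apply/eqP; rewrite -sqrf_eq0; apply/eqP; rewrite c1 in cs; lra.
  rewrite (_ : rot2 p q c s = (fun t => upd t q (- tnth t q)%R) \o (fun t => upd t p (- tnth t p)%R)).
    by apply: leb_invariant_comp; exact: leb_invariant_opp.
  apply/funext => t; apply: eq_from_tnth => i; rewrite tnth_rot2 //= !tnth_upd (negbTE qp) c1 s0.
  case: eqP => _; first by ring.
  by case: eqP => _; ring.
(* Minus the tangent of half the angle. It is undefined for the half turn, hence the separate
   treatment of [c = -1] by two sign changes. *)
pose a := (- s / (1 + c))%R.
have c10 : (1 + c != 0)%R.
  by apply/eqP => h; move/eqP : c1; apply; lra.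
(* for c <> -1 the rotation is a product of three shears *)
rewrite (_ : rot2 p q c s = (fun t => upd t p (tnth t p + a * tnth t q)%R) \o
  ((fun t => upd t q (tnth t q + s * tnth t p)%R) \o (fun t => upd t p (tnth t p + a * tnth t q)%R))).
  by apply: leb_invariant_comp; [|apply: leb_invariant_comp]; exact: leb_invariant_shear.
apply/funext => t; apply: eq_from_tnth => i; rewrite tnth_rot2 //= !tnth_upd !eqxx (negbTE qp) (negbTE pq).
have s2 : (s ^+ 2 = (1 - c) * (1 + c))%R.
  have -> : (s ^+ 2 = 1 - c ^+ 2)%R by rewrite -cs; ring.
  by ring.
have as_ : (a * s = c - 1)%R.
  by rewrite /a mulrAC mulNr -expr2 s2; field.
case: (eqVneq i q) => [->|iq]; rewrite ?(negbTE qp).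
  rewrite [RHS](_ : _ = ( (1 + a * s) * tnth t q + s * tnth t p)%R); last by ring.
  by rewrite as_; ring.
case: eqP => // _.
rewrite [RHS](_ : _ = ((1 + a * s) * tnth t p + (a + a * s * a + a) * tnth t q)%R); last by ring.
rewrite as_ (_ : (a + (c - 1) * a + a = a * (1 + c))%R); last by ring.
by rewrite /a divfK //; ring.
Qed.

End tuple_measure.

(** * Joint measurability from continuity in each variable *)

Section separately_continuous.
Variable R : realType.
Local Notation T := (measurableTypeR R).
Local Notation mu := (@lebesgue_measure R).

(** Rounding the first variable down to a grid of mesh 1/(k+1) turns preimages into countable unions
    of measurable rectangles; by continuity the rounded functions converge to [f]. *)
Lemma measurable_fun_caratheodory d (S : measurableType d) (f : T * S -> R) :
  (forall s, continuous (fun x : R => f (x, s))) ->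
  (forall x, measurable_fun setT (fun s => f (x, s))) ->
  measurable_fun setT f.
Proof.
move=> cf mf.
pose a k (x : R) : R := (Num.floor (x * k.+1%:R))%:~R / k.+1%:R.
have k0 k : 0 < k.+1%:R :> R by rewrite ltr0n.
have ax k x : `|a k x - x| <= k.+1%:R^-1.
  have /andP[h1 h2] := floor_itv (x * k.+1%:R).
  have E : (a k x - x) * k.+1%:R = (Num.floor (x * k.+1%:R))%:~R - x * k.+1%:R.
    by rewrite mulrBl /a divfK // gt_eqF.
  rewrite -(ler_pM2r (k0 k)) mulVf ?gt_eqF // -[X in _ * X](@ger0_norm _ k.+1%:R) // -normrM E.
  rewrite intrD in h2; rewrite ler_norml; apply/andP; split; lra.
apply: (@measurable_fun_cvg _ _ _ _ (fun k p => f (a k p.1, p.2))).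
  move=> k _ Y mY; rewrite setTI.
  rewrite (_ : _ @^-1` Y = \bigcup_(i : int) ([set x | Num.floor (x * k.+1%:R) = i] `*`
     [set s | Y (f (i%:~R / k.+1%:R, s))])); last first.
    apply/seteqP; split=> [[x s] /= h|[x s] [i _] [/= <-]] //.
    by exists (Num.floor (x * k.+1%:R)).
  apply: countable_bigcupT_measurable => // i; apply: measurableX.
    rewrite (_ : [set x | _] = `[i%:~R / k.+1%:R, (i + 1)%:~R / k.+1%:R[%classic).
      exact: measurable_itv.
    apply/seteqP; split=> x /=; rewrite in_itv /= ler_pdivrMr // ltr_pdivlMr //.
      by move=> <-; exact: floor_itv.
    by move=> /andP[h1 h2]; apply: floor_def; rewrite h1 h2.
  by have := mf (i%:~R / k.+1%:R) measurableT Y mY; rewrite setTI.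
move=> [x s] _ /=.
have acvg : (fun k => a k x : R) @ \oo --> (x : R).
  apply/cvgrPdist_le => e e0; near=> k; rewrite distrC (le_trans (ax k x)) //.
  rewrite -[leRHS]invrK lef_pV2 ?posrE ?invr_gt0 //.
  near: k; exists (Num.bound e^-1) => // k /= hk.
  rewrite (le_trans (ltW (archi_boundP _))) ?invr_ge0 ?(ltW e0) // ler_nat.
  exact: leq_trans hk _.
exact: (cvg_comp (fun k => a k x) (fun x : R => f (x, s)) acvg (cf s x)).
Unshelve. all: by end_near.
Qed.

Lemma measurable_separately_continuous n (f : n.-tuple T -> R) :
  (forall t q, continuous (fun x : R => f (upd t q x))) -> measurable_fun setT f.
Proof.
elim: n f => [|n IH] f cf.
  rewrite (_ : f = cst (f [tuple])); first exact: measurable_cst.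
  by apply/funext => t; rewrite (tuple0 t).
rewrite (_ : f = (f \o @cons_pair _ T n) \o @uncons_pair _ T n); last first.
  by apply/funext => t /=; rewrite uncons_pairK.
apply: measurableT_comp; last exact: measurable_uncons_pair.
apply: measurable_fun_caratheodory => [s x|x].
  have := cf (@cons_pair _ T n ((0 : R), s)) ord0 x.
  by under eq_fun do rewrite upd_cons0.
apply: IH => t q y; have := cf (@cons_pair _ T n (x, t)) (lift ord0 q) y.
by under eq_fun do rewrite upd_consS.
Qed.

Lemma integral_power_prod n (phi : R -> R) (I : R) : measurable_fun setT phi ->
  (forall x, 0 <= phi x) -> (\int[mu]_x (phi x)%:E = I%:E)%E ->
  (\int[power_measure mu n]_t (\prod_(k < n) phi (tnth t k))%:E = (I ^+ n)%:E)%E.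
Proof.
move=> mphi phi0 hI.
have mprod k : measurable_fun setT (fun t : k.-tuple T => \prod_(i < k) phi (tnth t i)).
  apply: measurable_prod => i _; apply: measurableT_comp => //; exact: measurable_tnth.
have prod0 k (t : k.-tuple T) : 0 <= \prod_(i < k) phi (tnth t i) by apply: prodr_ge0.
elim: n => [|n IH].
  rewrite integral_dirac //; first by rewrite diracT mul1e big_ord0 expr0.
  by apply/measurable_EFinP; exact: mprod.
rewrite integral_powerS1; last 2 first.
- by apply/measurable_EFinP; exact: mprod.
- by move=> t; rewrite lee_fin.
transitivity (\int[mu]_x ((I ^+ n)%:E * (phi x)%:E))%E.
  apply: eq_integral => x _; rewrite -IH muleC -ge0_integralZl //; last 3 first.
  - by apply/measurable_EFinP; exact: mprod.
  - by move=> t _; rewrite lee_fin.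
  - by rewrite lee_fin.
  apply: eq_integral => s _; rewrite -EFinM big_ord_recl tnth_cons0; congr (_ * _)%:E.
  by apply: eq_bigr => i _; rewrite tnth_consS.
have I0 : 0 <= I by rewrite -lee_fin -hI; apply: integral_ge0 => x _; rewrite lee_fin.
rewrite ge0_integralZl //.
- by rewrite hI -EFinM exprSr.
- exact/measurable_EFinP.
- by move=> x _; rewrite lee_fin.
- by rewrite lee_fin exprn_ge0.
Qed.

End separately_continuous.

(** * Gaussian integration by parts on the line *)

Section gaussian_parts.
Variable R : realType.
Local Notation T := (measurableTypeR R).
Local Notation mu := (@lebesgue_measure R).

(** The integral of [h]' is zero because [h] vanishes at infinity. Splitting [h]' into nonnegative
    parts avoids any integrability condition: both sides are compared on growing intervals and may
    be infinite. *)
Lemma eq_integral_derive_sub (h h1 h2 : R -> R) :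
  continuous h1 -> continuous h2 ->
  (forall x, 0 <= h1 x) -> (forall x, 0 <= h2 x) ->
  (forall x : R, is_derive x 1 h (h1 x - h2 x)) ->
  (forall e : R, 0 < e -> exists N : nat, forall x, N%:R <= `|x| -> `|h x| <= e) ->
  (\int[mu]_x (h1 x)%:E = \int[mu]_x (h2 x)%:E)%E.
Proof.
move=> c1 c2 p1 p2 dh h0.
pose F (n : nat) : set T := `[- n.+1%:R, n.+1%:R]%classic.
have ndF : nondecreasing_seq F.
  move=> n m nm; apply/subsetPset => x; rewrite /F /= !in_itv /= => /andP[a b].
  have : n.+1%:R <= m.+1%:R :> R by rewrite ler_nat.
  by move=> h'; apply/andP; split; lra.
have mF n : measurable (F n) by exact: measurable_itv.
have FT : \bigcup_n F n = setT.
  apply/seteqP; split=> // x _; exists (Num.bound `|x|) => //.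
  rewrite /F /= in_itv /= -ler_norml (le_trans (ltW (archi_boundP (normr_ge0 x)))) //.
  by rewrite ler_nat.
have mh (k : R -> R) : continuous k -> measurable_fun setT (EFin \o k).
  by move=> ck; apply/measurable_EFinP; exact: continuous_measurable_fun.
have lim (k : R -> R) : continuous k -> (forall x, 0 <= k x) ->
    (fun n => \int[mu]_(x in F n) (k x)%:E)%E @ \oo --> (\int[mu]_x (k x)%:E)%E.
  move=> ck pk; rewrite -FT.
  apply: ge0_nondecreasing_set_cvg_integral => //.
  - by move=> i; apply: (@measurable_funTS _ _ T _ (F i) (EFin \o k)); exact: mh.
  - by move=> i x _; rewrite lee_fin.
have intF (k : R -> R) n : continuous k -> mu.-integrable (F n) (EFin \o k).
  by move=> ck; apply: continuous_compact_integrable; [exact: segment_compact|exact: continuous_subspaceT].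
have FTC n : (\int[mu]_(x in F n) (h1 x)%:E = \int[mu]_(x in F n) (h2 x)%:E + (h n.+1%:R - h (- n.+1%:R))%:E)%E.
  have ab : - n.+1%:R < n.+1%:R :> R by rewrite gtrN ?ltr0n.
  have ch : continuous h by exact: is_derive_continuous dh.
  have := @continuous_FTC2 R (fun x => h1 x - h2 x) h (- n.+1%:R) n.+1%:R ab.
  rewrite -/(F n) => FTC.
  have : (\int[mu]_(x in F n) (h1 x - h2 x)%:E = (h n.+1%:R)%:E - (h (- n.+1%:R))%:E)%E.
    apply: FTC.
    - apply: continuous_subspaceT => x; apply: cvgB; [exact: c1|exact: c2].
    - split; last 2 first.
      + by apply: cvg_at_right_filter; exact: ch.
      + by apply: cvg_at_left_filter; exact: ch.
      by move=> x _; case: (dh x).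
    - by move=> x _; rewrite derive1E; case: (dh x).
  under eq_integral do rewrite EFinB.
  rewrite integralB_EFin //; [|exact: intF|exact: intF].
  have f2 : (\int[mu]_(x in F n) (h2 x)%:E)%E \is a fin_num.
    by apply: integrable_fin_num => //; exact: intF.
  by rewrite -EFinB => E; rewrite -E addeC subeK.
have l1 := lim h1 c1 p1; have l2 := lim h2 c2 p2.
rewrite -(cvg_lim (@ereal_hausdorff R) l1); apply: cvg_lim; first exact: ereal_hausdorff.
have -> : (fun n => \int[mu]_(x in F n) (h1 x)%:E)%E =
  (fun n => \int[mu]_(x in F n) (h2 x)%:E + (h n.+1%:R - h (- n.+1%:R))%:E)%E.
  by apply/funext => n; rewrite FTC.
rewrite -[X in _ --> X]adde0; apply: cvgeD => //; first by rewrite fin_num_adde_defl.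
apply/fine_cvgP; split; first by near=> n.
apply/cvgrPdist_le => e e0; have e2 : 0 < e / 2 by rewrite divr_gt0.
have [N hN] := h0 _ e2; exists N => // n /= Nn.
have Nn' : N%:R <= n.+1%:R :> R by rewrite ler_nat ltnW.
rewrite sub0r normrN (le_trans (ler_normB _ _)) // [e]splitr lerD // hN ?normrN ?ger0_norm //.
Unshelve. all: by end_near.
Qed.

(** A single term of the exponential series lies below [expR u]. *)
Lemma pow_expN (u : R) k : 0 <= u -> u ^+ k.+1 * expR (- u) <= k.+1`!%:R.
Proof.
move=> u0; rewrite expRN ler_pdivrMr ?expR_gt0 //.
have := expR_ge1Dxn k u0; have f0 : 0 < k.+1`!%:R :> R by rewrite ltr0n fact_gt0.
move=> h; rewrite mulrC -ler_pdivrMr //; apply: le_trans h.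
by rewrite lerDr.
Qed.

(** The derivative of x (x^2 + b)^k e^(-x^2) is the right integrand minus the left one. Later [b] is
    the square of a second coordinate; at k = 0 the meaningless exponent [k.-1] is multiplied by
    0. *)
Lemma gauss_moment_parts (b : R) k : 0 <= b ->
  (\int[mu]_x (2 * x ^+ 2 * (x ^+ 2 + b) ^+ k * expR (- x ^+ 2))%:E =
   \int[mu]_x (((x ^+ 2 + b) ^+ k + 2 * k%:R * x ^+ 2 * (x ^+ 2 + b) ^+ k.-1) * expR (- x ^+ 2))%:E)%E.
Proof.
move=> b0; apply/esym.
have cX : continuous (fun x : R => x ^+ 2) by move=> x; exact: exprn_continuous.
have cE : continuous (fun x : R => expR (- x ^+ 2)).
  move=> x; apply: (@continuous_comp _ _ _ (fun x : R => - x ^+ 2) expR).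
    by apply: continuousN; exact: cX.
  exact: continuous_expR.
have cB j : continuous (fun x : R => (x ^+ 2 + b) ^+ j).
  move=> x; apply: (@continuous_comp _ _ _ (fun x : R => x ^+ 2 + b) (fun x => x ^+ j)).
    by apply: cvgD; [exact: cX|exact: cvg_cst].
  exact: exprn_continuous.
have bx (x : R) : 0 <= x ^+ 2 + b by rewrite addr_ge0 // sqr_ge0.
apply: (@eq_integral_derive_sub (fun x => x * (x ^+ 2 + b) ^+ k * expR (- x ^+ 2))).
- move=> x; apply: cvgM; last exact: cE.
  apply: cvgD; first exact: cB.
  by apply: cvgM; [apply: cvgM; [exact: cvg_cst|exact: cX]|exact: cB].
- move=> x; apply: cvgM; last exact: cE.
  by apply: cvgM; [apply: cvgM; [exact: cvg_cst|exact: cX]|exact: cB].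
- move=> x; rewrite mulr_ge0 ?expR_ge0 // addr_ge0 ?exprn_ge0 // mulr_ge0 ?exprn_ge0 //.
  by rewrite mulr_ge0 ?sqr_ge0 // mulr_ge0.
- by move=> x; rewrite mulr_ge0 ?expR_ge0 // mulr_ge0 ?exprn_ge0 // mulr_ge0 ?sqr_ge0.
- move=> x.
  have d0 : is_derive x 1 (fun x : R => x ^+ 2) (2 * x).
    have -> : (fun x : R => x ^+ 2) = (@id R) * (@id R) by apply/funext => y; rewrite expr2.
    by apply: is_derive_eq; rewrite /GRing.scale /=; ring.
  have d1 : is_derive x 1 (fun x : R => (x ^+ 2 + b) ^+ k) (k%:R * (x ^+ 2 + b) ^+ k.-1 * (2 * x)).
    have d1' : is_derive x 1 (fun x : R => x ^+ 2 + b) (2 * x).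
      by rewrite -[X in is_derive _ _ _ X]addr0; apply: is_deriveD.
    case: k => [|k]; first by rewrite !mul0r; apply: is_derive_cst.
    have -> : (fun x : R => (x ^+ 2 + b) ^+ k.+1) = (fun x : R => x ^+ 2 + b) ^+ k.+1.
      apply/funext => y; elim: k.+1 => [|j IH]; first by rewrite !expr0.
      by rewrite [LHS]exprS IH (exprS (fun x : R => x ^+ 2 + b)).
    exact: is_deriveX.
  have d2 : is_derive x 1 (fun x : R => expR (- x ^+ 2)) (- (2 * x) * expR (- x ^+ 2)).
    have d2' : is_derive x 1 (fun x : R => - x ^+ 2) (- (2 * x)) by exact: is_deriveN.
    have := @is_derive1_comp R expR (fun x : R => - x ^+ 2) x _ _ (is_derive_expR _) d2'.
    by rewrite mulrC.
  have -> : (fun x : R => x * (x ^+ 2 + b) ^+ k * expR (- x ^+ 2)) =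
    (@id R) * (fun x => (x ^+ 2 + b) ^+ k) * (fun x => expR (- x ^+ 2)) by [].
  apply: is_derive_eq; rewrite /GRing.scale /=.
  rewrite [X in X * _ + _](_ : _ = x * (x ^+ 2 + b) ^+ k) //; ring.
- move=> e e0.
  (* For |x| >= 1 one has x^2 + b <= (1 + b) x^2. Hence the boundary term times |x| is at most (1 +
     b)^k (x^2)^(k+2) e^(-x^2), which [pow_expN] bounds by [K]. *)
  pose K : R := (1 + b) ^+ k * k.+2`!%:R.
  have K0 : 0 <= K by rewrite mulr_ge0 // exprn_ge0 // addr_ge0.
  exists (Num.bound (K / e)).+1 => x hx.
  have x1 : 1 <= `|x| by rewrite (le_trans _ hx) // ler1n.
  have xe : K <= e * `|x|.
    rewrite mulrC -ler_pdivrMr // (le_trans (ltW (archi_boundP _))) ?divr_ge0 ?(ltW e0) //.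
    by rewrite (le_trans _ hx) // ler_nat.
  have x0 : 0 < `|x| by rewrite (lt_le_trans ltr01).
  rewrite -(ler_pM2r x0); apply: le_trans xe.
  rewrite !normrM (ger0_norm (expR_ge0 _)) normrX (ger0_norm (bx x)).
  have x21 : 1 <= x ^+ 2 by rewrite -real_normK ?num_real // exprn_ege1.
  have h1 : (x ^+ 2 + b) ^+ k <= (1 + b) ^+ k * (x ^+ 2) ^+ k.
    have hb : x ^+ 2 + b <= (1 + b) * x ^+ 2 by rewrite mulrDl mul1r lerD2l ler_peMr.
    by rewrite -exprMn lerXn2r // nnegrE // (le_trans _ hb).
  have h2 := @pow_expN (x ^+ 2) k.+1 (sqr_ge0 x).
  have E0 := expR_ge0 (- x ^+ 2).
  have -> : `|x| * (x ^+ 2 + b) ^+ k * expR (- x ^+ 2) * `|x| =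
    (x ^+ 2 + b) ^+ k * (x ^+ 2 * expR (- x ^+ 2)).
    have xx : `|x| * `|x| = x ^+ 2 by rewrite -expr2 real_normK ?num_real.
    by move: (expR _) ((_ + b) ^+ k) => E P; rewrite -xx; ring.
  apply: (@le_trans _ _ ((1 + b) ^+ k * (x ^+ 2) ^+ k * (x ^+ 2 * expR (- x ^+ 2)))).
    by rewrite ler_wpM2r // mulr_ge0 // sqr_ge0.
  rewrite /K -mulrA ler_wpM2l ?exprn_ge0 ?addr_ge0 // (le_trans _ h2) //.
  by rewrite mulrA -exprSr ler_wpM2r // ler_weXn2l.
Qed.

End gaussian_parts.

(** * Gaussian moments in a pair of coordinates *)

Section tuple_moments.
Variable R : realType.
Local Notation T := (measurableTypeR R).
Local Notation mu := (@lebesgue_measure R).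
Local Notation power n := (power_measure mu n).
Variable N : nat.
Implicit Types (t : N.-tuple T) (p q : 'I_N).

Definition sumsq t : R := \sum_(k < N) tnth t k ^+ 2.

Lemma measurable_sumsq : measurable_fun setT sumsq.
Proof.
by apply: measurable_sum => k; apply: measurable_funX; exact: measurable_tnth.
Qed.

Lemma measurable_expN_sumsq (c : R) : measurable_fun setT (fun t => expR (- (c * sumsq t))).
Proof.
apply: measurableT_comp => //; apply: measurable_funN; apply: measurable_funM => //.
exact: measurable_sumsq.
Qed.

Lemma sumsq_upd t q x : sumsq (upd t q x) = x ^+ 2 + (sumsq t - tnth t q ^+ 2).
Proof.
rewrite /sumsq (bigD1 q) //= [in RHS](bigD1 q) //= tnth_upd eqxx.
rewrite (eq_bigr (fun k => tnth t k ^+ 2)) => [|k kq]; first by ring.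
by rewrite tnth_upd (negbTE kq).
Qed.

Lemma gauss_parts p q (H : N.-tuple T -> R) k : p != q ->
  measurable_fun setT H -> (forall t, 0 <= H t) -> (forall t x, H (upd t q x) = H t) ->
  (\int[power N]_t (2 * tnth t q ^+ 2 * (tnth t q ^+ 2 + tnth t p ^+ 2) ^+ k * H t * expR (- sumsq t))%:E =
   \int[power N]_t (((tnth t q ^+ 2 + tnth t p ^+ 2) ^+ k + 2 * k%:R * tnth t q ^+ 2 *
     (tnth t q ^+ 2 + tnth t p ^+ 2) ^+ k.-1) * H t * expR (- sumsq t))%:E)%E.
Proof.
move=> pq mH H0 Hq.
have mt i : measurable_fun setT (fun t => tnth t i : R) by exact: measurable_tnth.
have mt2 i : measurable_fun setT (fun t => tnth t i ^+ 2 : R) by exact: measurable_funX.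
have mr j : measurable_fun setT (fun t => (tnth t q ^+ 2 + tnth t p ^+ 2) ^+ j : R).
  by apply: measurable_funX; exact: measurable_funD.
have mE : measurable_fun setT (fun t => expR (- sumsq t)).
  by have := measurable_expN_sumsq 1; under eq_fun do rewrite mul1r.
have r0 j (a b : R) : 0 <= (a ^+ 2 + b ^+ 2) ^+ j by rewrite exprn_ge0 // addr_ge0 // sqr_ge0.
apply: (@eq_integral_upd _ _ q).
- apply/measurable_EFinP; do ! apply: measurable_funM => //.
- apply/measurable_EFinP; do 2 apply: measurable_funM => //.
  apply: measurable_funD => //; do ! apply: measurable_funM => //.
- by move=> t; rewrite lee_fin mulr_ge0 ?expR_ge0 // mulr_ge0 // mulr_ge0 // mulr_ge0 ?sqr_ge0.
- move=> t; rewrite lee_fin mulr_ge0 ?expR_ge0 // mulr_ge0 // addr_ge0 // mulr_ge0 //.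
  by rewrite mulr_ge0 ?sqr_ge0 // mulr_ge0.
(* On the fibre of coordinate [q], the square of coordinate [p] is the parameter [b], and [rho]
   collects the factors that do not involve [q]. *)
move=> t; set b := tnth t p ^+ 2; pose rho := H t * expR (- (sumsq t - tnth t q ^+ 2)).
have rho0 : 0 <= rho by rewrite mulr_ge0 ?expR_ge0.
have E1 x : 2 * tnth (upd t q x) q ^+ 2 * (tnth (upd t q x) q ^+ 2 + tnth (upd t q x) p ^+ 2) ^+ k *
    H (upd t q x) * expR (- sumsq (upd t q x)) =
    rho * (2 * x ^+ 2 * (x ^+ 2 + b) ^+ k * expR (- x ^+ 2)).
  by rewrite sumsq_upd Hq !tnth_upd eqxx (negbTE pq) opprD expRD /rho; ring.
have E2 x : ((tnth (upd t q x) q ^+ 2 + tnth (upd t q x) p ^+ 2) ^+ k +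
    2 * k%:R * tnth (upd t q x) q ^+ 2 * (tnth (upd t q x) q ^+ 2 + tnth (upd t q x) p ^+ 2) ^+ k.-1) *
    H (upd t q x) * expR (- sumsq (upd t q x)) =
    rho * (((x ^+ 2 + b) ^+ k + 2 * k%:R * x ^+ 2 * (x ^+ 2 + b) ^+ k.-1) * expR (- x ^+ 2)).
  rewrite sumsq_upd Hq !tnth_upd eqxx (negbTE pq) opprD expRD /rho -/b.
  by move: (_ ^+ k) (_ ^+ k.-1) (expR _) (expR _) => P Q E E'; ring.
under eq_integral do rewrite E1 EFinM.
under [RHS]eq_integral do rewrite E2 EFinM.
have b0 : 0 <= b by exact: sqr_ge0.
have mx2 : measurable_fun [set: T] (fun x : T => x ^+ 2 : R).
  by apply: (@measurable_funX _ _ _ _ (fun x : T => x : R)); exact: measurable_id.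
have mxb j : measurable_fun [set: T] (fun x : T => (x ^+ 2 + b) ^+ j : R).
  by apply: measurable_funX; exact: measurable_funD.
have mxe : measurable_fun [set: T] (fun x : T => expR (- x ^+ 2) : R).
  by apply: (measurableT_comp (@measurable_expR R)); exact: measurable_funN.
have bj (x : R) j : 0 <= (x ^+ 2 + b) ^+ j by rewrite exprn_ge0 // addr_ge0 // sqr_ge0.
rewrite !ge0_integralZl ?lee_fin //.
- by congr (_ * _)%E; exact: gauss_moment_parts.
- apply/measurable_EFinP; apply: measurable_funM => //; apply: measurable_funD => //.
  by do ! apply: measurable_funM => //.
- move=> x _; rewrite lee_fin mulr_ge0 ?expR_ge0 // addr_ge0 // mulr_ge0 //.
  by rewrite mulr_ge0 ?sqr_ge0 // mulr_ge0.
- by apply/measurable_EFinP; do ! apply: measurable_funM => //.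
- by move=> x _; rewrite lee_fin mulr_ge0 ?expR_ge0 // mulr_ge0 // mulr_ge0 ?sqr_ge0.
Qed.

(** Let r^2 be the sum of the two squares. Adding the integrations by parts in both coordinates
    gives 2 r^(2k+2) on the left and 2 r^(2k) + 2k r^2 r^(2k-2) = 2(k+1) r^(2k) on the right. This
    replaces polar coordinates. *)
Lemma gauss_moment_step p q (H : N.-tuple T -> R) k : p != q ->
  measurable_fun setT H -> (forall t, 0 <= H t) ->
  (forall t x, H (upd t q x) = H t) -> (forall t x, H (upd t p x) = H t) ->
  (\int[power N]_t ((tnth t p ^+ 2 + tnth t q ^+ 2) ^+ k.+1 * H t * expR (- sumsq t))%:E =
   k.+1%:R%:E * \int[power N]_t ((tnth t p ^+ 2 + tnth t q ^+ 2) ^+ k * H t * expR (- sumsq t))%:E)%E.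
Proof.
move=> pq mH H0 Hq Hp; have qp : q != p by rewrite eq_sym.
have e1 := gauss_parts k pq mH H0 Hq; have e2 := gauss_parts k qp mH H0 Hp.
have mt i : measurable_fun setT (fun t => tnth t i : R) by exact: measurable_tnth.
have mt2 i : measurable_fun setT (fun t => tnth t i ^+ 2 : R) by exact: measurable_funX.
have mr i i' j : measurable_fun setT (fun t => (tnth t i ^+ 2 + tnth t i' ^+ 2) ^+ j : R).
  by apply: measurable_funX; exact: measurable_funD.
have mE : measurable_fun setT (fun t => expR (- sumsq t)).
  by have := measurable_expN_sumsq 1; under eq_fun do rewrite mul1r.
have r0 j (a b : R) : 0 <= (a ^+ 2 + b ^+ 2) ^+ j by rewrite exprn_ge0 // addr_ge0 // sqr_ge0.
have two : (2%:E * \int[power N]_t ((tnth t p ^+ 2 + tnth t q ^+ 2) ^+ k.+1 * H t * expR (- sumsq t))%:E =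
   2%:E * (k.+1%:R%:E * \int[power N]_t ((tnth t p ^+ 2 + tnth t q ^+ 2) ^+ k * H t * expR (- sumsq t))%:E))%E.
  rewrite muleA -EFinM -!ge0_integralZl ?lee_fin //; last 4 first.
  - by apply/measurable_EFinP; do ! apply: measurable_funM => //.
  - by move=> t _; rewrite lee_fin mulr_ge0 ?expR_ge0 // mulr_ge0.
  - by apply/measurable_EFinP; do ! apply: measurable_funM => //.
  - by move=> t _; rewrite lee_fin mulr_ge0 ?expR_ge0 // mulr_ge0.
  have m1 i i' : measurable_fun setT (fun t => (2 * tnth t i ^+ 2 *
      (tnth t i ^+ 2 + tnth t i' ^+ 2) ^+ k * H t * expR (- sumsq t))%:E).
    by apply/measurable_EFinP; do ! apply: measurable_funM => //.
  have p1 i i' t : (0 <= (2 * tnth t i ^+ 2 *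
      (tnth t i ^+ 2 + tnth t i' ^+ 2) ^+ k * H t * expR (- sumsq t))%:E)%E.
    by rewrite lee_fin mulr_ge0 ?expR_ge0 // mulr_ge0 // mulr_ge0 // mulr_ge0 ?sqr_ge0.
  have m2 i i' : measurable_fun setT (fun t => (((tnth t i ^+ 2 + tnth t i' ^+ 2) ^+ k +
     2 * k%:R * tnth t i ^+ 2 * (tnth t i ^+ 2 + tnth t i' ^+ 2) ^+ k.-1) * H t * expR (- sumsq t))%:E).
    apply/measurable_EFinP; do 2 apply: measurable_funM => //.
    by apply: measurable_funD => //; do ! apply: measurable_funM => //.
  have p2 i i' t : (0 <= (((tnth t i ^+ 2 + tnth t i' ^+ 2) ^+ k +
     2 * k%:R * tnth t i ^+ 2 * (tnth t i ^+ 2 + tnth t i' ^+ 2) ^+ k.-1) * H t * expR (- sumsq t))%:E)%E.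
    rewrite lee_fin mulr_ge0 ?expR_ge0 // mulr_ge0 // addr_ge0 // mulr_ge0 //.
    by rewrite mulr_ge0 ?sqr_ge0 // mulr_ge0.
  transitivity (\int[power N]_t ((2 * tnth t q ^+ 2 *
      (tnth t q ^+ 2 + tnth t p ^+ 2) ^+ k * H t * expR (- sumsq t))%:E +
      (2 * tnth t p ^+ 2 *
      (tnth t p ^+ 2 + tnth t q ^+ 2) ^+ k * H t * expR (- sumsq t))%:E))%E.
    apply: eq_integral => t _; rewrite -EFinM -EFinD; congr EFin.
    by rewrite exprS [tnth t q ^+ 2 + _]addrC; ring.
  rewrite ge0_integralD // e1 e2 -ge0_integralD //.
  apply: eq_integral => t _; rewrite -EFinM -EFinD; congr EFin.
  rewrite [tnth t q ^+ 2 + _]addrC -natr1; case: (k) => [|j] /=; first by rewrite expr0; ring.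
  by rewrite exprS -natr1; ring.
have := congr1 (fun x => (2^-1%:E * x)%E) two; rewrite /= [in LHS]muleA [in RHS]muleA -!EFinM.
by rewrite mulVf // !mul1e.
Qed.

End tuple_moments.

(** * Norm and inner product of the Fock space *)

Section matrix_coordinates.
Variable R : realType.
Local Notation C := (Cplx R).
Local Notation T := (measurableTypeR R).
Variables m n : nat.
Local Notation N := (m * n + m * n)%N.
Local Notation mxo := (@mx_of R m n).
Implicit Types (F G : 'M[C]_(m, n) -> C) (z : 'M[C]_(m, n)).

Definition rei (p : 'I_m * 'I_n) : 'I_N := lshift (m * n) (mxvec_index p.1 p.2).
Definition imi (p : 'I_m * 'I_n) : 'I_N := rshift (m * n) (mxvec_index p.1 p.2).

Lemma mxvec_index_inj (p q : 'I_m * 'I_n) :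
  (mxvec_index p.1 p.2 == mxvec_index q.1 q.2) = (p == q).
Proof.
apply/eqP/eqP => [|-> //]; case: p q => [i j] [k l] /= e.
have [g gK _] := curry_mxvec_bij m n.
by rewrite -(gK (i, j)) ?inE // -(gK (k, l)) ?inE //= e.
Qed.

Lemma rei_eq p q : (rei p == rei q) = (p == q).
Proof. by rewrite /rei eq_lshift mxvec_index_inj. Qed.
Lemma imi_eq p q : (imi p == imi q) = (p == q).
Proof. by rewrite /imi eq_rshift mxvec_index_inj. Qed.
Lemma rei_imi p q : (rei p == imi q) = false.
Proof. by rewrite /rei /imi eq_lrshift. Qed.
Lemma imi_rei p q : (imi p == rei q) = false.
Proof. by rewrite /rei /imi eq_rlshift. Qed.

Lemma mx_ofE (t : N.-tuple T) i j :
  mxo t i j = Complex (tnth t (rei (i, j))) (tnth t (imi (i, j))) :> C.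
Proof. by rewrite mxE. Qed.

Definition nsq z : R := \sum_i \sum_j cabs (z i j) ^+ 2.

Lemma gaussE z : gauss z = expR (- nsq z).
Proof.
rewrite /gauss; congr (expR (- _)); rewrite /nsq exchange_big /= Cre_sum.
apply: eq_bigr => j _; rewrite mxE Cre_sum; apply: eq_bigr => i _.
by rewrite !mxE conjC_mul.
Qed.

Lemma nsq_mx_of (t : N.-tuple T) : nsq (mxo t) = sumsq t.
Proof.
rewrite /nsq /sumsq big_split_ord /= !(reindex _ (curry_mxvec_bij m n)) /= -big_split /=.
rewrite pair_big /=; apply: eq_bigr => -[i j] _ /=.
by rewrite mx_ofE cabs_sqr.
Qed.

Lemma gauss_mx_of (t : N.-tuple T) : gauss (mxo t) = expR (- sumsq t).
Proof. by rewrite gaussE nsq_mx_of. Qed.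

Lemma gauss_ge0 z : 0 <= gauss z. Proof. by rewrite gaussE expR_ge0. Qed.

Definition cmeas F := measurable_fun setT (fun t => Cre (F (mxo t))) /\
  measurable_fun setT (fun t => Cim (F (mxo t))).

Lemma mx_of_upd (t : N.-tuple T) q x :
  mxo (upd t q x) = mxo (upd t q 0) + RtoC x *: mxo (upd [tuple of nseq N (0 : R)] q 1).
Proof.
apply/matrixP => i j; rewrite [RHS]mxE [X in _ = _ + X]mxE !mx_ofE !tnth_upd.
have z0 k : tnth [tuple of nseq N (0 : R)] k = 0 by rewrite (tnth_nth 0) /= nth_nseq ltn_ord.
rewrite !z0; apply: Ceq; rewrite ?CreD ?CimD ?CreZ ?CimZ /=.
  by case: eqP => _; ring.
by case: eqP => _; ring.
Qed.

Lemma holomorphic_cmeas F : holomorphic F -> cmeas F.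
Proof.
move=> hF.
have H t q : ccont (fun x : R => F (mxo (upd t q x))).
  apply: ccontP => x e e0.
  have fE := differentiable_entire_line (mxo (upd t q 0)) (mxo (upd [tuple of nseq N (0 : R)] q 1)) hF.
  have [r r0 hr] := entire_continuous (RtoC x) fE e0.
  exists r => // y yx; have := hr (RtoC y); rewrite -RtoCB cabs_RtoC => /(_ yx).
  by rewrite -!mx_of_upd.
split; apply: measurable_separately_continuous => t q.
  exact: (H t q).1.
exact: (H t q).2.
Qed.

Lemma cmeasD F G : cmeas F -> cmeas G -> cmeas (fun z => F z + G z).
Proof.
move=> [f1 f2] [g1 g2]; split.
  by under eq_fun do rewrite CreD; exact: measurable_funD.
by under eq_fun do rewrite CimD; exact: measurable_funD.
Qed.

Lemma cmeasM F G : cmeas F -> cmeas G -> cmeas (fun z => F z * G z).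
Proof.
move=> [f1 f2] [g1 g2]; split.
  by under eq_fun do rewrite CreM; apply: measurable_funB; exact: measurable_funM.
by under eq_fun do rewrite CimM; apply: measurable_funD; exact: measurable_funM.
Qed.

Lemma cmeas_conj F : cmeas F -> cmeas (fun z => (F z)^*).
Proof.
move=> [f1 f2]; split; first by under eq_fun do rewrite Cre_conj.
by under eq_fun do rewrite Cim_conj; exact: measurable_funN.
Qed.

Lemma cmeas_RtoC (g : 'M[C]_(m, n) -> R) :
  measurable_fun setT (fun t => g (mxo t)) -> cmeas (fun z => RtoC (g z)).
Proof. by move=> mg; split => //=; exact: measurable_cst. Qed.

Lemma measurable_cabs2 F : cmeas F -> measurable_fun setT (fun t => cabs (F (mxo t)) ^+ 2).
Proof.
move=> [f1 f2]; under eq_fun do rewrite cabs_sqr.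
by apply: measurable_funD; exact: measurable_funX.
Qed.

Lemma measurable_gauss : measurable_fun setT (fun t => gauss (mxo t)).
Proof.
under eq_fun do rewrite gauss_mx_of.
by have := @measurable_expN_sumsq R N 1; under eq_fun do rewrite mul1r.
Qed.

(** The map is realized on the real coordinates, where the measure lives. *)
Definition mx_invariant (g : 'M[C]_(m, n) -> 'M[C]_(m, n)) :=
  exists2 h, leb_invariant h & forall t, mxo (h t) = g (mxo t).

Lemma mx_invariant_id : mx_invariant id.
Proof. by exists id => //; exact: leb_invariant_id. Qed.

Lemma mx_invariant_comp g1 g2 : mx_invariant g1 -> mx_invariant g2 ->
  mx_invariant (g1 \o g2).
Proof.
move=> [h1 i1 e1] [h2 i2 e2]; exists (h1 \o h2); first exact: leb_invariant_comp.
by move=> t /=; rewrite e1 e2.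
Qed.

Lemma mx_invariant_integral g (f : 'M[C]_(m, n) -> \bar R) : mx_invariant g ->
  measurable_fun setT (fun t => f (mxo t)) ->
  (\int[leb R m n]_t f (g (mxo t)) = \int[leb R m n]_t f (mxo t))%E.
Proof.
move=> [h hi e] mf; rewrite -[RHS](leb_invariant_integral hi) //.
by apply: eq_integral => t _; rewrite e.
Qed.

Lemma mx_invariant_cmeas g F : mx_invariant g -> cmeas F -> cmeas (F \o g).
Proof.
move=> [h [mh _] e] [m1 m2]; split.
  by under eq_fun do rewrite /= -e; exact: (measurableT_comp m1 mh).
by under eq_fun do rewrite /= -e; exact: (measurableT_comp m2 mh).
Qed.

(** With [cabs u = 1] this is a rotation of one entry; [u = 0] deletes the entry. Both uses
    matter. *)
Definition sc (p : 'I_m * 'I_n) (u : C) z : 'M[C]_(m, n) :=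
  \matrix_(i, j) if (i, j) == p then u * z i j else z i j.

Lemma mx_invariant_sc p (u : C) : cabs u = 1 -> mx_invariant (sc p u).
Proof.
move=> u1; exists (rot2 (rei p) (imi p) (Cre u) (Cim u)).
  apply: leb_invariant_rot2; first by rewrite rei_imi.
  by rewrite -cabs_sqr u1 expr1n.
move=> t; apply/matrixP => i j; rewrite mx_ofE !mxE !tnth_rot2 ?rei_imi //.
rewrite rei_eq imi_eq imi_rei; case: eqP => [<-|//].
by apply: Ceq; rewrite ?CreM ?CimM /=; ring.
Qed.

Lemma mx_invariant_translate z0 : mx_invariant (fun z => z + z0).
Proof.
pose c : N.-tuple T := [tuple (match fintype.split k with inl a => Cre (mxvec z0 0 a) | inr a => Cim (mxvec z0 0 a) end) | k < N].
(* Restricting the translation to the coordinates in [s] lets an induction add one elementary shift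
   at a time. *)
pose h (s : seq 'I_N) (t : N.-tuple T) : N.-tuple T :=
  [tuple if k \in s then (tnth t k + tnth c k : R) else tnth t k | k < N].
have hi s : uniq s -> leb_invariant (h s).
  elim: s => [_|q s IH /= /andP[qs us]].
    rewrite (_ : h [::] = id); first exact: leb_invariant_id.
    by apply/funext => t; apply: eq_from_tnth => k; rewrite tnth_mktuple.
  rewrite (_ : h (q :: s) = (fun t => upd t q (tnth t q + tnth c q : R)) \o h s).
    apply: leb_invariant_comp; last exact: IH.
    by apply: (@leb_invariant_shift _ _ _ (fun=> tnth c q)).
  apply/funext => t; apply: eq_from_tnth => k; rewrite tnth_upd !tnth_mktuple inE (negbTE qs).
  by case: eqP => [->|].
exists (h (enum 'I_N)); first by apply: hi; exact: enum_uniq.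
move=> t; apply/matrixP => i j; rewrite mx_ofE !mxE !tnth_mktuple !mem_enum /=.
have -> : fintype.split (rei (i, j)) = inl (mxvec_index i j).
  by rewrite -[RHS]unsplitK.
have -> : fintype.split (imi (i, j)) = inr (mxvec_index i j).
  by rewrite -[RHS]unsplitK.
by rewrite !mxvecE; apply: Ceq; rewrite ?CreD ?CimD.
Qed.

Lemma integral_gauss : (\int[leb R m n]_t (gauss (mxo t))%:E = (pi ^+ (m * n))%:E)%E.
Proof.
have := @integral_power_prod R N (@gauss_fun R) (Num.sqrt pi) (@measurable_gauss_fun R)
  (@gauss_fun_ge0 R) (@integralT_gauss R).
have -> : Num.sqrt pi ^+ N = pi ^+ (m * n) :> R.
  by rewrite exprD -exprMn -expr2 sqr_sqrtr // pi_ge0.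
move=> <-.
apply: eq_integral => t _; rewrite gauss_mx_of /sumsq -sumrN expR_sum //.
Qed.

(** The mass of this weight enters only a constant in the bound for point evaluations, so positivity
    and finiteness suffice: in one variable it is dominated by the Gaussian and is at least e^(-2)
    on [0, 1]. *)
Lemma integral_gauss2 : exists2 I : R, 0 < I &
  (\int[leb R m n]_t (expR (- (2 * nsq (mxo t))))%:E = I%:E)%E.
Proof.
pose phi (x : R) := expR (- (2 * x ^+ 2)).
have mphi : measurable_fun setT phi.
  apply: continuous_measurable_fun => x.
  apply: (@continuous_comp _ _ _ (fun x : R => - (2 * x ^+ 2)) expR); last exact: continuous_expR.
  apply: continuousN; apply: continuousM; first exact: cvg_cst.
  exact: exprn_continuous.
have phi0 x : 0 <= phi x by exact: expR_ge0.
have fin : (\int[lebesgue_measure]_x (phi x)%:E)%E \is a fin_num.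
  rewrite ge0_fin_numE; last by apply: integral_ge0 => x _; rewrite lee_fin.
  apply: (@le_lt_trans _ _ (\int[lebesgue_measure]_x (gauss_fun x)%:E)%E); last first.
    by rewrite integralT_gauss ltry.
  apply: ge0_le_integral => //.
  - by move=> x _; rewrite lee_fin.
  - exact/measurable_EFinP.
  - by apply/measurable_EFinP; exact: measurable_gauss_fun.
  - move=> x _; rewrite lee_fin ler_expR lerN2.
    by have := sqr_ge0 x; lra.
pose I1 := fine (\int[lebesgue_measure]_x (phi x)%:E)%E.
have I1E : (\int[lebesgue_measure]_x (phi x)%:E = I1%:E)%E by rewrite fineK.
have I10 : 0 < I1.
  rewrite -lte_fin -I1E.
  apply: (@lt_le_trans _ _ (\int[lebesgue_measure]_(x in `[0%R, 1%R]) (expR (- 2))%:E)%E).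
    rewrite integral_cst //= lebesgue_measure_itv /= lte_fin ltr01 oppr0 adde0 mule1.
    by rewrite lte_fin expR_gt0.
  apply: (@le_trans _ _ (\int[lebesgue_measure]_(x in `[0%R, 1%R]) (phi x)%:E)%E).
    apply: ge0_le_integral => //.
    - by apply/measurable_EFinP; exact: measurable_funTS.
    - move=> x /=; rewrite in_itv /= => /andP[x0 x1]; rewrite lee_fin ler_expR lerN2.
      have : x ^+ 2 <= 1 by rewrite expr_le1.
      lra.
  apply: ge0_subset_integral => //.
    by apply/measurable_EFinP.
  by move=> x _; rewrite lee_fin.
exists (I1 ^+ N); first by rewrite exprn_gt0.
rewrite -(integral_power_prod N mphi phi0 I1E).
apply: eq_integral => t _; rewrite nsq_mx_of /sumsq mulr_sumr -sumrN expR_sum //.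
Qed.

End matrix_coordinates.

Lemma fatou_le d (X : measurableType d) (R : realType) (mu : {measure set X -> \bar R})
    (g : nat -> X -> R) (f : X -> R) (c : \bar R) N0 :
  (forall n, measurable_fun setT (g n)) -> (forall n x, 0 <= g n x) ->
  (forall x, (fun n => g n x) @ \oo --> f x) ->
  (forall n, (N0 <= n)%N -> (\int[mu]_x (g n x)%:E <= c)%E) ->
  (\int[mu]_x (f x)%:E <= c)%E.
Proof.
move=> mg g0 gf gc.
have mG n : measurable_fun setT (fun x => (g (n + N0)%N x)%:E) by apply/measurable_EFinP.
have := @fatou _ _ _ mu setT measurableT (fun n x => (g (n + N0)%N x)%:E) mG.
have G0 n x : setT x -> (0%R <= (g (n + N0)%N x)%:E)%E by rewrite lee_fin.
move=> /(_ G0) h.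
have -> : (\int[mu]_x (f x)%:E = \int[mu]_x limn_einf (fun n => (g (n + N0)%N x)%:E))%E.
  apply: eq_integral => x _; apply/esym.
  have fx : (fun n => (g (n + N0)%N x)%:E) @ \oo --> (f x)%:E.
    apply/fine_cvgP; split; first exact: nearW.
    by have := gf x; rewrite -(cvg_shiftn N0).
  by have [-> _] := cvg_limn_einf_sup fx.
apply: (le_trans h); rewrite limn_einf_lim; apply: lime_le.
  exact: is_cvg_einfs.
apply: nearW => n; apply: (@le_trans _ _ (\int[mu]_x (g (n + N0)%N x)%:E)%E).
  by apply: ereal_inf_lbound; exists n => /=.
by apply: gc; rewrite leq_addl.
Qed.

Section Rintegral_linear.
Context d (X : measurableType d) (R : realType) (mu : {measure set X -> \bar R}).
Variables (f g : X -> R).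
Hypotheses (hf : mu.-integrable setT (EFin \o f)) (hg : mu.-integrable setT (EFin \o g)).

Lemma integrable_lin (a b : R) : mu.-integrable setT (EFin \o (fun t => a * f t + b * g t)).
Proof.
rewrite (_ : _ \o _ = (fun t => a%:E * (EFin \o f) t)%E \+ (fun t => b%:E * (EFin \o g) t)%E) //.
by apply: integrableD => //; exact: integrableZl.
Qed.

Lemma Rintegral_lin (a b : R) : (\int[mu]_t (a * f t + b * g t) =
  a * \int[mu]_t f t + b * \int[mu]_t g t)%R.
Proof.
have h (c : R) (k : X -> R) : mu.-integrable setT (EFin \o k) ->
    mu.-integrable setT (EFin \o (fun t => c * k t)).
  move=> hk; rewrite (_ : _ \o _ = (fun t => c%:E * (EFin \o k) t)%E) //.
  exact: integrableZl.
by rewrite RintegralD //; [rewrite !RintegralZl|exact: h|exact: h].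
Qed.

End Rintegral_linear.

(** * Weighted square norms, the Fock norm and the inner product *)

Section fock_norm.
Variable R : realType.
Local Notation C := (Cplx R).
Local Notation T := (measurableTypeR R).
Variables m n : nat.
Local Notation mxo := (@mx_of R m n).
Local Notation mu := (leb R m n).
Implicit Types (F G : 'M[C]_(m, n) -> C) (z : 'M[C]_(m, n)) (rho : 'M[C]_(m, n) -> R).

(** The weight is a parameter because point evaluations are first bounded with a weight other than
    [gauss]. Extended real values admit functions not yet known to be square integrable, such as
    components and limits. *)
Definition l2w rho F : \bar R := (\int[mu]_t (cabs (F (mxo t)) ^+ 2 * rho (mxo t))%:E)%E.

Definition weight rho := measurable_fun setT (fun t => rho (mxo t)) /\ forall z, 0 <= rho z.

Lemma weight_gauss : weight (@gauss R m n).
Proof. by split; [exact: measurable_gauss|exact: gauss_ge0]. Qed.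

Lemma l2w_measurable rho F : weight rho -> cmeas F ->
  measurable_fun setT (fun t => (cabs (F (mxo t)) ^+ 2 * rho (mxo t))%:E).
Proof.
move=> [mr _] mF; apply/measurable_EFinP; apply: measurable_funM => //.
exact: measurable_cabs2.
Qed.

Lemma l2w_ge0 rho F : weight rho -> (0 <= l2w rho F)%E.
Proof. by move=> [_ r0]; apply: integral_ge0 => t _; rewrite lee_fin mulr_ge0 ?sqr_ge0. Qed.

Lemma l2wZ rho F (a : C) : weight rho -> cmeas F ->
  l2w rho (fun z => a * F z) = ((cabs a ^+ 2)%:E * l2w rho F)%E.
Proof.
move=> wr mF; have [mr r0] := wr; rewrite -ge0_integralZl ?lee_fin ?sqr_ge0 //.
- by apply: eq_integral => t _; rewrite -EFinM cabsM; congr EFin; ring.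
- exact: l2w_measurable.
- by move=> t _; rewrite lee_fin mulr_ge0 ?sqr_ge0.
Qed.

(** The parameter [e] stays free: taken as a ratio of norms, it turns this pointwise inequality into
    the triangle inequality. *)
Lemma cabs_sqrD_le (z w : C) (e : R) : 0 < e ->
  cabs (z + w) ^+ 2 <= (1 + e) * cabs z ^+ 2 + (1 + e^-1) * cabs w ^+ 2.
Proof.
move=> e0; have h := cabsD z w; have z0 := cabs_ge0 z; have w0 := cabs_ge0 w.
have zw0 := cabs_ge0 (z + w).
apply: (@le_trans _ _ ((cabs z + cabs w) ^+ 2)).
  by rewrite lerXn2r // nnegrE // addr_ge0.
rewrite -subr_ge0.
have -> : (1 + e) * cabs z ^+ 2 + (1 + e^-1) * cabs w ^+ 2 - (cabs z + cabs w) ^+ 2 =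
   (e * cabs z - cabs w) ^+ 2 / e by field; rewrite gt_eqF.
by rewrite divr_ge0 ?sqr_ge0 // ltW.
Qed.

Lemma l2wD_le rho F G (e : R) : weight rho -> cmeas F -> cmeas G -> 0 < e ->
  (l2w rho (fun z => F z + G z)%R <= (1 + e)%:E * l2w rho F + (1 + e^-1)%:E * l2w rho G)%E.
Proof.
move=> wr mF mG e0; have [mr r0] := wr.
have e1 : 0 <= 1 + e by rewrite addr_ge0 // ltW.
have e2 : 0 <= 1 + e^-1 by rewrite addr_ge0 // invr_ge0 ltW.
have p H t : (0 <= (cabs (H (mxo t) : C) ^+ 2 * rho (mxo t))%:E)%E.
  by rewrite lee_fin mulr_ge0 ?sqr_ge0.
rewrite -!ge0_integralZl ?lee_fin //; [|exact: l2w_measurable|exact: l2w_measurable].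
have mFe := l2w_measurable wr mF; have mGe := l2w_measurable wr mG.
rewrite -ge0_integralD //; last 4 first.
- by move=> t _; rewrite mule_ge0.
- exact: measurable_funeM.
- by move=> t _; rewrite mule_ge0.
- exact: measurable_funeM.
apply: ge0_le_integral => //.
- by move=> t _; rewrite lee_fin mulr_ge0 ?sqr_ge0.
- exact: (l2w_measurable wr (cmeasD mF mG)).
- by apply: emeasurable_funD; exact: measurable_funeM.
move=> t _; rewrite -!EFinM -EFinD lee_fin.
have := ler_wpM2r (r0 (mxo t)) (cabs_sqrD_le (F (mxo t)) (G (mxo t)) e0).
by rewrite [leRHS]mulrDl -!mulrA.
Qed.

Lemma l2w_fatou rho (Fn : nat -> 'M[C]_(m, n) -> C) F (c : \bar R) N0 : weight rho ->
  (forall k, cmeas (Fn k)) -> (forall z, ctends (fun k => Fn k z) (F z)) ->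
  (forall k, (N0 <= k)%N -> (l2w rho (Fn k) <= c)%E) -> (l2w rho F <= c)%E.
Proof.
move=> wr mFn FnF hc; have [mr r0] := wr.
apply: (@fatou_le _ _ _ mu (fun k t => cabs (Fn k (mxo t)) ^+ 2 * rho (mxo t)) _ c N0) => //.
- by move=> k; apply/measurable_EFinP; exact: l2w_measurable.
- by move=> k t; rewrite mulr_ge0 ?sqr_ge0.
move=> t; apply: cvgM; last exact: cvg_cst.
have cvc := ctends_cabs (FnF (mxo t)).
by apply: cvgM.
Qed.

Lemma l2w_invariant rho F g : weight rho -> cmeas F -> mx_invariant g ->
  (forall z, rho (g z) = rho z) -> l2w rho (F \o g) = l2w rho F.
Proof.
move=> wr mF gi rg; rewrite -[RHS](mx_invariant_integral gi (f := fun z => (cabs (F z) ^+ 2 * rho z)%:E)).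
  by apply: eq_integral => t _; rewrite rg.
exact: l2w_measurable.
Qed.

Definition l2 F := l2w (@gauss R m n) F.

(** [fine] sends an infinite value to 0, so [nrm2] measures [F] only when [l2 F] is finite;
    statements about it therefore often assume [fock]. *)
Definition nrm2 F : R := pi ^- (m * n) * fine (l2 F).

Lemma piN_gt0 : 0 < pi ^- (m * n) :> R.
Proof. by rewrite invr_gt0 exprn_gt0 // pi_gt0. Qed.

Lemma inner_self F : inner F F = RtoC (nrm2 F).
Proof.
rewrite /inner /nrm2 RtoCM; congr (_ * _); rewrite /Cintegral; apply: Ceq => /=.
  congr fine; apply: eq_integral => t _.
  by rewrite conjC_mul -RtoCM.
rewrite /Rintegral (eq_integral (fun=> 0%E)) ?integral0 // => t _.
by rewrite conjC_mul -RtoCM.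
Qed.

Lemma fnormE F : fnorm F = Num.sqrt (nrm2 F).
Proof. by rewrite /fnorm inner_self. Qed.

Lemma nrm2_ge0 F : 0 <= nrm2 F.
Proof. by rewrite mulr_ge0 ?fine_ge0 ?l2w_ge0 //; [exact/ltW/piN_gt0|exact: weight_gauss]. Qed.

Lemma fnorm_ge0 F : 0 <= fnorm F. Proof. by rewrite fnormE sqrtr_ge0. Qed.

Lemma fnorm_sqr F : fnorm F ^+ 2 = nrm2 F.
Proof. by rewrite fnormE sqr_sqrtr // nrm2_ge0. Qed.

Lemma fockP F : fock F <-> holomorphic F /\ (l2 F < +oo)%E.
Proof.
have E : (\int[mu]_t (Cre (`|F (mxo t)| ^+ 2) * gauss (mxo t))%:E = l2 F)%E.
  by apply: eq_integral => t _; rewrite Cre_norm2.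
rewrite /fock /= E; split=> -[hF h]; split=> //.
  have l0 := l2w_ge0 F weight_gauss; rewrite -/(l2 F) in l0.
  move: h; case: (l2 F) l0 => [r _ _|_|//]; first by rewrite ltry.
  by rewrite mulry gtr0_sg ?piN_gt0 // mul1e ltxx.
have l0 := l2w_ge0 F weight_gauss; rewrite -/(l2 F) in l0.
by apply: lte_mul_pinfty => //; rewrite lee_fin (ltW piN_gt0).
Qed.

Lemma fock_cmeas F : fock F -> cmeas F.
Proof. by move=> [/holomorphic_cmeas]. Qed.

Lemma fock_l2 F : fock F -> l2 F = (fine (l2 F))%:E.
Proof.
move=> /fockP[_ h]; rewrite fineK // ge0_fin_numE //.
exact: (l2w_ge0 F weight_gauss).
Qed.

Lemma fock_l2E F : fock F -> l2 F = (pi ^+ (m * n) * nrm2 F)%:E.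
Proof.
move=> hF; rewrite fock_l2 // /nrm2 mulrA divff ?mul1r //.
by rewrite gt_eqF // exprn_gt0 // pi_gt0.
Qed.

Lemma fockZ F (a : C) : fock F -> fock (fun z => a * F z).
Proof.
move=> hF; apply/fockP; split.
  move=> z; have [h _] := hF.
  have -> : (fun z => a * F z) = a *: F by [].
  by apply: differentiableZ; exact: h.
rewrite /l2 l2wZ; [|exact: weight_gauss|exact: fock_cmeas].
rewrite -/(l2 F) (fock_l2 hF).
by rewrite -EFinM ltry.
Qed.

Lemma fockD F G : fock F -> fock G -> fock (fun z => F z + G z).
Proof.
move=> hF hG; apply/fockP; split.
  move=> z; have [h _] := hF; have [h' _] := hG.
  have -> : (fun z => F z + G z) = F + G by [].
  by apply: differentiableD; [exact: h|exact: h'].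
apply: (le_lt_trans (l2wD_le weight_gauss (fock_cmeas hF) (fock_cmeas hG) ltr01)).
by rewrite -!/(l2 _) (fock_l2 hF) (fock_l2 hG) -!EFinM -EFinD ltry.
Qed.

Lemma fock0 : fock (fun _ : 'M[C]_(m, n) => 0).
Proof.
apply/fockP; split; first by move=> z; exact: differentiable_cst.
rewrite /l2 /l2w; under eq_integral do rewrite cabs0 expr0n /= mul0r.
by rewrite integral0.
Qed.

Lemma fock_lin F G (a : C) : fock F -> fock G -> fock (fun z => a * F z + G z).
Proof. by move=> hF hG; exact: fockD (fockZ a hF) hG. Qed.

Lemma fockB F G : fock F -> fock G -> fock (fun z => F z - G z).
Proof.
move=> hF hG; have := fock_lin (-1) hG hF.
by congr fock; apply/funext => z; rewrite mulN1r addrC.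
Qed.

Lemma fock_sum I (s : seq I) (H : I -> 'M[C]_(m, n) -> C) :
  (forall i, fock (H i)) -> fock (fun z => \sum_(i <- s) H i z).
Proof.
move=> h; elim: s => [|i s IH].
  by under eq_fun do rewrite big_nil; exact: fock0.
by under eq_fun do rewrite big_cons; exact: fockD.
Qed.

Lemma nrm2Z F (a : C) : fock F -> nrm2 (fun z => a * F z) = cabs a ^+ 2 * nrm2 F.
Proof.
move=> hF; rewrite /nrm2 /l2 l2wZ; [|exact: weight_gauss|exact: fock_cmeas].
by rewrite -/(l2 F) (fock_l2 hF) -EFinM /=; ring.
Qed.

Lemma fnormZ F (a : C) : fock F -> fnorm (fun z => a * F z) = cabs a * fnorm F.
Proof.
move=> hF; rewrite !fnormE nrm2Z // sqrtrM ?sqr_ge0 // sqrtr_sqr ger0_norm //.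
exact: cabs_ge0.
Qed.

Lemma nrm2D_le F G (e : R) : fock F -> fock G -> 0 < e ->
  nrm2 (fun z => F z + G z) <= (1 + e) * nrm2 F + (1 + e^-1) * nrm2 G.
Proof.
move=> hF hG e0.
have := l2wD_le weight_gauss (fock_cmeas hF) (fock_cmeas hG) e0.
rewrite -!/(l2 _) (fock_l2 hF) (fock_l2 hG) (fock_l2 (fockD hF hG)).
rewrite -!EFinM -EFinD lee_fin -(ler_pM2l piN_gt0) => h.
by rewrite (le_trans h) // /nrm2; lra.
Qed.

Lemma fnormD F G : fock F -> fock G -> fnorm (fun z => F z + G z) <= fnorm F + fnorm G.
Proof.
move=> hF hG; apply/ler_addgt0Pr => e e0.
pose a := fnorm F + e / 2; pose b := fnorm G + e / 2.
have e2 : 0 < e / 2 by rewrite divr_gt0.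
have a0 : 0 < a by rewrite ltr_wpDl // fnorm_ge0.
have b0 : 0 < b by rewrite ltr_wpDl // fnorm_ge0.
have -> : fnorm F + fnorm G + e = a + b by rewrite /a /b; field.
(* With e = b / a the right side is at most (a + b)^2. Adding [e / 2] to each norm keeps [a] and [b]
   positive even for norm 0. *)
have h := nrm2D_le hF hG (divr_gt0 b0 a0).
have Fa : nrm2 F <= a ^+ 2.
  by rewrite -fnorm_sqr lerXn2r ?nnegrE ?fnorm_ge0 ?(ltW a0) // /a lerDl ltW.
have Gb : nrm2 G <= b ^+ 2.
  by rewrite -fnorm_sqr lerXn2r ?nnegrE ?fnorm_ge0 ?(ltW b0) // /b lerDl ltW.
have : fnorm (fun z => F z + G z) ^+ 2 <= (a + b) ^+ 2.
  rewrite fnorm_sqr (le_trans h) //.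
  have -> : (a + b) ^+ 2 = (1 + b / a) * a ^+ 2 + (1 + (b / a)^-1) * b ^+ 2.
    by field; rewrite !gt_eqF.
  by rewrite lerD // ler_wpM2l // addr_ge0 ?invr_ge0 // divr_ge0 // ltW.
by rewrite ler_sqr ?nnegrE ?fnorm_ge0 // addr_ge0 // ltW.
Qed.

Lemma fnormB_le F G H : fock F -> fock G -> fock H ->
  fnorm (fun z => F z - H z) <= fnorm (fun z => F z - G z) + fnorm (fun z => G z - H z).
Proof.
move=> hF hG hH; have -> : (fun z => F z - H z) = (fun z => (F z - G z) + (G z - H z)).
  by apply/funext => z; ring.
by apply: fnormD; exact: fockB.
Qed.

Lemma fnorm0 : fnorm (fun _ : 'M[C]_(m, n) => 0) = 0.
Proof.
transitivity (fnorm (fun z : 'M[C]_(m, n) => 0 * (fun=> 0 : C) z)).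
  by congr fnorm; apply/funext => z; rewrite mul0r.
by rewrite (fnormZ 0 fock0) cabs0 mul0r.
Qed.

Lemma fnormN F G : fock F -> fock G -> fnorm (fun z => F z - G z) = fnorm (fun z => G z - F z).
Proof.
move=> hF hG; rewrite -[RHS]mul1r -(cabs1 R) -cabsN -fnormZ; last exact: fockB.
by congr fnorm; apply/funext => z; rewrite mulN1r opprB.
Qed.

Lemma fnorm_le_add F G : fock F -> fock G -> fnorm F <= fnorm G + fnorm (fun z => F z - G z).
Proof.
move=> hF hG; have := fnormD hG (fockB hF hG).
by congr (fnorm _ <= _); apply/funext => z; ring.
Qed.

Lemma fnorm_sum I (s : seq I) (H : I -> 'M[C]_(m, n) -> C) : (forall i, fock (H i)) ->
  fnorm (fun z => \sum_(i <- s) H i z) <= \sum_(i <- s) fnorm (H i).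
Proof.
move=> h; elim: s => [|i s IH].
  by rewrite big_nil; under eq_fun do rewrite big_nil; rewrite fnorm0.
rewrite big_cons; under eq_fun do rewrite big_cons.
by rewrite (le_trans (fnormD _ _)) ?lerD2l //; exact: fock_sum.
Qed.

Let integrand F G z : C := (F z)^* * G z * RtoC (gauss z).

(** The product of the moduli is bounded by the sum of their squares, which is integrable against
    the Gaussian. *)
Lemma integrable_integrand F G : fock F -> fock G ->
  mu.-integrable setT (fun t => (Cre (integrand F G (mxo t)))%:E) /\
  mu.-integrable setT (fun t => (Cim (integrand F G (mxo t)))%:E).
Proof.
move=> hF hG; have mF := fock_cmeas hF; have mG := fock_cmeas hG.
have [m1 m2] : cmeas (integrand F G).
  apply: cmeasM; last by apply: cmeas_RtoC; exact: measurable_gauss.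
  by apply: cmeasM => //; exact: cmeas_conj.
have bnd t : cabs (integrand F G (mxo t)) <=
   cabs (F (mxo t)) ^+ 2 * gauss (mxo t) + cabs (G (mxo t)) ^+ 2 * gauss (mxo t).
  rewrite /integrand !cabsM cabs_conj cabs_RtoC ger0_norm ?gauss_ge0 // -mulrDl ler_wpM2r ?gauss_ge0 //.
  have := cabs_ge0 (F (mxo t)); have := cabs_ge0 (G (mxo t)).
  have := sqr_ge0 (cabs (F (mxo t)) - cabs (G (mxo t))); nra.
have fin : (\int[mu]_t ((cabs (F (mxo t)) ^+ 2 * gauss (mxo t))%:E +
   (cabs (G (mxo t)) ^+ 2 * gauss (mxo t))%:E) < +oo)%E.
  rewrite ge0_integralD //.
  - by rewrite -!/(l2w _ _) -!/(l2 _) (fock_l2 hF) (fock_l2 hG) -EFinD ltry.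
  - by move=> t _; rewrite lee_fin mulr_ge0 ?sqr_ge0 ?gauss_ge0.
  - by apply: l2w_measurable => //; exact: weight_gauss.
  - by move=> t _; rewrite lee_fin mulr_ge0 ?sqr_ge0 ?gauss_ge0.
  - by apply: l2w_measurable => //; exact: weight_gauss.
have mbnd : measurable_fun setT (fun t => ((cabs (F (mxo t)) ^+ 2 * gauss (mxo t))%:E +
   (cabs (G (mxo t)) ^+ 2 * gauss (mxo t))%:E)%E).
  by apply: emeasurable_funD; apply: l2w_measurable => //; exact: weight_gauss.
split; apply/integrableP; split; do ?exact/measurable_EFinP; apply: le_lt_trans fin.
  apply: ge0_le_integral => //.
  - by apply: measurableT_comp => //; exact/measurable_EFinP.
  - by move=> t _; rewrite -EFinD lee_fin (le_trans (Cre_le_cabs _)).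
apply: ge0_le_integral => //.
- by apply: measurableT_comp => //; exact/measurable_EFinP.
- by move=> t _; rewrite -EFinD lee_fin (le_trans (Cim_le_cabs _)).
Qed.

Lemma inner_linr F G1 G2 (a : C) : fock F -> fock G1 -> fock G2 ->
  inner F (fun z => a * G1 z + G2 z) = a * inner F G1 + inner F G2.
Proof.
move=> hF hG1 hG2.
have [i1 j1] := integrable_integrand hF hG1; have [i2 j2] := integrable_integrand hF hG2.
have E z : (F z)^* * (a * G1 z + G2 z) * RtoC (gauss z) = a * integrand F G1 z + integrand F G2 z.
  by rewrite /integrand; ring.
rewrite /inner [LHS](_ : _ = RtoC (pi ^- (m * n)) * (a * Cintegral (integrand F G1) + Cintegral (integrand F G2))); last first.
  congr (_ * _); rewrite /Cintegral; apply: Ceq; rewrite ?CreD ?CimD ?CreM ?CimM /=.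
    rewrite -[X in _ = _ + X]mul1r -mulNr -(Rintegral_lin i1 j1).
    rewrite -[X in _ = X + _]mul1r -(Rintegral_lin (integrable_lin i1 j1 _ _) i2).
    by apply: eq_Rintegral => t _; rewrite E CreD CreM; ring.
  rewrite -[X in _ = _ + X]mul1r -(Rintegral_lin j1 i1).
  rewrite -[X in _ = X + _]mul1r -(Rintegral_lin (integrable_lin j1 i1 _ _) j2).
  by apply: eq_Rintegral => t _; rewrite E CimD CimM; ring.
by rewrite mulrDr; congr (_ + _); rewrite mulrCA.
Qed.

Lemma inner0r F : fock F -> inner F (fun=> 0) = 0.
Proof.
move=> hF; have := inner_linr (-1) hF fock0 fock0.
rewrite (_ : (fun z => _) = (fun=> 0)); last by apply/funext => z; rewrite mulr0 addr0.
by move=> ->; rewrite mulN1r addNr.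
Qed.

Lemma inner_conj F G : fock F -> fock G -> (inner F G)^* = inner G F.
Proof.
move=> hF hG; have [i1 j1] := integrable_integrand hF hG.
rewrite /inner; apply: Ceq; rewrite ?Cre_conj ?Cim_conj ?CreZ ?CimZ /= -?mulrN; congr (_ * _).
  by apply: eq_Rintegral => t _; rewrite !(CreM, CimM, Cre_conj, Cim_conj) /=; ring.
rewrite -mulN1r -RintegralZl //.
by apply: eq_Rintegral => t _; rewrite !(CreM, CimM, Cre_conj, Cim_conj) /=; ring.
Qed.

Lemma inner_sumr I (s : seq I) (a : I -> C) (G : I -> 'M[C]_(m, n) -> C) F :
  fock F -> (forall i, fock (G i)) ->
  inner F (fun z => \sum_(i <- s) a i * G i z) = \sum_(i <- s) a i * inner F (G i).
Proof.
move=> hF hG; elim: s => [|i s IH].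
  rewrite big_nil -[RHS](inner0r hF); congr inner; apply/funext => z.
  by rewrite big_nil.
rewrite big_cons -IH -inner_linr //.
  by congr inner; apply/funext => z; rewrite big_cons.
by apply: fock_sum => j; exact: fockZ.
Qed.

Lemma inner_sum I J (s : seq I) (s' : seq J) (a : I -> C) (b : J -> C)
    (F : I -> 'M[C]_(m, n) -> C) (G : J -> 'M[C]_(m, n) -> C) :
  (forall i, fock (F i)) -> (forall j, fock (G j)) ->
  inner (fun z => \sum_(i <- s) a i * F i z) (fun z => \sum_(j <- s') b j * G j z) =
  \sum_(i <- s) \sum_(j <- s') (a i)^* * b j * inner (F i) (G j).
Proof.
move=> hF hG.
have hS : fock (fun z => \sum_(i <- s) a i * F i z).
  by apply: fock_sum => i; exact: fockZ.
rewrite inner_sumr // exchange_big /=; apply: eq_bigr => j _.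
rewrite -inner_conj // inner_sumr // rmorph_sum mulr_sumr; apply: eq_bigr => i _.
by rewrite rmorphM /= inner_conj //; ring.
Qed.

(** The real half of polarization; it also yields Pythagoras for orthogonal components. *)
Lemma Cre_inner F G : fock F -> fock G ->
  nrm2 (fun z => F z + G z) = nrm2 F + nrm2 G + 2 * Cre (inner F G).
Proof.
move=> hF hG.
have E : inner (fun z => F z + G z) (fun z => F z + G z) =
   inner F F + inner G G + (inner F G + (inner F G)^*).
  have FG := fockD hF hG.
  have lr H : fock H -> inner H (fun z => F z + G z) = inner H F + inner H G.
    move=> hH; rewrite -[inner H F]mul1r -inner_linr //.
    by congr inner; apply/funext => z; rewrite mul1r.
  rewrite lr // -[inner _ F]inner_conj // -[inner _ G]inner_conj // !lr // !rmorphD /=.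
  rewrite !inner_conj //; ring.
have := congr1 (@Cre R) E; rewrite !inner_self !CreD Cre_conj /=; lra.
Qed.

Lemma inner_iE F G : fock F -> fock G -> inner F (fun z => 'i * G z) = 'i * inner F G.
Proof.
move=> hF hG; have := inner_linr 'i hF hG fock0; rewrite inner0r // addr0 => <-.
by congr inner; apply/funext => z; rewrite addr0.
Qed.

Lemma l2_invariant F g : fock F -> mx_invariant g -> (forall z, nsq (g z) = nsq z) ->
  nrm2 (F \o g) = nrm2 F.
Proof.
move=> hF gi gn; rewrite /nrm2 /l2 l2w_invariant //; first exact: weight_gauss.
- exact: fock_cmeas.
- by move=> z; rewrite !gaussE gn.
Qed.

Lemma inner_invariant F G g : fock F -> fock G -> mx_invariant g -> (forall z, nsq (g z) = nsq z) ->
  inner (F \o g) (G \o g) = inner F G.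
Proof.
move=> hF hG gi gn; have [i1 j1] := integrable_integrand hF hG.
rewrite /inner; congr (_ * _); rewrite /Cintegral; congr Complex; congr fine.
  rewrite -[RHS](mx_invariant_integral gi (f := fun z => (Cre (integrand F G z))%:E)).
    by apply: eq_integral => t _; rewrite /integrand /= !gaussE gn.
  by case/integrableP: i1.
rewrite -[RHS](mx_invariant_integral gi (f := fun z => (Cim (integrand F G z))%:E)).
  by apply: eq_integral => t _; rewrite /integrand /= !gaussE gn.
by case/integrableP: j1.
Qed.

End fock_norm.

(** Polarization: the norm of F + G determines the real part of the inner product, and replacing G
    by iG gives the imaginary part. *)
Lemma isometry_inner (R : realType) m n p q (H : set ('M[Cplx R]_(m, n) -> Cplx R))
    (T : ('M[Cplx R]_(m, n) -> Cplx R) -> ('M[Cplx R]_(p, q) -> Cplx R)) :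
  (forall F, H F -> fock F /\ fock (T F)) ->
  (forall (a : Cplx R) F G, H F -> H G -> H (fun z => a * F z + G z)) ->
  (forall (a : Cplx R) F G, H F -> H G ->
     T (fun z => a * F z + G z) = (fun x => a * T F x + T G x)) ->
  (forall F, H F -> fnorm (T F) = fnorm F) ->
  forall F G, H F -> H G -> inner (T F) (T G) = inner F G.
Proof.
move=> Hf Hl Tl Ti.
have n2 F : H F -> nrm2 (T F) = nrm2 F by move=> h; rewrite -!fnorm_sqr Ti.
have re F G : H F -> H G -> Cre (inner (T F) (T G)) = Cre (inner F G).
  move=> hF hG; have [fF tF] := Hf _ hF; have [fG tG] := Hf _ hG.
  have := Cre_inner fF fG; have := Cre_inner tF tG.
  have := n2 _ (Hl 1 _ _ hF hG); rewrite Tl //.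
  under eq_fun do rewrite mul1r; move=> e.
  have -> : (fun z => F z + G z) = (fun z => 1 * F z + G z).
    by apply/funext => z; rewrite mul1r.
  rewrite -e (n2 _ hF) (n2 _ hG); lra.
move=> F G hF hG; have [fF tF] := Hf _ hF; have [fG tG] := Hf _ hG.
have H0 : H (fun=> 0).
  have := Hl (-1) _ _ hF hF; congr H; apply/funext => z; ring.
have T0 : T (fun=> 0) = fun=> 0.
  have := Tl (-1) _ _ H0 H0; rewrite (_ : (fun z => -1 * 0 + 0) = fun=> 0); last first.
    by apply/funext => z; ring.
  move=> e; apply/funext => x; have := congr1 (fun f => f x) e; rewrite /= => ->; ring.
apply: Ceq; first exact: re.
have hiG : H (fun z => 'i * G z).
  by have := Hl 'i _ _ hG H0; under eq_fun do rewrite addr0.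
have TiG : T (fun z => 'i * G z) = fun x => 'i * T G x.
  have := Tl 'i _ _ hG H0; under eq_fun do rewrite addr0; move=> ->.
  by apply/funext => x; rewrite T0 addr0.
have := re _ _ hF hiG; rewrite TiG !inner_iE // !CreM /= !mul0r !mul1r !sub0r.
exact: oppr_inj.
Qed.

(** * Taylor coefficients as limits of averages over roots of unity *)

Section dft.
Variable R : realType.
Local Notation C := (Cplx R).
Implicit Types (f : C -> C).

(** Repeated square roots of -1 give a number whose 2^k-th power is -1. Its order divides 2^(k+1),
    and a smaller one would divide 2^k. *)
Lemma prim_root_pow2 k : exists w : C, (2 ^ k).-primitive_root w.
Proof.
case: k => [|k].
  have [d pd] := @prim_order_exists C 1%N 1 isT (expr1n _ _).
  by rewrite dvdn1 => /eqP d1; exists 1; rewrite expn0 -d1.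
have [w hw] : exists w : C, w ^+ (2 ^ k) = -1.
  elim: k => [|k [w hw]]; first by exists (-1); rewrite expr1.
  by exists (sqrtC w); rewrite expnS exprM sqrtCK.
exists w.
have w1 : w ^+ (2 ^ k.+1) = 1 by rewrite expnSr exprM hw sqrrN expr1n.
have [d pd] := prim_order_exists (expn_gt0 2 k.+1) w1.
move=> /(dvdn_pfactor _ _ (isT : prime 2))[j jk dE].
move: jk; rewrite leq_eqVlt => /predU1P[jk|jk]; first by rewrite -jk -dE.
exfalso; have : w ^+ (2 ^ k) = 1.
  rewrite -(subnKC (_ : j <= k)%N) // expnD exprM -dE (prim_expr_order pd).
  by rewrite expr1n.
move=> /eqP; rewrite hw eq_sym -subr_eq0 opprK (_ : 1 + 1 = 2%:R) // pnatr_eq0.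
by [].
Qed.

Definition root2 k : C := xchoose (prim_root_pow2 k).
Lemma root2P k : (2 ^ k).-primitive_root (root2 k).
Proof. exact: xchooseP (prim_root_pow2 k). Qed.

Section fixed_root.
Variables (M : nat) (w : C).
Hypothesis wP : M.-primitive_root w.

Let M0 : (0 < M)%N. Proof. exact: prim_order_gt0 wP. Qed.
Let MC0 : M%:R != 0 :> C. Proof. by rewrite pnatr_eq0 -lt0n. Qed.

Lemma cabs_root : cabs w = 1.
Proof.
have : cabs w ^+ M = 1 by rewrite -cabsX (prim_expr_order wP) cabs1.
by move/eqP; rewrite pexprn_eq1 ?cabs_ge0 // (gtn_eqF M0) /= => /eqP.
Qed.

Lemma root_neq0 : w != 0. Proof. by rewrite -cabs_gt0 cabs_root. Qed.

Lemma root_conj : w^* = w^-1.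
Proof.
apply: (mulfI root_neq0); rewrite divff ?root_neq0 // mulrC conjC_mul cabs_root.
by rewrite expr1n.
Qed.

Lemma root_sum c : \sum_(i < M) (w ^+ c) ^+ i = (M * (M %| c))%:R.
Proof.
have [Mc|Mc] := boolP (M %| c)%N.
  rewrite muln1 (eq_bigr (fun=> 1)) ?sumr_const ?card_ord // => i _.
  by rewrite (eqP (_ : w ^+ c == 1)) ?expr1n // -(prim_order_dvd wP).
have c1 : w ^+ c - 1 != 0 by rewrite subr_eq0 -(prim_order_dvd wP).
rewrite muln0; apply: (mulfI c1); rewrite mulr0 -subrX1 -exprM mulnC exprM.
by rewrite (prim_expr_order wP) expr1n subrr.
Qed.

Lemma root_inv_exp i : (i <= M)%N -> w^-1 ^+ i = w ^+ (M - i).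
Proof.
move=> iM; apply: (mulfI (expf_neq0 i root_neq0)).
by rewrite -exprMn divff ?root_neq0 // expr1n -exprD subnKC // (prim_expr_order wP).
Qed.

(** The discrete Fourier coefficient: the coefficient of degree j < M in the polynomial of degree
    below M that interpolates [f] at the roots of unity. *)
Definition dft j f : C := M%:R^-1 * \sum_(i < M) (w^-1 ^+ j) ^+ i * f (w ^+ i).

Lemma cabs_root_exp i : cabs (w ^+ i) = 1.
Proof. by rewrite cabsX cabs_root expr1n. Qed.

(** Only exponents congruent to j modulo M survive the sum, and j is the only one below j + M. *)
Lemma dft_poly (b : nat -> C) j L : (j < M)%N -> (j < L)%N -> (L <= j + M)%N ->
  dft j (fun t => \sum_(l < L) b l * t ^+ l) = b j.
Proof.
move=> jM jL LjM; rewrite /dft.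
under eq_bigr do rewrite mulr_sumr.
rewrite exchange_big /= (bigD1 (Ordinal jL)) //= [X in _ * (_ + X)]big1 ?addr0.
  rewrite (eq_bigr (fun=> b j)) ?sumr_const ?card_ord.
    by rewrite -[b j *+ M]mulr_natl mulKf.
  move=> i _; have e : (w^-1 ^+ j) ^+ i * (w ^+ i) ^+ j = 1.
    by rewrite -!exprM mulnC -exprMn mulVf ?root_neq0 // expr1n.
  by rewrite mulrCA e mulr1.
move=> l lj; rewrite (eq_bigr (fun i : 'I_M => b l * (w ^+ (M - j + l)) ^+ i)); last first.
  move=> i _; rewrite root_inv_exp 1?ltnW // exprD exprMn -![(w ^+ _) ^+ _]exprM [(l * i)%N]mulnC.
  by ring.
rewrite -mulr_sumr root_sum.
suff /negbTE -> : ~~ (M %| M - j + l)%N by rewrite muln0 mulr0.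
apply/negP => /dvdnP[q qE].
have lL := ltn_ord l; have lj' : (l : nat) <> j by move/eqP: lj => lj e; apply: lj; exact: val_inj.
case: q qE => [|[|q]]; rewrite ?mul0n ?mul1n ?mulSn; lia.
Qed.

Lemma dft_bound j f B : (forall t, cabs t = 1 -> cabs (f t) <= B) -> cabs (dft j f) <= B.
Proof.
move=> fB; rewrite /dft cabsM cabsV -RtoC_nat cabs_RtoC ger0_norm // mulrC.
rewrite ler_pdivrMr ?ltr0n // (le_trans (cabs_sum _ _ _)) //.
rewrite (le_trans (ler_sum _ (G := fun=> B) _)) ?sumr_const ?card_ord ?mulr_natr //.
move=> i _; rewrite cabsM !cabsX cabsV cabs_root invr1 !expr1n mul1r fB //.
exact: cabs_root_exp.
Qed.

Lemma dftB j f g : dft j (fun t => f t - g t) = dft j f - dft j g.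
Proof.
rewrite /dft (eq_bigr (fun i : 'I_M => (w^-1 ^+ j) ^+ i * f (w ^+ i) - (w^-1 ^+ j) ^+ i * g (w ^+ i))).
  by rewrite sumrB mulrBr.
by move=> i _; rewrite mulrBr.
Qed.

(** The first [j + M] Taylor terms form the longest partial sum whose average is exactly [b j];
    averaging does not enlarge the remainder. *)
Lemma dft_approx f (b : nat -> C) (B : R) j : (j < M)%N ->
  (forall t N, cabs t = 1 -> cabs (f t - \sum_(l < N) b l * t ^+ l) <= B * 2^-1 ^+ N) ->
  cabs (dft j f - b j) <= B * 2^-1 ^+ (j + M).
Proof.
move=> jM h; rewrite -[X in _ - X](@dft_poly b j (j + M)) // -?dftB ?leqnn //; last first.
  by rewrite -{1}[j]addn0 ltn_add2l.
by apply: dft_bound => t t1; exact: h.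
Qed.

(** After expanding the squares and summing over j first, [root_sum] leaves only the terms with
    equal indices. *)
Lemma dft_parseval f : \sum_(j < M) cabs (dft j f) ^+ 2 = M%:R^-1 * \sum_(i < M) cabs (f (w ^+ i)) ^+ 2.
Proof.
suff H : \sum_(j < M) (dft j f)^* * dft j f = M%:R^-1 * \sum_(i < M) (f (w ^+ i))^* * f (w ^+ i).
  have := congr1 (@Cre R) H; rewrite -RtoC_nat.
  have -> : (RtoC M%:R)^-1 = RtoC (M%:R^-1) :> C.
    apply: (mulfI (_ : RtoC M%:R != 0)); first by rewrite RtoC_nat.
    by rewrite divff ?RtoC_nat // -RtoC_nat -RtoCM divff // pnatr_eq0 -lt0n.
  rewrite CreZ !Cre_sum.
  by under eq_bigr do rewrite conjC_mul; under [X in _ * X]eq_bigr do rewrite conjC_mul.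
pose u i := f (w ^+ i).
have E j : (dft j f)^* * dft j f = M%:R^-1 * M%:R^-1 *
   \sum_(i < M) \sum_(i' < M) (u i)^* * u i' * (w ^+ (i + (M - i'))) ^+ j.
  rewrite /dft rmorphM rmorph_sum /= fmorphV rmorph_nat mulrACA; congr (_ * _).
  rewrite mulr_suml; apply: eq_bigr => i _; rewrite mulr_sumr; apply: eq_bigr => i' _.
  rewrite rmorphM /= !rmorphXn /= fmorphV /= root_conj invrK exprD exprMn -root_inv_exp 1?ltnW //.
  rewrite -!exprM mulnC [(j * i')%N]mulnC /u; ring.
under eq_bigr do rewrite E.
rewrite -mulr_sumr exchange_big /= -mulrA; congr (_ * _).
apply: (mulfI MC0); rewrite mulrA divff // mul1r mulr_sumr; apply: eq_bigr => i _.
rewrite exchange_big /= (bigD1 i) //= [X in _ + X]big1 ?addr0.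
  rewrite -mulr_sumr root_sum subnKC 1?ltnW // dvdnn muln1 /u; ring.
move=> i' i'i; rewrite -mulr_sumr root_sum.
suff /negbTE -> : ~~ (M %| i + (M - i'))%N by rewrite muln0 mulr0.
apply/negP => /dvdnP[q qE].
have iM := ltn_ord i; have i'M := ltn_ord i'.
have ii' : (i' : nat) <> i by move/eqP: i'i => ii e; apply: ii; exact: val_inj.
case: q qE => [|[|q]]; rewrite ?mul0n ?mul1n ?mulSn; lia.
Qed.

End fixed_root.

Lemma dft_pow2_approx f (b : nat -> C) (B : R) j N : (j <= N)%N ->
  (forall t K, cabs t = 1 -> cabs (f t - \sum_(l < K) b l * t ^+ l) <= B * 2^-1 ^+ K) ->
  cabs (dft (2 ^ N) (root2 N) j f - b j) <= B * 2^-1 ^+ N.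
Proof.
move=> jN h.
have B0 : 0 <= B.
  by have := h 1 0%N (cabs1 R); rewrite expr0 mulr1; apply: le_trans; exact: cabs_ge0.
have NN : (N < 2 ^ N)%N by exact: ltn_expl.
rewrite (le_trans (dft_approx (root2P N) (leq_ltn_trans jN NN) h)) // ler_wpM2l //.
have h2 : 0 <= (2^-1 : R) <= 1 by rewrite invr_ge0 ler0n invf_le1 ?ler1n.
case/andP: h2 => h2 h2'; apply: ler_wiXn2l => //.
by rewrite (leq_trans (ltnW NN)) // leq_addl.
Qed.

Lemma half_exp_small (B : R) e : 0 <= B -> 0 < e ->
  exists N, forall k, (N <= k)%N -> B * 2^-1 ^+ k <= e.
Proof.
move=> B0 e0; have B1 : 0 < B + 1 by rewrite ltr_wpDl.
have h2 : 0 <= (2^-1 : R) < 1 by rewrite invr_ge0 ler0n invf_lt1 ?ltr1n.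
have [N hN] := cabs_exp_small h2 (divr_gt0 e0 B1).
exists N => k Nk; have h : 2^-1 ^+ k <= e / (B + 1).
  by case/andP: h2 => h2 h2'; rewrite (le_trans _ (ltW hN)) // ler_wiXn2l // ltW.
rewrite (le_trans (ler_wpM2l B0 h)) // mulrC -[X in X <= _](mul1r) mulrC.
have := ler_div_succ (ltW e0) ler01 B0; rewrite mulr1 mul1r; lra.
Qed.

(** As a limit of averages the coefficient depends on [f] alone and, with parameters, inherits
    measurability from the averages. The default 0 is reached only if they diverge, which never
    happens for entire [f]. *)
Definition taylor_coef f k : C :=
  xget 0 [set l | ctends (fun N => dft (2 ^ N) (root2 N) k f) l].

Lemma taylor_coef_uniq f (b : nat -> C) (B : R) :
  (forall t K, cabs t = 1 -> cabs (f t - \sum_(l < K) b l * t ^+ l) <= B * 2^-1 ^+ K) ->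
  forall k, taylor_coef f k = b k.
Proof.
move=> h k.
have B0 : 0 <= B.
  by have := h 1 0%N (cabs1 R); rewrite expr0 mulr1; apply: le_trans; exact: cabs_ge0.
have lim : ctends (fun N => dft (2 ^ N) (root2 N) k f) (b k).
  move=> e e0; have [N hN] := half_exp_small B0 e0.
  exists (maxn N k) => j; rewrite geq_max => /andP[Nj kj].
  by rewrite (le_trans (dft_pow2_approx kj h)) // hN.
rewrite /taylor_coef; case: xgetP => [l _ /= hl|/(_ (b k)) //].
exact: ctends_uniq hl lim.
Qed.

Lemma taylor_expansion f (B : R) : entire f -> (forall t, cabs t = 2 -> cabs (f t) <= B) ->
  forall t K, cabs t <= 1 ->
    cabs (f t - \sum_(k < K) taylor_coef f k * t ^+ k) <= 4 * B * (cabs t / 2) ^+ K.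
Proof.
move=> fE fB; have [a [_ ha]] := taylor_disc fE (ltr0Sn R 1) fB.
have ha' t K : cabs t <= 1 -> cabs (f t - \sum_(k < K) a k * t ^+ k) <= 4 * B * (cabs t / 2) ^+ K.
  by move=> t1; apply: ha; rewrite divff // pnatr_eq0.
have aE k : taylor_coef f k = a k.
  apply: (@taylor_coef_uniq _ _ (4 * B)) => t K t1.
  by have := ha' t K; rewrite t1 mul1r; apply; exact: lexx.
by move=> t K t1; under eq_bigr do rewrite aE; exact: ha'.
Qed.

Lemma taylor_expansion1 f (B : R) : entire f -> (forall t, cabs t = 2 -> cabs (f t) <= B) ->
  forall t K, cabs t = 1 ->
    cabs (f t - \sum_(k < K) taylor_coef f k * t ^+ k) <= 4 * B * 2^-1 ^+ K.
Proof.
move=> fE fB t K t1; have := taylor_expansion fE fB K (_ : cabs t <= 1).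
by rewrite t1 mul1r; apply; exact: lexx.
Qed.

Lemma taylor_coef_dft f (B : R) j N : entire f -> (forall t, cabs t = 2 -> cabs (f t) <= B) ->
  (j <= N)%N -> cabs (dft (2 ^ N) (root2 N) j f - taylor_coef f j) <= 4 * B * 2^-1 ^+ N.
Proof. by move=> fE fB jN; apply: dft_pow2_approx => //; exact: taylor_expansion1. Qed.

Lemma taylor_coef_ctends f k : entire f -> ctends (fun N => dft (2 ^ N) (root2 N) k f) (taylor_coef f k).
Proof.
move=> fE; have [B fB] := entire_bounded_circle_r fE (ltr0Sn R 1).
have B0 : 0 <= 4 * B.
  rewrite mulr_ge0 // (le_trans (cabs_ge0 (f 2))) // fB //.
  by rewrite -(RtoC_nat R 2) cabs_RtoC ger0_norm.
move=> e e0; have [N hN] := half_exp_small B0 e0.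
exists (maxn N k) => j; rewrite geq_max => /andP[Nj kj].
by rewrite (le_trans (taylor_coef_dft fE fB kj)) // hN.
Qed.

Lemma taylor_coef0 f : entire f -> taylor_coef f 0 = f 0.
Proof.
move=> fE; have [B fB] := entire_bounded_circle_r fE (ltr0Sn R 1).
have := taylor_expansion fE fB 1 (_ : cabs 0 <= 1); rewrite cabs0 ler01 => /(_ isT).
rewrite big_ord1 expr0 mulr1 mul0r expr1 mulr0 => h.
apply/esym/eqP; rewrite -subr_eq0; apply/eqP; apply: cabs_lt_eq0 => e e0.
by rewrite (le_trans h) // ltW.
Qed.

Lemma taylor_coefZ f (c : C) k : entire f -> taylor_coef (fun t => c * f t) k = c * taylor_coef f k.
Proof.
move=> fE; have [B fB] := entire_bounded_circle_r fE (ltr0Sn R 1).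
apply: (@taylor_coef_uniq _ (fun k => c * taylor_coef f k) (cabs c * (4 * B))) => t K t1.
rewrite (_ : _ - _ = c * (f t - \sum_(k < K) taylor_coef f k * t ^+ k)); last first.
  by rewrite mulrBr mulr_sumr; congr (_ - _); apply: eq_bigr => i _; ring.
by rewrite cabsM -mulrA ler_wpM2l ?cabs_ge0 //; exact: taylor_expansion1.
Qed.

(** [cabs c <= 1] keeps [c * t] in the closed unit disc, where the expansion bound holds. *)
Lemma taylor_coef_scale f (c : C) k : entire f -> cabs c <= 1 ->
  taylor_coef (fun t => f (c * t)) k = c ^+ k * taylor_coef f k.
Proof.
move=> fE c1; have [B fB] := entire_bounded_circle_r fE (ltr0Sn R 1).
have B0 : 0 <= 4 * B.
  rewrite mulr_ge0 // (le_trans (cabs_ge0 (f 2))) // fB //.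
  by rewrite -(RtoC_nat R 2) cabs_RtoC ger0_norm.
apply: (@taylor_coef_uniq _ (fun k => c ^+ k * taylor_coef f k) (4 * B)) => t K t1.
have ct : cabs (c * t) <= 1 by rewrite cabsM t1 mulr1.
rewrite (eq_bigr (fun l : 'I_K => taylor_coef f l * (c * t) ^+ l)); last first.
  by move=> i _; rewrite exprMn; ring.
rewrite (le_trans (taylor_expansion fE fB K ct)) // ler_wpM2l // lerXn2r ?nnegrE //.
  by rewrite divr_ge0 ?cabs_ge0.
by rewrite ler_pdivrMr // mulVf // pnatr_eq0.
Qed.

End dft.

(** * Point evaluations and completeness *)

Section matrix_norm.
Variable R : realType.
Local Notation C := (Cplx R).

Lemma cabs_entry_le m n (z : 'M[C]_(m, n)) i j : cabs (z i j) <= vnorm z.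
Proof.
suff : `|z i j| <= `|z| by rewrite normC_cabs vnormE lecR.
by rewrite -[leLHS]nngE [leRHS]mx_normE num_le; exact: (le_bigmax _ _ (i, j)).
Qed.

Lemma vnorm_le m n (z : 'M[C]_(m, n)) (B : R) : 0 <= B ->
  (forall i j, cabs (z i j) <= B) -> vnorm z <= B.
Proof.
move=> B0 hB; have [/eqP z0|/mx_norm_neq0[[i j] /= e]] := boolP (mx_norm z == 0).
  by rewrite /vnorm /Num.norm /= z0.
by rewrite /vnorm /Num.norm /= e; exact: hB.
Qed.

Lemma diff_bounded (V : normedModType C) (F : V -> C) z : differentiable F z ->
  exists D : R, forall h, cabs ('d F z h) <= D * vnorm h.
Proof.
move=> dF; have /(continuous_linear_bounded 0) : {for 0, continuous ('d F z)}.
  exact: (diff_continuous dF).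
move=> /linear_boundedP[M [Mr hM]].
have ME : M = RtoC (Cre M) by apply/esym/RRe_real.
exists (Cre M + 1) => h.
have := hM (RtoC (Cre M + 1)); rewrite ME ltcR ltrDl ltr01 => /(_ isT h).
by rewrite normC_cabs vnormE -RtoCM lecR.
Qed.

(** The chain rule for an affine map [g] with linear part [g0]; the bound by [K] stands for the
    continuity of [g0]. *)
Lemma holomorphic_comp_affine m n m' n' (F : 'M[C]_(m, n) -> C)
    (g g0 : 'M[C]_(m', n') -> 'M[C]_(m, n)) (K : R) :
  holomorphic F -> (forall z h, g (h + z) = g0 h + g z) ->
  (forall (a : C) h1 h2, g0 (a *: h1 + h2) = a *: g0 h1 + g0 h2) ->
  (forall h, vnorm (g0 h) <= K * vnorm h) -> holomorphic (F \o g).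
Proof.
move=> hF gg0 glin gK z.
have K1 : 0 < `|K| + 1 by rewrite ltr_wpDl.
have gK' h : vnorm (g0 h) <= (`|K| + 1) * vnorm h.
  rewrite (le_trans (gK h)) // ler_wpM2r ?vnorm_ge0 // (le_trans (ler_norm _)) //.
  by rewrite lerDl.
have [D hD] := diff_bounded (hF (g z)).
apply: (@estimate_differentiable _ _ _ _ (fun h => 'd F (g z) (g0 h)) (`|D| * (`|K| + 1))).
- by move=> a h1 h2; rewrite glin; exact: linearP.
- move=> h; rewrite (le_trans (hD _)) // (le_trans (ler_wpM2r (vnorm_ge0 _) (ler_norm D))) //.
  by rewrite -mulrA ler_wpM2l.
- move=> e e0; have [r r0 hr] := differentiable_estimate (hF (g z)) (divr_gt0 e0 K1).
  exists (r / (`|K| + 1)); first by rewrite divr_gt0.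
  move=> h; rewrite ltr_pdivlMr // => hh.
  have gr : vnorm (g0 h) < r by rewrite (le_lt_trans (gK' h)) // mulrC.
  have := hr _ gr; rewrite /= gg0 => E; rewrite (le_trans E) //.
  rewrite (le_trans (ler_wpM2l (ltW (divr_gt0 e0 K1)) (gK' h))) //.
  by rewrite mulrA divfK ?gt_eqF.
Qed.

End matrix_norm.

(** * Rotation averages in one matrix entry and Bessel's inequality *)

Section rotation_averages.
Variable R : realType.
Local Notation C := (Cplx R).
Variables m n : nat.
Local Notation mxo := (@mx_of R m n).
Local Notation mu := (leb R m n).
Implicit Types (F G : 'M[C]_(m, n) -> C) (z : 'M[C]_(m, n)) (p q : 'I_m * 'I_n).

Lemma sc1 p z : sc p 1 z = z.
Proof. by apply/matrixP => i j; rewrite mxE mul1r; case: ifP. Qed.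

Lemma scM p (u v : C) z : sc p u (sc p v z) = sc p (u * v) z.
Proof. by apply/matrixP => i j; rewrite !mxE; case: ifP => e; rewrite ?e // mulrA. Qed.

Lemma sc_comm p q (u v : C) z : p != q -> sc p u (sc q v z) = sc q v (sc p u z).
Proof.
move=> pq; apply/matrixP => i j; rewrite !mxE; case: eqP => [->|//].
by rewrite (negbTE pq).
Qed.

Definition ent p z : 'M[C]_(m, n) := \matrix_(i, j) if (i, j) == p then z i j else 0.

Lemma sc_line p t z : sc p t z = sc p 0 z + t *: ent p z.
Proof.
by apply/matrixP => i j; rewrite !mxE; case: ifP => _; rewrite ?mul0r ?add0r // mulr0 addr0.
Qed.

Lemma nsq_sc p (u : C) z : cabs u = 1 -> nsq (sc p u z) = nsq z.
Proof.
move=> u1; apply: eq_bigr => i _; apply: eq_bigr => j _; rewrite mxE.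
by case: ifP => // _; rewrite cabsM u1 mul1r.
Qed.

Lemma nsq_sc_le p (u : C) z : cabs u <= 2 -> nsq (sc p u z) <= 4 * nsq z.
Proof.
move=> u2; rewrite mulr_sumr; apply: ler_sum => i _; rewrite mulr_sumr; apply: ler_sum => j _.
have h := sqr_ge0 (cabs (z i j)).
rewrite mxE; case: ifP => _; last by lra.
rewrite cabsM exprMn ler_wpM2r // (_ : 4 = 2 ^+ 2); last by ring.
by rewrite lerXn2r ?nnegrE ?cabs_ge0.
Qed.

Lemma entire_sc F p z : holomorphic F -> entire (fun t => F (sc p t z)).
Proof.
move=> hF; have := differentiable_entire_line (sc p 0 z) (ent p z) hF.
have -> // : (fun t => F (sc p 0 z + t *: ent p z)) = (fun t => F (sc p t z)).
by apply/funext => t; rewrite [in RHS]sc_line.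
Qed.

Lemma holomorphic_sc F p (u : C) : holomorphic F -> holomorphic (F \o sc p u).
Proof.
move=> hF; apply: (@holomorphic_comp_affine _ _ _ _ _ _ (sc p u) (sc p u) (1 + cabs u)) => //.
- move=> z h; apply/matrixP => i j; rewrite !mxE; case: ifP => // _; exact: mulrDr.
- move=> a h1 h2; apply/matrixP => i j; rewrite !mxE; case: ifP => // _; ring.
- move=> h; apply: vnorm_le => [|i j].
    by rewrite mulr_ge0 ?vnorm_ge0 // addr_ge0 ?cabs_ge0.
  rewrite mxE mulrDl mul1r; have h1 := cabs_entry_le h i j; have u0 := cabs_ge0 u.
  have v0 := vnorm_ge0 h.
  case: ifP => _; last by rewrite (le_trans h1) // lerDl mulr_ge0.
  by rewrite cabsM (le_trans (ler_wpM2l u0 h1)) // lerDr.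
Qed.

Lemma holomorphicZ F (a : C) : holomorphic F -> holomorphic (fun z => a * F z).
Proof.
move=> h z; have -> : (fun z => a * F z) = a *: F by [].
by apply: differentiableZ; exact: h.
Qed.

Lemma holomorphicD F G : holomorphic F -> holomorphic G -> holomorphic (fun z => F z + G z).
Proof.
move=> h h' z; have -> : (fun z => F z + G z) = F + G by [].
by apply: differentiableD; [exact: h|exact: h'].
Qed.

Lemma holomorphic_sum I (s : seq I) (H : I -> 'M[C]_(m, n) -> C) :
  (forall i, holomorphic (H i)) -> holomorphic (fun z => \sum_(i <- s) H i z).
Proof.
move=> h; elim: s => [|i s IH].
  under eq_fun do rewrite big_nil; move=> z; exact: differentiable_cst.
by under eq_fun do rewrite big_cons; exact: holomorphicD.
Qed.

Definition avg p N j F z : C := dft (2 ^ N) (root2 R N) j (fun t => F (sc p t z)).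

Definition hcomp p k F z : C := taylor_coef (fun t => F (sc p t z)) k.

Lemma holomorphic_avg p N j F : holomorphic F -> holomorphic (avg p N j F).
Proof.
move=> hF; apply: holomorphicZ; apply: holomorphic_sum => i; apply: holomorphicZ.
exact: holomorphic_sc.
Qed.

Lemma avg_ctends p k F z : holomorphic F -> ctends (fun N => avg p N k F z) (hcomp p k F z).
Proof. by move=> hF; apply: taylor_coef_ctends; exact: entire_sc. Qed.

Lemma cmeas_limit (Fn : nat -> 'M[C]_(m, n) -> C) F : (forall N, cmeas (Fn N)) ->
  (forall z, ctends (fun N => Fn N z) (F z)) -> cmeas F.
Proof.
move=> mF lim; split.
  apply: (@measurable_fun_cvg _ _ _ _ (fun N t => Cre (Fn N (mxo t)))) => [N|t _].
    exact: (mF N).1.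
  apply/cvgrPdist_le => e e0; have [N hN] := lim (mxo t) e e0.
  by exists N => // k /= /hN; rewrite distrC -CreB; apply: le_trans; exact: Cre_le_cabs.
apply: (@measurable_fun_cvg _ _ _ _ (fun N t => Cim (Fn N (mxo t)))) => [N|t _].
  exact: (mF N).2.
apply/cvgrPdist_le => e e0; have [N hN] := lim (mxo t) e e0.
by exists N => // k /= /hN; rewrite distrC -CimB; apply: le_trans; exact: Cim_le_cabs.
Qed.

Lemma cmeas_avg p N k F : holomorphic F -> cmeas (avg p N k F).
Proof. by move=> hF; apply: holomorphic_cmeas; exact: holomorphic_avg. Qed.

Lemma cmeas_hcomp p k F : holomorphic F -> cmeas (hcomp p k F).
Proof.
move=> hF; apply: (@cmeas_limit (fun N => avg p N k F)) => [N|z].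
  exact: cmeas_avg.
exact: avg_ctends.
Qed.

Lemma cvg_sumR I (s : seq I) (u : I -> nat -> R) (l : I -> R) :
  (forall i, u i @ \oo --> l i) ->
  (fun k => \sum_(i <- s) u i k) @ \oo --> \sum_(i <- s) l i.
Proof.
move=> h; elim: s => [|i s IH].
  by under eq_fun do rewrite big_nil; rewrite big_nil; exact: cvg_cst.
by under eq_fun do rewrite big_cons; rewrite big_cons; apply: cvgD.
Qed.

(** For fixed N, Parseval bounds the squared averages pointwise by the mean square of rotated copies
    of [F], all of the same weighted norm; Fatou's lemma passes to the components. Taking N >= K
    ensures K <= 2^N, so all K indices are frequencies of the average. *)
Lemma bessel rho p K F : weight rho -> (forall u z, cabs u = 1 -> rho (sc p u z) = rho z) ->
  holomorphic F ->
  (\sum_(k < K) l2w rho (hcomp p k F) <= l2w rho F)%E.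
Proof.
move=> wr rinv hF; have [mr r0] := wr.
have mF := holomorphic_cmeas hF.
rewrite -ge0_integral_sum //; last 2 first.
- by move=> k; apply: l2w_measurable => //; exact: cmeas_hcomp.
- by move=> k t _; rewrite lee_fin mulr_ge0 ?sqr_ge0.
have mavg N k := l2w_measurable wr (cmeas_avg p N k hF).
rewrite (eq_integral (fun t => (\sum_(k < K) cabs (hcomp p k F (mxo t)) ^+ 2 * rho (mxo t))%:E)); last first.
  by move=> t _; rewrite sumEFin.
apply: (@fatou_le _ _ _ mu (fun N t => \sum_(k < K) cabs (avg p N k F (mxo t)) ^+ 2 * rho (mxo t)) _ _ K).
- by move=> N; apply: measurable_sum => k; apply/measurable_EFinP; exact: mavg.
- by move=> N t; apply: sumr_ge0 => k _; rewrite mulr_ge0 ?sqr_ge0.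
- move=> t; apply: cvg_sumR => k; apply: cvgM; last exact: cvg_cst.
  have c := ctends_cabs (avg_ctends p k (mxo t) hF).
  by apply: cvgM.
move=> N KN.
pose M := (2 ^ N)%N; pose w := root2 R N.
have wP : M.-primitive_root w by exact: root2P.
have M0 : (0 < M)%N by exact: prim_order_gt0 wP.
have KM : (K <= M)%N by rewrite (leq_trans KN) // ltnW // ltn_expl.
have inv i : l2w rho (F \o sc p (w ^+ i)) = l2w rho F.
  apply: l2w_invariant => //.
    by apply: mx_invariant_sc; exact: (cabs_root_exp wP).
  by move=> z; rewrite rinv // (cabs_root_exp wP).
have mi i := l2w_measurable wr (holomorphic_cmeas (holomorphic_sc p (w ^+ i) hF)).
apply: (@le_trans _ _ (\int[mu]_t (\sum_(i < M) ((M%:R^-1)%:E *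
   (cabs ((F \o sc p (w ^+ i)) (mxo t)) ^+ 2 * rho (mxo t))%:E)))%E).
  apply: ge0_le_integral => //.
  - by move=> t _; rewrite lee_fin; apply: sumr_ge0 => k _; rewrite mulr_ge0 ?sqr_ge0.
  - by apply/measurable_EFinP; apply: measurable_sum => k; apply/measurable_EFinP; exact: mavg.
  - by apply: emeasurable_sum => i; exact: measurable_funeM.
  move=> t _; under [X in (_ <= X)%E]eq_bigr do rewrite -EFinM; rewrite sumEFin lee_fin.
  rewrite -mulr_suml; under [leRHS]eq_bigr do rewrite mulrA; rewrite -mulr_suml -mulr_sumr.
  rewrite ler_wpM2r // -(dft_parseval wP (fun u => F (sc p u (mxo t)))).
  rewrite (big_ord_widen M (fun k => cabs (avg p N k F (mxo t)) ^+ 2) KM) big_mkcond /=.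
  by apply: ler_sum => k _; case: ifP => // _; rewrite sqr_ge0.
rewrite ge0_integral_sum //; last 2 first.
- by move=> i; exact: measurable_funeM.
- by move=> i t _; rewrite mule_ge0 // ?lee_fin ?invr_ge0 // mulr_ge0 ?sqr_ge0.
rewrite (eq_bigr (fun=> (M%:R^-1)%:E * l2w rho F))%E; last first.
  move=> i _; rewrite ge0_integralZl ?lee_fin ?invr_ge0 //.
    by congr (_ * _)%E; exact: inv.
  by move=> t _; rewrite lee_fin mulr_ge0 ?sqr_ge0.
have := l2w_ge0 F wr; case: (l2w rho F) => [r r_ge0| |//]; last by move=> _; rewrite leey.
under eq_bigr do rewrite -EFinM; rewrite sumEFin lee_fin sumr_const card_ord -[leLHS]mulr_natl [leLHS]mulrA.
by rewrite divff ?mul1r // pnatr_eq0 -lt0n.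
Qed.

Lemma hcomp0 p F z : holomorphic F -> hcomp p 0 F z = F (sc p 0 z).
Proof. by move=> hF; rewrite /hcomp taylor_coef0 //; exact: entire_sc. Qed.

(** The component of degree 0 is [F] with the entry deleted, so this is a single term of Bessel's
    inequality. *)
Lemma l2w_sc0 rho p F : weight rho -> (forall u z, cabs u = 1 -> rho (sc p u z) = rho z) ->
  holomorphic F -> (l2w rho (F \o sc p 0) <= l2w rho F)%E.
Proof.
move=> wr rinv hF; have := bessel 1 wr rinv hF; rewrite big_ord1.
have -> // : hcomp p 0 F = F \o sc p 0.
by apply/funext => z; rewrite hcomp0.
Qed.

(** A mean value inequality, obtained by deleting the entries one after another. *)
Lemma l2w_at0 rho F : weight rho -> (forall p u z, cabs u = 1 -> rho (sc p u z) = rho z) ->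
  holomorphic F -> (l2w rho (fun=> F 0%R) <= l2w rho F)%E.
Proof.
move=> wr rinv hF.
pose Z (s : seq ('I_m * 'I_n)) z : 'M[C]_(m, n) := \matrix_(i, j) if (i, j) \in s then 0 else z i j.
suff H : forall s, holomorphic (F \o Z s) /\ (l2w rho (F \o Z s) <= l2w rho F)%E.
  have [_] := H (enum {: 'I_m * 'I_n}); have -> // : F \o Z (enum {: 'I_m * 'I_n}) = fun=> F 0.
  by apply/funext => z /=; congr F; apply/matrixP => i j; rewrite !mxE mem_enum inE.
elim=> [|p s [h1 h2]].
  have -> : F \o Z [::] = F by apply/funext => z /=; congr F; apply/matrixP => i j; rewrite mxE.
  by split.
have -> : F \o Z (p :: s) = (F \o Z s) \o sc p 0.
  apply/funext => z /=; congr F; apply/matrixP => i j; rewrite !mxE inE.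
  by case: eqP => [->|_] /=; rewrite ?mul0r ?if_same.
split; first exact: holomorphic_sc.
exact: le_trans (l2w_sc0 wr (rinv p) h1) h2.
Qed.

End rotation_averages.

(** * Bounded point evaluations, completeness and components in the Fock space *)

Section evaluation.
Variable R : realType.
Local Notation C := (Cplx R).
Variables m n : nat.
Local Notation mxo := (@mx_of R m n).
Local Notation mu := (leb R m n).
Implicit Types (F G : 'M[C]_(m, n) -> C) (z : 'M[C]_(m, n)).

Lemma nsqD_le z w : nsq (z + w) <= 2 * nsq z + 2 * nsq w.
Proof.
rewrite !mulr_sumr -big_split; apply: ler_sum => i _.
rewrite !mulr_sumr -big_split; apply: ler_sum => j _ /=.
have := cabs_sqrD_le (z i j) (w i j) ltr01; rewrite mxE invr1.
by rewrite (_ : 1 + 1 = 2).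
Qed.

Lemma nsq_vnorm z : nsq z <= (m * n)%:R * vnorm z ^+ 2.
Proof.
rewrite /nsq pair_big /=.
apply: (@le_trans _ _ (\sum_(p : 'I_m * 'I_n) vnorm z ^+ 2)).
  by apply: ler_sum => p _; rewrite lerXn2r ?nnegrE ?cabs_ge0 ?vnorm_ge0 ?cabs_entry_le.
by rewrite sumr_const card_prod !card_ord mulr_natl.
Qed.

Lemma exp_nsq_locally_bounded (c : R) : 0 <= c -> forall z, exists B : R,
  exists2 r : R, 0 < r & forall h, vnorm h <= r -> expR (c * nsq (h + z)) <= B.
Proof.
move=> c0 z; exists (expR (c * (2 * (m * n)%:R + 2 * nsq z))); exists 1 => // h h1.
rewrite ler_expR ler_wpM2l // (le_trans (nsqD_le _ _)) // lerD2r ler_wpM2l //.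
rewrite (le_trans (nsq_vnorm h)) // -[leRHS]mulr1 ler_wpM2l //.
by rewrite expr_le1 // vnorm_ge0.
Qed.

(* The bound at 0 is applied to a translate of F, with the weight exp(-2|z|^2),
   because exp(-2|z - z0|^2) <= exp(2|z0|^2) exp(-|z|^2). *)
Lemma evaluation_bound : exists2 E : R, 0 < E & forall F, fock F -> forall z,
  cabs (F z) <= E * expR (nsq z) * fnorm F.
Proof.
have [I I0 hI] := integral_gauss2 R m n.
pose rho z : R := expR (- (2 * nsq z)).
have mrho : measurable_fun setT (fun t => rho (mxo t)).
  by under eq_fun do rewrite /rho nsq_mx_of; exact: measurable_expN_sumsq.
have wr : weight rho by split => // z; exact: expR_ge0.
have rinv p u z : cabs u = 1 -> rho (sc p u z) = rho z by move=> u1; rewrite /rho nsq_sc.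
pose P : R := pi ^+ (m * n); have P0 : 0 < P by rewrite exprn_gt0 // pi_gt0.
(* [I] is the mass of the weight [rho], so the constant [F z0] has weighted square norm
   [cabs (F z0) ^+ 2 * I]; [P] undoes the normalization of [nrm2]. *)
exists (Num.sqrt (P / I)); first by rewrite sqrtr_gt0 divr_gt0.
move=> F hF z0; have [holF _] := hF.
have holG : holomorphic (F \o (fun z => z + z0)).
  apply: (@holomorphic_comp_affine _ _ _ _ _ _ (fun z => z + z0) id 1) => //.
  - by move=> z h; rewrite addrA.
  - by move=> h; rewrite mul1r.
have := l2w_at0 wr rinv holG; rewrite /= add0r.
have -> : l2w rho (fun=> F z0) = (cabs (F z0) ^+ 2 * I)%:E.
  rewrite EFinM -hI /l2w -ge0_integralZl ?lee_fin ?sqr_ge0 //.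
  exact/measurable_EFinP.
have mF := fock_cmeas hF.
have mrho' : measurable_fun setT (fun t => rho (mxo t - z0)).
  have := mx_invariant_cmeas (mx_invariant_translate (- z0)) (cmeas_RtoC mrho).
  by case.
have -> : l2w rho (F \o (fun z => z + z0)) = (\int[mu]_t (cabs (F (mxo t)) ^+ 2 * rho (mxo t - z0))%:E)%E.
  rewrite -(mx_invariant_integral (mx_invariant_translate z0)
    (f := fun z => (cabs (F z) ^+ 2 * rho (z - z0))%:E)).
    by apply: eq_integral => t _; rewrite addrK.
  by apply/measurable_EFinP; apply: measurable_funM => //; exact: measurable_cabs2.
move=> h1.
have h2 : ((cabs (F z0) ^+ 2 * I)%:E <= (expR (2 * nsq z0))%:E * l2 F)%E.
  apply: (le_trans h1); rewrite -ge0_integralZl ?lee_fin ?expR_ge0 //; last 2 first.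
  - by apply: l2w_measurable => //; exact: weight_gauss.
  - by move=> t _; rewrite lee_fin mulr_ge0 ?sqr_ge0 ?gauss_ge0.
  apply: ge0_le_integral => //.
  - by move=> t _; rewrite lee_fin mulr_ge0 ?sqr_ge0 ?expR_ge0.
  - by apply/measurable_EFinP; apply: measurable_funM => //; exact: measurable_cabs2.
  - by apply: measurable_funeM; apply: l2w_measurable => //; exact: weight_gauss.
  move=> t _; rewrite -EFinM lee_fin mulrCA ler_wpM2l ?sqr_ge0 //.
  rewrite gaussE -expRD ler_expR; have := nsqD_le (mxo t - z0) z0; rewrite subrK; lra.
move: h2; rewrite (fock_l2E hF) -EFinM lee_fin => h2.
have -> : cabs (F z0) = Num.sqrt (cabs (F z0) ^+ 2) by rewrite sqrtr_sqr ger0_norm // cabs_ge0.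
have -> : Num.sqrt (P / I) * expR (nsq z0) * fnorm F = Num.sqrt ((P / I) * expR (2 * nsq z0) * nrm2 F).
  have PI0 : 0 <= P / I by rewrite divr_ge0 // ltW.
  move: (P / I) PI0 => Q Q0; rewrite -!mulrA sqrtrM //; congr (_ * _); rewrite sqrtrM ?expR_ge0 // -fnormE; congr (_ * _).
  rewrite mulrC expRM_natr sqrtr_sqr ger0_norm // expR_ge0.
apply: ler_wsqrtr; rewrite -(ler_pM2r I0) (le_trans h2) // /P le_eqVlt; apply/orP; left; apply/eqP.
by field; rewrite gt_eqF.
Qed.

(** Evaluation bounds give pointwise limits. The indices [phi k] are chosen for the explicit rate
    1/(k+1) that [holomorphic_limit] needs, and Fatou's lemma bounds the norm of the difference from
    the limit. *)
Lemma fock_cauchy_limit (Fn : nat -> 'M[C]_(m, n) -> C) : (forall k, fock (Fn k)) ->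
  (forall e : R, 0 < e -> exists N, forall i j, (N <= i)%N -> (N <= j)%N ->
     fnorm (fun z => Fn i z - Fn j z) <= e) ->
  exists F, [/\ fock F, forall z, ctends (fun k => Fn k z) (F z)
    & forall e : R, 0 < e -> exists N, forall k, (N <= k)%N -> fnorm (fun z => F z - Fn k z) <= e].
Proof.
move=> hFn cau; have [E E0 hE] := evaluation_bound.
have ex z : exists l, ctends (fun k => Fn k z) l.
  apply: ccauchy => e e0; pose W := E * expR (nsq z).
  have W0 : 0 < W by rewrite mulr_gt0 ?expR_gt0.
  have [N hN] := cau _ (divr_gt0 e0 W0); exists N => i j Ni Nj.
  rewrite (le_trans (hE _ (fockB (hFn i) (hFn j)) z)) // -/W mulrC -ler_pdivlMr //.
  exact: hN.
have [F hF] := choice ex.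
have cau' (k : nat) : exists N, forall i j, (N <= i)%N -> (N <= j)%N ->
    fnorm (fun z => Fn i z - Fn j z) <= k.+1%:R^-1.
  by apply: cau; rewrite invr_gt0.
have [phi hphi] := choice cau'.
have small (e : R) : 0 < e -> exists N, forall k, (N <= k)%N -> E * k.+1%:R^-1 <= e.
  move=> e0; exists (Num.bound (E / e)) => k Nk.
  have := archi_boundP (divr_ge0 (ltW E0) (ltW e0)); rewrite ltr_pdivrMr // => h.
  rewrite ler_pdivrMr ?ltr0n // (le_trans (ltW h)) // mulrC ler_pM2l // ler_nat.
  by rewrite (leq_trans Nk).
have holF : holomorphic F.
  apply: (@holomorphic_limit _ _ (fun k => Fn (phi k)) F (fun k => E * k.+1%:R^-1)
    (fun z => expR (1 * nsq z))) => //.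
  - by move=> k; have [] := hFn (phi k).
  - move=> k z; rewrite mul1r.
    apply: (@ctends_le _ (fun j => Fn (phi k) z - Fn j z)).
      have := ctendsD (@ctends_cst _ (Fn (phi k) z)) (ctendsM (@ctends_cst _ (-1)) (hF z)).
      by rewrite mulN1r; under eq_fun do rewrite mulN1r.
    exists (phi k) => j kj; rewrite (le_trans (hE _ (fockB (hFn _) (hFn _)) z)) //.
    by rewrite mulrAC ler_wpM2r ?expR_ge0 // ler_wpM2l ?(ltW E0) // hphi.
  - by move=> k; rewrite mulr_ge0 ?invr_ge0 // ltW.
  - exact: exp_nsq_locally_bounded.
have P0 : 0 < pi ^+ (m * n) :> R by rewrite exprn_gt0 // pi_gt0.
have main (e : R) : 0 < e -> exists N, forall k, (N <= k)%N ->
    (l2 (fun z => F z - Fn k z)%R <= (pi ^+ (m * n) * e ^+ 2)%:E)%E.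
  move=> e0; have [N hN] := cau _ e0; exists N => k Nk.
  apply: (@l2w_fatou _ _ _ _ (fun j z => Fn j z - Fn k z) _ _ N) => [|j|z|j Nj].
  - exact: weight_gauss.
  - by apply: fock_cmeas; exact: fockB.
  - by apply: ctendsD; [exact: hF|exact: ctends_cst].
  rewrite -/(l2 _) (fock_l2E (fockB (hFn j) (hFn k))) lee_fin ler_pM2l //.
  by rewrite -fnorm_sqr lerXn2r ?nnegrE ?fnorm_ge0 ?(ltW e0) // hN.
have fFB k (e : R) : (l2 (fun z => F z - Fn k z)%R <= e%:E)%E -> fock (fun z => F z - Fn k z).
  move=> he; apply/fockP; split; last exact: le_lt_trans he (ltry _).
  have := holomorphicD holF (holomorphicZ (-1) (hFn k).1).
  by under eq_fun do rewrite mulN1r.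
have fF : fock F.
  have [N hN] := main 1 ltr01.
  have := fockD (fFB N _ (hN N (leqnn N))) (hFn N).
  by under eq_fun do rewrite subrK.
exists F; split => // e e0; have [N hN] := main e e0; exists N => k Nk.
have h := fockB fF (hFn k).
have := hN k Nk; rewrite (fock_l2E h) lee_fin ler_pM2l // -fnorm_sqr.
by rewrite ler_sqr ?nnegrE ?fnorm_ge0 ?(ltW e0).
Qed.

Section homogeneous_components.
Variables (p : 'I_m * 'I_n) (F : 'M[C]_(m, n) -> C).
Hypothesis hF : fock F.

(** The rate of the averages needs a bound of [F] where the entry is scaled by modulus 2; this at
    most quadruples [nsq], whence the weight exp(4 nsq z). The index is [N + k] because the rate
    holds only from order k on. *)
Lemma holomorphic_hcomp k : holomorphic (hcomp p k F).
Proof.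
have [E E0 hE] := evaluation_bound; have holF := hF.1.
pose A := 4 * (E * fnorm F).
have A0 : 0 <= A by rewrite !mulr_ge0 ?fnorm_ge0 // ltW.
apply: (@holomorphic_limit _ _ (fun N => avg p (N + k) k F) _ (fun N => A * 2^-1 ^+ (N + k))
  (fun z => expR (4 * nsq z))) => //.
- by move=> N; exact: holomorphic_avg.
- move=> N z; rewrite /avg /hcomp.
  have := @taylor_coef_dft R (fun t => F (sc p t z)) (E * expR (4 * nsq z) * fnorm F) k (N + k)
    (entire_sc p z holF).
  move=> h; rewrite (le_trans (h _ _)) ?leq_addl //.
    move=> t t2; rewrite (le_trans (hE _ hF _)) // ler_wpM2r ?fnorm_ge0 // ler_wpM2l ?(ltW E0) //.
    by rewrite ler_expR; apply: nsq_sc_le; rewrite t2.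
  by rewrite le_eqVlt; apply/orP; left; apply/eqP; rewrite /A; ring.
- by move=> N; rewrite mulr_ge0 // exprn_ge0 // invr_ge0.
- move=> e e0; have [N hN] := half_exp_small A0 e0; exists N => j Nj; apply: hN.
  by rewrite (leq_trans Nj) // leq_addr.
- by apply: exp_nsq_locally_bounded.
Qed.

Lemma hcomp_bessel K : (\sum_(k < K) l2 (hcomp p k F) <= l2 F)%E.
Proof.
apply: bessel; [exact: weight_gauss| |exact: hF.1].
by move=> u z u1; rewrite !gaussE nsq_sc.
Qed.

Lemma fock_hcomp k : fock (hcomp p k F).
Proof.
apply/fockP; split; first exact: holomorphic_hcomp.
apply: le_lt_trans (_ : l2 F < +oo)%E; last by case/fockP: hF.
apply: le_trans (hcomp_bessel k.+1); rewrite big_ord_recr /= leeDr //.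
by apply: sume_ge0 => i _; exact: l2w_ge0 _ (@weight_gauss _ _ _).
Qed.

Lemma sum_nrm2_hcomp K : \sum_(k < K) nrm2 (hcomp p k F) <= nrm2 F.
Proof.
have := hcomp_bessel K; rewrite (fock_l2E hF).
under eq_bigr do rewrite (fock_l2E (fock_hcomp _)).
rewrite sumEFin lee_fin -mulr_sumr ler_pM2l //.
by rewrite exprn_gt0 // pi_gt0.
Qed.

End homogeneous_components.

End evaluation.

(** * Density of monomials *)

Section approximation.
Variable R : realType.
Local Notation C := (Cplx R).
Variables m n : nat.
Implicit Types (F G : 'M[C]_(m, n) -> C) (z : 'M[C]_(m, n)).

Lemma innerZr F G (a : C) : fock F -> fock G -> inner F (fun z => a * G z) = a * inner F G.
Proof.
move=> hF hG; have := inner_linr a hF hG (@fock0 R m n).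
by rewrite inner0r // addr0 => <-; congr inner; apply/funext => z; rewrite addr0.
Qed.

Lemma innerZl F G (a : C) : fock F -> fock G -> inner (fun z => a * F z) G = a^* * inner F G.
Proof.
move=> hF hG; rewrite -(inner_conj hG (fockZ a hF)) innerZr // rmorphM /= inner_conj //.
Qed.

Lemma nrm2_orthogonal_sum (I : eqType) (s : seq I) (H : I -> 'M[C]_(m, n) -> C) :
  uniq s -> (forall i, fock (H i)) -> (forall i j, i != j -> inner (H i) (H j) = 0) ->
  nrm2 (fun z => \sum_(i <- s) H i z) = \sum_(i <- s) nrm2 (H i).
Proof.
move=> us hH ort; elim: s us => [_|i s IH /= /andP[si us]].
  rewrite big_nil -fnorm_sqr; under eq_fun do rewrite big_nil.
  by rewrite fnorm0 expr0n.
rewrite big_cons -IH //; under eq_fun do rewrite big_cons.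
rewrite Cre_inner //; last exact: fock_sum.
rewrite (_ : inner _ _ = 0) ?mulr0 ?addr0 //.
under eq_fun do under eq_bigr do rewrite -[H _ _]mul1r.
rewrite inner_sumr // big_seq big1 // => j js; rewrite ort ?mulr0 //.
by apply: contraNneq si => ->.
Qed.

(** Lists of pairs may repeat an index, so adding two combinations is concatenation.
    [big_span_index] converts to the format of [is_onb]. *)
Definition span_approx (I : Type) (e : I -> 'M[C]_(m, n) -> C) F := forall eps : R, 0 < eps ->
  exists r : seq (C * I), fnorm (fun z => F z - \sum_(x <- r) x.1 * e x.2 z) < eps.

Section span.
Variables (I : Type) (e : I -> 'M[C]_(m, n) -> C).
Hypothesis he : forall i, fock (e i).

Lemma fock_span (r : seq (C * I)) : fock (fun z => \sum_(x <- r) x.1 * e x.2 z).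
Proof. by apply: fock_sum => x; exact: fockZ. Qed.

Lemma span_approx_span (r : seq (C * I)) : span_approx e (fun z => \sum_(x <- r) x.1 * e x.2 z).
Proof. by move=> eps eps0; exists r; under eq_fun do rewrite subrr; rewrite fnorm0. Qed.

Lemma span_approxD F G : fock F -> fock G -> span_approx e F -> span_approx e G ->
  span_approx e (fun z => F z + G z).
Proof.
move=> hF hG aF aG eps eps0; have e2 : 0 < eps / 2 by rewrite divr_gt0.
have [r hr] := aF _ e2; have [s hs] := aG _ e2; exists (r ++ s).
rewrite [eps]splitr; apply: le_lt_trans (ltrD hr hs).
have := fnormD (fockB hF (fock_span r)) (fockB hG (fock_span s)).
congr (fnorm _ <= _); apply/funext => z; rewrite big_cat /=; ring.
Qed.

Lemma span_approx_sum J (s : seq J) (H : J -> 'M[C]_(m, n) -> C) : (forall j, fock (H j)) ->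
  (forall j, span_approx e (H j)) -> span_approx e (fun z => \sum_(j <- s) H j z).
Proof.
move=> hH aH; elim: s => [|j s IH].
  by under eq_fun do rewrite big_nil; have := span_approx_span [::]; under eq_fun do rewrite big_nil.
under eq_fun do rewrite big_cons; apply: span_approxD => //.
exact: fock_sum.
Qed.

Lemma span_approx_limit F : fock F ->
  (forall eps : R, 0 < eps -> exists G, [/\ fock G, span_approx e G & fnorm (fun z => F z - G z) <= eps]) ->
  span_approx e F.
Proof.
move=> hF h eps eps0; have e2 : 0 < eps / 2 by rewrite divr_gt0.
have [G [hG aG FG]] := h _ e2; have [r hr] := aG _ e2; exists r.
rewrite [eps]splitr; apply: le_lt_trans (ler_ltD FG hr).
apply: fnormB_le => //; exact: fock_span.
Qed.

End span.

End approximation.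

(** * Homogeneous components in one entry *)

Section homogeneity.
Variable R : realType.
Local Notation C := (Cplx R).
Variables m n : nat.
Implicit Types (F G : 'M[C]_(m, n) -> C) (z : 'M[C]_(m, n)) (p q : 'I_m * 'I_n).

Definition homog p k F := forall (u : C) z, F (sc p u z) = u ^+ k * F z.

(** Rotation by [w] multiplies the inner product by the conjugate of w^k times w^l. This factor is
    not 1, since the order of [w] exceeds both degrees. *)
Lemma homog_orthogonal p k l F G : fock F -> fock G -> homog p k F -> homog p l G ->
  k != l -> inner F G = 0.
Proof.
move=> hF hG fk gl kl.
pose N := maxn k l; pose w := root2 R N; have wP : (2 ^ N).-primitive_root w := root2P R N.
have lt j : (j <= N)%N -> (j < 2 ^ N)%N by move=> jN; rewrite (leq_ltn_trans jN) // ltn_expl.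
have w1 := cabs_root wP.
have := inner_invariant hF hG (mx_invariant_sc p w1) (fun z => nsq_sc p z w1).
have -> : F \o sc p w = fun z => w ^+ k * F z by apply/funext => z; exact: fk.
have -> : G \o sc p w = fun z => w ^+ l * G z by apply/funext => z; exact: gl.
rewrite (innerZr _ (fockZ _ hF) hG) (innerZl _ hF hG).
move=> /eqP; rewrite mulrA -subr_eq0 -{2}[inner F G]mul1r -mulrBl mulf_eq0 subr_eq0.
case/orP => [/eqP e|/eqP //]; exfalso.
have e' : w ^+ l = w ^+ k.
  have wk : (w ^+ k)^* * w ^+ k = 1 by rewrite conjC_mul (cabs_root_exp wP) expr1n.
  have : (w ^+ k)^* != 0 by apply/eqP => h; move/eqP: wk; rewrite h mul0r eq_sym oner_eq0.
  by move/mulfI; apply; rewrite wk mulrC.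
move/eqP: e'; rewrite (eq_prim_root_expr wP) !modn_small ?lt ?leq_maxl ?leq_maxr //.
by rewrite eq_sym (negbTE kl).
Qed.

Section components.
Variables (p : 'I_m * 'I_n) (F : 'M[C]_(m, n) -> C).
Hypothesis hF : fock F.

(** Scaling is known in the closed unit disc; for larger [u] it is applied with [u^-1] at the point
    [sc p u z]. *)
Lemma homog_hcomp k : homog p k (hcomp p k F).
Proof.
have H (u : C) z : cabs u <= 1 -> hcomp p k F (sc p u z) = u ^+ k * hcomp p k F z.
  move=> u1; rewrite /hcomp -taylor_coef_scale //; last by apply: entire_sc; exact: hF.1.
  apply: (congr1 (fun g => taylor_coef g k)).
  by apply/funext => t; rewrite scM mulrC.
move=> u z; have [|u1] := leP (cabs u) 1; first exact: H.
have u0 : u != 0 by rewrite -cabs_gt0 (lt_trans _ u1).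
have := H u^-1 (sc p u z); rewrite cabsV invf_le1 ?(lt_trans _ u1) // (ltW u1) => /(_ isT).
rewrite scM mulVf // sc1 => ->.
by rewrite mulrA -exprMn divff // expr1n mul1r.
Qed.

(** Expanding in one entry must not destroy the homogeneity already achieved in others; scalings of
    different entries commute. *)
Lemma homog_hcomp_other q l k : q != p -> homog q l F -> homog q l (hcomp p k F).
Proof.
move=> qp hl u z; rewrite /hcomp -taylor_coefZ; last by apply: entire_sc; exact: hF.1.
apply: (congr1 (fun g => taylor_coef g k)).
by apply/funext => t; rewrite -hl sc_comm // eq_sym.
Qed.

(** Bessel's inequality bounds the partial sums of squared norms, so by orthogonality the sums [S K]
    form a Cauchy sequence. Its norm limit is also a pointwise limit and equals [F] by the Taylor
    expansion at t = 1. *)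
Lemma hcomp_sum_approx (eps : R) : 0 < eps ->
  exists K, fnorm (fun z => F z - \sum_(k < K) hcomp p k F z) <= eps.
Proof.
move=> eps0.
pose S K z := \sum_(0 <= k < K) hcomp p k F z.
have fh k := fock_hcomp p hF k.
have fS K : fock (S K) by apply: fock_sum.
have ort i j : i != j -> inner (hcomp p i F) (hcomp p j F) = 0.
  by apply: homog_orthogonal => //; exact: homog_hcomp.
pose a K := \sum_(0 <= k < K) nrm2 (hcomp p k F).
have nS i j : (j <= i)%N -> nrm2 (fun z => S i z - S j z) = a i - a j.
  move=> ji; rewrite /a (big_cat_nat _ ji) //= [X in X - _]addrC addrK.
  rewrite -nrm2_orthogonal_sum ?iota_uniq //; congr nrm2; apply/funext => z.
  by rewrite /S (big_cat_nat _ ji) //= [X in X - _]addrC addrK.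
have am i j : (j <= i)%N -> a j <= a i by move=> ji; rewrite -subr_ge0 -nS // nrm2_ge0.
have aB i : a i <= nrm2 F by rewrite /a big_mkord sum_nrm2_hcomp.
have hs : has_sup (range a).
  by split; [exists (a 0%N), 0%N|exists (nrm2 F) => _ [i _ <-]].
have cau (e : R) : 0 < e -> exists N, forall i j, (N <= i)%N -> (N <= j)%N ->
    fnorm (fun z => S i z - S j z) <= e.
  move=> e0; have e2 : 0 < e ^+ 2 by rewrite exprn_gt0.
  have [_ [N _ <-] hN] := sup_adherent e2 hs.
  exists N => i j; wlog ji : i j / (j <= i)%N => [W Ni Nj|Ni Nj].
    by case/orP: (leq_total j i) => h; [exact: W|rewrite fnormN //; exact: W].
  rewrite -ler_sqr ?nnegrE ?fnorm_ge0 ?(ltW e0) // fnorm_sqr nS //.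
  have := am _ _ Nj; have : a i <= sup (range a) by apply: sup_upper_bound => //; exists i.
  lra.
have [G [fG SG hG]] := fock_cauchy_limit fS cau.
have GF : G = F.
  apply/funext => z; apply: ctends_uniq (SG z) _ => e e0.
  have fE := entire_sc p z hF.1.
  have [B fB] := entire_bounded_circle_r fE (ltr0Sn R 1).
  have B0 : 0 <= 4 * B.
    rewrite mulr_ge0 // (le_trans (cabs_ge0 (F (sc p 2 z)))) // fB //.
    by rewrite -(RtoC_nat R 2) cabs_RtoC ger0_norm.
  have [N hN] := half_exp_small B0 e0; exists N => K NK.
  have := taylor_expansion1 fE fB K (cabs1 R); rewrite sc1 cabsC => h.
  apply: le_trans (hN K NK); apply: le_trans h; rewrite /S big_mkord.
  by rewrite le_eqVlt; apply/orP; left; apply/eqP; congr (cabs (_ - _)); apply: eq_bigr => k _; rewrite expr1n mulr1.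
have [K hK] := hG _ eps0; exists K; move: (hK K (leqnn K)); rewrite GF.
by congr (fnorm _ <= _); apply/funext => z; rewrite /S big_mkord.
Qed.

End components.

End homogeneity.

(** * Norms and orthogonality of monomials *)

Section monomials.
Variable R : realType.
Local Notation C := (Cplx R).
Variables m n : nat.
Local Notation mxo := (@mx_of R m n).
Local Notation mu := (leb R m n).
Local Notation idx := {ffun 'I_m * 'I_n -> nat}.
Implicit Types (F G : 'M[C]_(m, n) -> C) (z : 'M[C]_(m, n)) (p q : 'I_m * 'I_n) (a b : idx).

Lemma holomorphicM F G : holomorphic F -> holomorphic G -> holomorphic (fun z => F z * G z).
Proof.
move=> h h' z; have -> : (fun z => F z * G z) = F * G by [].
by apply: differentiableM; [exact: h|exact: h'].
Qed.

Lemma holomorphic_cst (c : C) : holomorphic (fun _ : 'M[C]_(m, n) => c).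
Proof. by move=> z; exact: differentiable_cst. Qed.

Lemma holomorphic_entry i j : holomorphic (fun z : 'M[C]_(m, n) => z i j).
Proof.
move=> z; apply: (@estimate_differentiable R 'M[C]_(m, n) (fun z => z i j) z (fun h => h i j) 1).
- by move=> a h1 h2; rewrite !mxE.
- by move=> h; rewrite mul1r cabs_entry_le.
- move=> e e0; exists 1 => // h _; rewrite mxE addrK subrr cabs0.
  by rewrite mulr_ge0 ?vnorm_ge0 // ltW.
Qed.

Lemma holomorphic_prod (I : Type) (s : seq I) (P : pred I) (H : I -> 'M[C]_(m, n) -> C) :
  (forall i, holomorphic (H i)) -> holomorphic (fun z => \prod_(i <- s | P i) H i z).
Proof.
move=> h; elim: s => [|i s IH].
  by under eq_fun do rewrite big_nil; exact: holomorphic_cst.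
under eq_fun do rewrite big_cons; case: (P i) => //.
exact: holomorphicM.
Qed.

Lemma holomorphicX F k : holomorphic F -> holomorphic (fun z => F z ^+ k).
Proof.
move=> h; elim: k => [|k IH]; first by under eq_fun do rewrite expr0; exact: holomorphic_cst.
by under eq_fun do rewrite exprS; exact: holomorphicM.
Qed.

Definition mono a z : C := \prod_p z p.1 p.2 ^+ a p.

Lemma holomorphic_mono a : holomorphic (mono a).
Proof.
by apply: holomorphic_prod => p; apply: holomorphicX; exact: holomorphic_entry.
Qed.

Lemma homog_mono a p : homog p (a p) (mono a).
Proof.
move=> u z; rewrite /mono (bigD1 p) //= [in RHS](bigD1 p) //= mulrA mxE -surjective_pairing eqxx.
rewrite exprMn; congr (_ * _); apply: eq_bigr => q qp; rewrite mxE -surjective_pairing.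
by rewrite (negbTE qp).
Qed.

Definition lower a p : idx := [ffun q => (a q - (q == p))%N].

Lemma cabs2_mono_split a p k t : a p = k ->
  cabs (mono a (mxo t)) ^+ 2 =
  (tnth t (rei p) ^+ 2 + tnth t (imi p) ^+ 2) ^+ k *
  \prod_(q | q != p) (tnth t (rei q) ^+ 2 + tnth t (imi q) ^+ 2) ^+ a q.
Proof.
move=> ap; have E q : cabs (mxo t q.1 q.2) ^+ 2 = tnth t (rei q) ^+ 2 + tnth t (imi q) ^+ 2.
  by rewrite mx_ofE cabs_sqr -surjective_pairing.
rewrite /mono (bigD1 p) //= cabsM exprMn cabsX ap exprAC E; congr (_ * _).
elim/big_rec2: _ => [|q y1 y2 _ h]; first by rewrite cabs1 expr1n.
by rewrite cabsM exprMn h cabsX exprAC E.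
Qed.

(** The entry [p] occupies two real coordinates, to which the moment recursion applies; [H] gathers
    the other entries. *)
Lemma l2_mono_step a p k : a p = k.+1 -> l2 (mono a) = (k.+1%:R%:E * l2 (mono (lower a p)))%E.
Proof.
move=> ap; pose H (t : (m * n + m * n).-tuple (measurableTypeR R)) : R :=
  \prod_(q | q != p) (tnth t (rei q) ^+ 2 + tnth t (imi q) ^+ 2) ^+ a q.
have lp : lower a p p = k by rewrite ffunE eqxx ap subn1.
have := @gauss_moment_step R _ (rei p) (imi p) H k.
rewrite rei_imi => /(_ isT) h.
have mt i : measurable_fun setT (fun t : (m * n + m * n).-tuple (measurableTypeR R) => tnth t i : R).
  exact: measurable_tnth.
have mH : measurable_fun setT H.
  rewrite /H; under eq_fun do rewrite -big_filter; apply: measurable_prod => q _; apply: measurable_funX.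
  by apply: measurable_funD; exact: measurable_funX.
have := h mH; clear h => h.
rewrite /l2 /l2w.
under eq_integral do rewrite (cabs2_mono_split _ ap) gauss_mx_of.
rewrite h; first 1 last.
- by move=> t; apply: prodr_ge0 => q _; rewrite exprn_ge0 // addr_ge0 ?sqr_ge0.
- move=> t x; apply: eq_bigr => q qp.
  by rewrite !tnth_upd rei_imi imi_eq (negbTE qp).
- move=> t x; apply: eq_bigr => q qp.
  by rewrite !tnth_upd rei_eq imi_rei (negbTE qp).
congr (_ * _)%E; apply: eq_integral => t _.
rewrite (cabs2_mono_split _ lp) gauss_mx_of; congr ((_ * _ * _)%:E).
by apply: eq_bigr => q qp; rewrite ffunE (negbTE qp) subn0.
Qed.

Definition ffact a : nat := \prod_p (a p)`!.

(** Induction on the total degree, lowering one exponent by 1 each time, down to the Gaussian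
    mass. *)
Lemma l2_mono a : l2 (mono a) = (pi ^+ (m * n) * (ffact a)%:R)%:E.
Proof.
have [k] := ubnP (\sum_p a p)%N; elim: k a => // k IH a ak.
have [/forallP a0|] := boolP [forall p, a p == 0%N].
  rewrite /ffact big1 ?mulr1; last by move=> p _; rewrite (eqP (a0 p)).
  rewrite -integral_gauss; apply: eq_integral => t _.
  rewrite (_ : mono a _ = 1) ?cabs1 ?expr1n ?mul1r //.
  by rewrite /mono big1 // => p _; rewrite (eqP (a0 p)).
rewrite negb_forall => /existsP[p]; rewrite -lt0n => ap.
have ap' : a p = (a p).-1.+1 by rewrite prednK.
rewrite (l2_mono_step ap') IH.
  rewrite -EFinM mulrCA -natrM; congr ((_ * _%:R)%:E).
  rewrite /ffact (bigD1 p) //= [in RHS](bigD1 p) //= ffunE eqxx subn1 mulnA {3}ap' factS.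
  congr (_ * _)%N; apply: eq_bigr => q qp; rewrite ffunE (negbTE qp) subn0 //.
move: ak; rewrite (bigD1 p) //= [in X in _ -> X](bigD1 p) //= ffunE eqxx subn1 {1}ap' addSn ltnS.
rewrite (eq_bigr (fun q => lower a p q)) // => q qp.
by rewrite ffunE (negbTE qp) subn0.
Qed.

Lemma fock_mono a : fock (mono a).
Proof. by apply/fockP; split; [exact: holomorphic_mono|rewrite l2_mono ltry]. Qed.

Lemma nrm2_mono a : nrm2 (mono a) = (ffact a)%:R.
Proof.
by rewrite /nrm2 l2_mono /= mulrA mulVf ?mul1r // gt_eqF // exprn_gt0 // pi_gt0.
Qed.

Lemma inner_mono a b : inner (mono a) (mono b) = (ffact a)%:R * (a == b)%:R.
Proof.
have [->|ab] := eqVneq a b; first by rewrite inner_self nrm2_mono mulr1 RtoC_nat.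
have [p pab] : exists p, a p != b p.
  apply/existsP; rewrite -negb_forall; apply: contraNN ab => /forallP h.
  by apply/eqP/ffunP => p; apply/eqP.
rewrite mulr0; apply: (homog_orthogonal (fock_mono a) (fock_mono b) (homog_mono a p) (homog_mono b p) pab).
Qed.

Lemma homog_all F a : (forall p, homog p (a p) F) -> F = fun z => F (const_mx 1) * mono a z.
Proof.
move=> hF; apply/funext => z.
pose Z (s : seq ('I_m * 'I_n)) : 'M[C]_(m, n) := \matrix_(i, j) if (i, j) \in s then z i j else 1.
have H : forall s, uniq s -> F (Z s) = F (const_mx 1) * \prod_(p <- s) z p.1 p.2 ^+ a p.
  elim=> [_|p s IH /= /andP[ps us]].
    by rewrite big_nil mulr1; congr F; apply/matrixP => i j; rewrite !mxE.
  rewrite big_cons mulrCA -IH // -hF; congr F; apply/matrixP => i j; rewrite !mxE inE.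
  case: eqP => [e|//] /=; rewrite e (negbTE ps) mulr1 -e //.
rewrite /mono -[in RHS]big_enum -H ?enum_uniq //; congr F; apply/matrixP => i j.
by rewrite mxE mem_enum.
Qed.

(* Expanding in one matrix entry at a time reduces to functions homogeneous in
   every entry, which are multiples of monomials. *)
Lemma mono_dense F : fock F -> span_approx mono F.
Proof.
move=> hF.
suff H : forall (s : seq ('I_m * 'I_n)) F, fock F -> (forall p, p \notin s -> exists k, homog p k F) -> span_approx mono F.
  by have := H (enum {: 'I_m * 'I_n}) F hF; apply => p; rewrite mem_enum.
move=> {F hF}; elim=> [|p s IH] F hF hom.
  have /choice[a ha] : forall p, exists k, homog p k F by move=> p; exact: hom.
  have := @homog_all F [ffun p => a p]; move=> /(_ _)-> => [|p]; last by rewrite ffunE.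
  move: (F _) [ffun p => a p] => c b; have := span_approx_span mono [:: (c, b)].
  have -> // : (fun z => \sum_(x <- [:: (c, b)]) x.1 * mono x.2 z) = (fun z => c * mono b z).
  by apply/funext => z; rewrite big_seq1.
apply: (span_approx_limit fock_mono) => // eps eps0.
have [K hK] := hcomp_sum_approx p hF eps0.
exists (fun z => \sum_(k < K) hcomp p k F z); split => //.
  by apply: fock_sum => k; exact: fock_hcomp.
apply: span_approx_sum => [a|k|k]; [exact: fock_mono|exact: fock_hcomp|].
apply: IH => [|q qs]; first exact: fock_hcomp.
have [->|qp] := eqVneq q p; first by exists k; exact: homog_hcomp.
have [|l hl] := hom q; first by rewrite inE negb_or qp.
by exists l; exact: homog_hcomp_other.
Qed.

End monomials.

(** * Schur polynomials of eigenvalues *)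

Section alternant_theory.
Variables (A : comNzRingType) (n : nat).
Implicit Types (x : 'I_n -> A) (mu : 'I_n -> nat) (s : 'S_n).

Lemma alternantE x mu : alternant x mu = \sum_(s : 'S_n) (-1) ^+ s * \prod_i x i ^+ mu (s i).
Proof. by apply: eq_bigr => s _; congr (_ * _); apply: eq_bigr => i _; rewrite mxE. Qed.

Lemma alternant_permx x mu s : alternant (x \o s) mu = (-1) ^+ s * alternant x mu.
Proof.
rewrite /alternant (_ : \matrix_(i, j) _ = row_perm s (\matrix_(i, j) x i ^+ mu j)).
  by rewrite row_permE det_mulmx det_perm.
by apply/matrixP => i j; rewrite !mxE.
Qed.

Lemma alternant_permmu x mu s : alternant x (mu \o s) = (-1) ^+ s * alternant x mu.
Proof.
rewrite /alternant -[in RHS]det_tr -[in LHS]det_tr.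
rewrite (_ : (\matrix_(i, j) x i ^+ (mu \o s) j)^T = row_perm s (\matrix_(i, j) x i ^+ mu j)^T).
  by rewrite row_permE det_mulmx det_perm.
by apply/matrixP => i j; rewrite !mxE.
Qed.

Lemma alternant_eq0 x mu i j : i != j -> mu i = mu j -> alternant x mu = 0.
Proof.
move=> ij e; rewrite /alternant -det_tr; apply: (determinant_alternate ij) => k.
by rewrite !mxE e.
Qed.

(** The Vandermonde determinant has increasing exponents while [delta] decreases; the sign is that
    of reversing the order. *)
Lemma alternant_delta (x : 'rV[A]_n) :
  \prod_(i < n) \prod_(j < n | (i < j)%N) (x 0 j - x 0 i) =
  (-1) ^+ (perm (@rev_ord_inj n)) * alternant (fun i => x 0 i) (@delta n).
Proof.
rewrite -det_Vandermonde -alternant_permmu /alternant -det_tr; congr (\det _).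
apply/matrixP => i j; rewrite !mxE /= permE /delta /=; congr (_ ^+ _).
by rewrite subnSK ?subKn // ltnW.
Qed.

End alternant_theory.

Lemma alternant_rmorph (A B : comNzRingType) (f : {rmorphism A -> B}) n (x : 'I_n -> A) mu :
  f (alternant x mu) = alternant (f \o x) mu.
Proof.
rewrite /alternant -det_map_mx; congr (\det _); apply/matrixP => i j.
by rewrite !mxE rmorphXn.
Qed.

Lemma msym_alternant (A : comNzRingType) n (mu : 'I_n -> nat) (s : 'S_n) :
  let a := alternant (fun i : 'I_n => mpoly.mpolyX A (mpoly.mnm1 i)) mu in
  mpoly.msym s a = (-1) ^+ s * a.
Proof.
rewrite /= -alternant_permx; apply: (etrans (alternant_rmorph (mpoly.msym s) _ _)).
congr alternant; apply/funext => i.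
exact: (etrans (mpoly.mmapX _ _ _) (mpoly.mmap1U _ _)).
Qed.

(** Both alternants take the same sign under a permutation of the variables, and the nonzero one can
    be cancelled. *)
Lemma alternant_quotient_sym (A : idomainType) n (mu nu : 'I_n -> nat) (p : mpoly.mpoly n A) :
  let a := alternant (fun i : 'I_n => mpoly.mpolyX A (mpoly.mnm1 i)) in
  a mu = p * a nu -> a nu != 0 -> p \is @mpoly.symmetric n A.
Proof.
move=> a ap a0; apply/mpoly.issymP => s.
have s0 : (-1) ^+ s != 0 :> mpoly.mpoly n A by rewrite signr_eq0.
apply: (mulIf (mulf_neq0 s0 a0)); rewrite [RHS]mulrCA -ap.
have h mu' : mpoly.msym s (a mu') = (-1) ^+ s * a mu' by exact: msym_alternant.
by rewrite -!h ap rmorphM.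
Qed.

Section schur_symmetric.
Variable R : realType.
Local Notation C := (Cplx R).
Variable n : nat.
Local Notation var := (@mpvar R n).
Local Notation meval v := (@mpoly.meval n C v).

(** At the distinct points 0, ..., n - 1 the Vandermonde product has no zero factor. *)
Lemma alternant_delta_neq0 : alternant var (@delta n) != 0.
Proof.
apply/eqP => h; pose v : 'I_n -> C := fun i => (i : nat)%:R.
have := congr1 (meval v) h.
rewrite mpoly.meval0.
rewrite alternant_rmorph.
have -> : meval v \o var = v by apply/funext => i; rewrite /= mpoly.mevalXU.
move=> a0.
have := alternant_delta (\row_i v i).
have -> : (fun i => (\row_i v i) 0 i) = v by apply/funext => i; rewrite mxE.
rewrite a0 mulr0 => /eqP; rewrite prodf_seq_eq0 => /hasP[i _ /=].
rewrite prodf_seq_eq0 => /hasP[j _ /= /andP[ij]].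
by rewrite !mxE subr_eq0 eqr_nat (gtn_eqF ij).
Qed.

Lemma schur_sym l : @schur R n l \is @mpoly.symmetric n C.
Proof.
have := @alternant_quotient_sym C n (add_delta l) (@delta n) (schur R l).
apply; [exact: schurP|exact: alternant_delta_neq0].
Qed.

(** The fundamental theorem on symmetric polynomials: up to sign, the coefficient of degree n - (k +
    1) is the elementary symmetric polynomial of degree k + 1 in the roots. *)
Lemma meval_sym (p : mpoly.mpoly n C) : p \is @mpoly.symmetric n C ->
  exists t : mpoly.mpoly n C, forall v : 'I_n -> C,
    meval v p = meval (fun k : 'I_n => (-1) ^+ k.+1 * (\prod_(i < n) ('X - (v i)%:P))`_(n - k.+1)) t.
Proof.
move=> /mpoly.sym_fundamental[t [<- _]]; exists t => v.
rewrite mpoly.comp_mpoly_meval; apply: mpoly.meval_eq => k.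
have := @mpoly.mroots_coeff C n [tuple v i | i < n] (lift ord0 k).
rewrite big_tuple; under eq_bigr do rewrite tnth_mktuple.
rewrite lift0 => ->; rewrite tnth_mktuple mulrA -exprMn mulN1r opprK expr1n mul1r.
by apply: mpoly.meval_eq => i; rewrite tnth_mktuple.
Qed.

Lemma size_eigenvalues (z : 'M[C]_n) : size (eigenvalues z) = n.
Proof.
have := size_char_poly z; rewrite eigenvaluesP size_prod_XsubC.
by case.
Qed.

Lemma eigenvalues_prod (z : 'M[C]_n) :
  \prod_(i < n) ('X - ((eigenvalues z)`_i)%:P) = char_poly z.
Proof. by rewrite eigenvaluesP (big_nth 0) size_eigenvalues big_mkord. Qed.

(** [chi] is defined through an arbitrary ordering of eigenvalues. This form removes the ordering
    and shows that [chi] is polynomial in the entries. *)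
Lemma chi_char_poly l : exists t : mpoly.mpoly n C, forall z : 'M[C]_n,
  chi l z = meval (fun k : 'I_n => (-1) ^+ k.+1 * (char_poly z)`_(n - k.+1)) t.
Proof.
have [t ht] := meval_sym (schur_sym l); exists t => z.
by rewrite /chi ht eigenvalues_prod.
Qed.

(** [eigenvalues] need not list the diagonal in its order; both sides depend only on the
    characteristic polynomial. *)
Lemma chi_diag l (x : 'rV[C]_n) : chi l (diag_mx x) = meval (fun i => x 0 i) (schur R l).
Proof.
have [t ht] := meval_sym (schur_sym l).
rewrite /chi !ht eigenvalues_prod char_poly_trig; last by rewrite diag_mx_is_trig.
by under eq_bigr do rewrite mxE eqxx mulr1n.
Qed.

Lemma char_poly_conj (u z : 'M[C]_n) : u \in unitmx -> char_poly (invmx u *m z *m u) = char_poly z.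
Proof.
move=> uu; rewrite /char_poly.
have -> : char_poly_mx (invmx u *m z *m u) = map_mx polyC (invmx u) *m char_poly_mx z *m map_mx polyC u.
  rewrite /char_poly_mx mulmxBr mulmxBl !map_mxM scalar_mxC -[_%:M *m _ *m _]mulmxA -!map_mxM mulVmx //.
  by rewrite map_mx1 mulmx1 !map_mxM.
by rewrite !det_mulmx mulrAC -det_mulmx -map_mxM mulVmx // map_mx1 det1 mul1r.
Qed.

Lemma chi_conj l (u z : 'M[C]_n) : u \in unitmx -> chi l (invmx u *m z *m u) = chi l z.
Proof. by move=> uu; rewrite /chi /eigenvalues char_poly_conj. Qed.

End schur_symmetric.

Section polynomial_functions.
Variable R : realType.
Local Notation C := (Cplx R).
Variables m n : nat.
Local Notation idx := {ffun 'I_m * 'I_n -> nat}.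
Implicit Types (F G : 'M[C]_(m, n) -> C).

Definition poly_fun F := exists r : seq (C * idx), F = fun z => \sum_(x <- r) x.1 * mono x.2 z.

Lemma poly_fun_fock F : poly_fun F -> fock F.
Proof. by move=> [r ->]; apply: fock_span; exact: fock_mono. Qed.

Lemma poly_funD F G : poly_fun F -> poly_fun G -> poly_fun (fun z => F z + G z).
Proof.
by move=> [r ->] [s ->]; exists (r ++ s); apply/funext => z; rewrite big_cat.
Qed.

Lemma monoM (a b : idx) z : mono a z * mono b z = mono [ffun p => (a p + b p)%N] z :> C.
Proof. by rewrite -big_split; apply: eq_bigr => p _; rewrite ffunE exprD. Qed.

Lemma poly_funM F G : poly_fun F -> poly_fun G -> poly_fun (fun z => F z * G z).
Proof.
move=> [r ->] [s ->].
exists (allpairs (fun x y : C * idx => (x.1 * y.1, [ffun p => (x.2 p + y.2 p)%N])) r s).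
apply/funext => z; rewrite big_allpairs_dep mulr_suml; apply: eq_bigr => x _.
by rewrite mulr_sumr; apply: eq_bigr => y _; rewrite /= -monoM mulrACA.
Qed.

Lemma poly_fun_cst (c : C) : poly_fun (fun=> c).
Proof.
exists [:: (c, [ffun=> 0%N])]; apply/funext => z.
by rewrite big_seq1 /mono big1 ?mulr1 // => p _; rewrite ffunE.
Qed.

Lemma poly_fun_entry i j : poly_fun (fun z => z i j).
Proof.
exists [:: (1, [ffun p => (p == (i, j)) : nat])]; apply/funext => z.
rewrite big_seq1 mul1r /mono (bigD1 (i, j)) //= ffunE eqxx expr1 big1 ?mulr1 // => p pij.
by rewrite ffunE (negbTE pij).
Qed.

Lemma poly_fun_sum I (s : seq I) (P : pred I) (H : I -> 'M[C]_(m, n) -> C) :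
  (forall i, poly_fun (H i)) -> poly_fun (fun z => \sum_(i <- s | P i) H i z).
Proof.
move=> h; elim: s => [|i s IH].
  by under eq_fun do rewrite big_nil; exact: poly_fun_cst.
by under eq_fun do rewrite big_cons; case: (P i) => //; exact: poly_funD.
Qed.

Lemma poly_fun_prod I (s : seq I) (P : pred I) (H : I -> 'M[C]_(m, n) -> C) :
  (forall i, poly_fun (H i)) -> poly_fun (fun z => \prod_(i <- s | P i) H i z).
Proof.
move=> h; elim: s => [|i s IH].
  by under eq_fun do rewrite big_nil; exact: poly_fun_cst.
by under eq_fun do rewrite big_cons; case: (P i) => //; exact: poly_funM.
Qed.

Lemma poly_funX F k : poly_fun F -> poly_fun (fun z => F z ^+ k).
Proof.
move=> h; elim: k => [|k IH].
  by under eq_fun do rewrite expr0; exact: poly_fun_cst.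
by under eq_fun do rewrite exprS; exact: poly_funM.
Qed.

Lemma poly_fun_meval k (t : mpoly.mpoly k C) (v : 'I_k -> 'M[C]_(m, n) -> C) :
  (forall i, poly_fun (v i)) -> poly_fun (fun z => mpoly.meval (v^~ z) t).
Proof.
move=> h; under eq_fun do rewrite mpoly.mevalE.
apply: poly_fun_sum => a; apply: poly_funM; first exact: poly_fun_cst.
by apply: poly_fun_prod => i; exact: poly_funX.
Qed.

Definition poly_coef_fun (P : 'M[C]_(m, n) -> {poly C}) := forall k, poly_fun (fun z => (P z)`_k).

Lemma poly_coef_fun_cst P : poly_coef_fun (fun=> P).
Proof. by move=> k; exact: poly_fun_cst. Qed.

Lemma poly_coef_funM P Q : poly_coef_fun P -> poly_coef_fun Q -> poly_coef_fun (fun z => P z * Q z).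
Proof.
move=> hP hQ k; under eq_fun do rewrite coefM.
by apply: poly_fun_sum => i; apply: poly_funM.
Qed.

Lemma poly_coef_fun_det k (Q : 'M[C]_(m, n) -> 'M[{poly C}]_k) :
  (forall i j, poly_coef_fun (fun z => Q z i j)) -> poly_coef_fun (fun z => \det (Q z)).
Proof.
move=> h l; under eq_fun do rewrite coef_sum.
apply: poly_fun_sum => s.
have H : poly_coef_fun (fun z => (-1) ^+ s * \prod_i Q z i (s i)).
  apply: poly_coef_funM; first exact: poly_coef_fun_cst.
  elim: (index_enum _) => [|i r IH]; first by under eq_fun do rewrite big_nil; exact: poly_coef_fun_cst.
  by under eq_fun do rewrite big_cons; exact: poly_coef_funM.
exact: H.
Qed.

End polynomial_functions.

Section schur_basis_theory.
Variable R : realType.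
Local Notation C := (Cplx R).
Variable n : nat.

Lemma poly_fun_chi (l : partitions n) : poly_fun (chi l : 'M[C]_n -> C).
Proof.
have [t ht] := chi_char_poly R l.
rewrite (funext ht).
apply: (@poly_fun_meval _ _ _ _ t (fun k z => (-1) ^+ k.+1 * (char_poly z)`_(n - k.+1))) => k.
apply: poly_funM; first exact: poly_fun_cst.
apply: poly_coef_fun_det => i j k'.
under eq_fun do rewrite !mxE coefB coefC.
apply: poly_funD; first exact: poly_fun_cst.
case: (_ == 0%N); last exact: poly_fun_cst.
have := poly_funM (poly_fun_cst _ _ (-1)) (poly_fun_entry R i j).
by under eq_fun do rewrite mulN1r.
Qed.

Lemma fockU_schur_basis (l : partitions n) : fockU R n (schur_basis l).
Proof.
split.
  apply: poly_fun_fock; apply: poly_funM; last exact: poly_fun_chi.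
  exact: poly_fun_cst.
by move=> u uu z; rewrite /schur_basis chi_conj // unitarymx_unit.
Qed.

End schur_basis_theory.

(** * Alternating functions *)

Section column_permutations.
Variable R : realType.
Local Notation C := (Cplx R).
Local Notation T := (measurableTypeR R).

(** A quarter turn sends the coordinates (x, y) to (-y, x); one sign change then gives the swap. *)
Lemma leb_invariant_tperm N (a b : 'I_N) : a != b ->
  leb_invariant (fun t : N.-tuple T => [tuple tnth t (tperm a b i) | i < N]).
Proof.
move=> ab; rewrite (_ : (fun t => _) = (fun t => upd t a (- tnth t a : R)) \o rot2 a b 0 1).
  by apply: leb_invariant_comp; [exact: leb_invariant_opp|apply: leb_invariant_rot2 => //; ring].
apply/funext => t; apply: eq_from_tnth => i; rewrite tnth_mktuple /= tnth_upd !tnth_rot2 //.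
rewrite eqxx (negbTE ab); case: tpermP => [->|->|/eqP/negbTE ia /eqP/negbTE ib].
- by rewrite eqxx; ring.
- by rewrite eqxx eq_sym (negbTE ab); ring.
- by rewrite ia ib.
Qed.

Variable n : nat.
Local Notation mxo := (@mx_of R 1 n).
Implicit Types (F G : 'rV[C]_n -> C) (z : 'rV[C]_n) (s : 'S_n) (mu nu : 'I_n -> nat).

Lemma mx_invariant_tperm (a b : 'I_n) : a != b -> mx_invariant (col_perm (tperm a b) : 'rV[C]_n -> _).
Proof.
move=> ab; have ab' : (ord0, a) != (ord0, b) :> 'I_1 * 'I_n by rewrite xpair_eqE eqxx.
exists ((fun t => [tuple tnth t (tperm (rei (ord0, a)) (rei (ord0, b)) i) | i < _]) \o
        (fun t => [tuple tnth t (tperm (imi (ord0, a)) (imi (ord0, b)) i) | i < _])).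
  by apply: leb_invariant_comp; apply: leb_invariant_tperm; rewrite ?rei_eq ?imi_eq.
move=> t; apply/matrixP => i j; rewrite mx_ofE !mxE !tnth_mktuple (ord1 i).
have inj_re : injective (fun j : 'I_n => rei (ord0 : 'I_1, j)).
  by move=> k k' /eqP; rewrite rei_eq => /eqP[].
have inj_im : injective (fun j : 'I_n => imi (ord0 : 'I_1, j)).
  by move=> k k' /eqP; rewrite imi_eq => /eqP[].
have -> : tperm (rei (ord0, a)) (rei (ord0, b)) (rei (ord0 : 'I_1, j)) = rei (ord0, tperm a b j).
  by rewrite (inj_tperm a b j inj_re).
have -> : tperm (imi (ord0, a)) (imi (ord0, b)) (rei (ord0 : 'I_1, tperm a b j)) = rei (ord0, tperm a b j).
  by rewrite tpermD // imi_rei.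
have -> : tperm (rei (ord0, a)) (rei (ord0, b)) (imi (ord0 : 'I_1, j)) = imi (ord0, j).
  by rewrite tpermD // rei_imi.
by rewrite -(inj_tperm a b j inj_im).
Qed.

Lemma mx_invariant_col_perm s : mx_invariant (col_perm s : 'rV[C]_n -> _).
Proof.
have [ts -> /allP h] := prod_tpermP s; elim: ts h => [|t ts IH] h.
  rewrite big_nil (_ : col_perm 1 = id); first exact: mx_invariant_id.
  by apply/funext => z; rewrite col_perm1.
rewrite big_cons (_ : col_perm _ = col_perm (tperm t.1 t.2) \o col_perm (\prod_(t <- ts) tperm t.1 t.2)).
  apply: mx_invariant_comp; first by apply: mx_invariant_tperm; apply: h; rewrite mem_head.
  by apply: IH => x xts; apply: h; rewrite inE xts orbT.
by apply/funext => z; rewrite /= col_permM.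
Qed.

Lemma nsq_col_perm s z : nsq (col_perm s z) = nsq z.
Proof.
apply: eq_bigr => i _; rewrite [RHS](reindex_inj (@perm_inj _ s)).
by apply: eq_bigr => j _; rewrite mxE.
Qed.

End column_permutations.

(** * Partitions and strictly decreasing exponents *)

Section strictly_decreasing.
Variable n : nat.
Implicit Types (mu nu : 'I_n -> nat) (l : partitions n).

(** These exponents represent the nonzero alternants up to sign; adding [delta] matches them one to
    one with partitions. *)
Definition sdec mu := forall i j : 'I_n, (i < j)%N -> (mu j < mu i)%N.

Lemma sdec_inj mu : sdec mu -> injective mu.
Proof.
by move=> h i j e; case: (ltngtP i j) => [/h|/h|/ord_inj //]; rewrite e ltnn.
Qed.

Lemma sdec_sorted mu : sdec mu -> sorted gtn [seq mu i | i <- enum 'I_n].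
Proof.
move=> h; apply: (@homo_sorted _ _ mu (relpre val ltn)) => //.
by rewrite -sorted_map val_enum_ord iota_ltn_sorted.
Qed.

(** A strictly decreasing sequence is determined by its set of values. *)
Lemma sdec_perm mu nu (s : 'S_n) : sdec mu -> sdec nu -> mu \o s =1 nu -> mu =1 nu.
Proof.
move=> hm hn e; have : [seq mu i | i <- enum 'I_n] = [seq nu i | i <- enum 'I_n].
  apply: (irr_sorted_eq (leT := gtn)).
  - by move=> y x z /= xy yz; exact: ltn_trans yz xy.
  - by move=> x; exact: ltnn.
  - exact: sdec_sorted.
  - exact: sdec_sorted.
  - move=> x; apply/mapP/mapP => -[i _ ->].
      by exists (s^-1%g i); rewrite ?mem_enum // -e /= permKV.
    by exists (s i); rewrite ?mem_enum // -e.
move=> /eq_in_map E i; apply: E; exact: mem_enum.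
Qed.

Lemma sdec_add_delta l : sdec (add_delta l).
Proof.
move=> i j ij; rewrite /add_delta /delta.
have lij : (tnth (val l) j <= tnth (val l) i)%N.
  rewrite !(tnth_nth 0%N).
  apply: (@sorted_leq_nth _ geq _ _ 0%N (val l) (valP l)) => //; rewrite ?inE ?size_tuple //.
  - by move=> y x z /= xy yz; exact: leq_trans yz xy.
  - by move=> x /=.
  - exact: ltnW.
rewrite -addnS leq_add // ltn_sub2l //.
exact: leq_ltn_trans ij (ltn_ord j).
Qed.

Lemma add_delta_inj l l' : add_delta l =1 add_delta l' -> l = l'.
Proof.
move=> h; apply: val_inj; apply: eq_from_tnth => i.
by have := h i; rewrite /add_delta => /addIn.
Qed.

Lemma sdec_ge_delta mu i : sdec mu -> (delta i <= mu i)%N.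
Proof.
move=> h; rewrite /delta; move e : (n - i.+1)%N => k; elim: k i e => // k IH i e.
have i1 : (i.+1 < n)%N by rewrite -subn_gt0 e.
have := h i (Ordinal i1) (ltnSn _); apply: leq_ltn_trans; apply: IH.
by rewrite /= subnS e.
Qed.

Lemma sdec_partition mu : sdec mu -> exists l, mu =1 add_delta l.
Proof.
move=> h; pose t : n.-tuple nat := [tuple (mu i - delta i)%N | i < n].
have st : sorted geq t.
  apply/(sortedP 0%N) => i; rewrite size_tuple => i1.
  have i0 : (i < n)%N by exact: ltnW.
  have E (j : 'I_n) : nth 0%N t j = (mu j - delta j)%N by rewrite -tnth_nth tnth_mktuple.
  rewrite (E (Ordinal i1)) (E (Ordinal i0)) /delta /=.
  have := h (Ordinal i0) (Ordinal i1) (ltnSn _).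
  have := sdec_ge_delta (Ordinal i0) h; have := sdec_ge_delta (Ordinal i1) h; rewrite /delta /=.
  lia.
exists (exist _ t st) => i; rewrite /add_delta tnth_mktuple subnK //.
exact: sdec_ge_delta.
Qed.

Lemma inj_sdec mu : injective mu -> exists s : 'S_n, sdec (mu \o s).
Proof.
move=> inj; pose t : n.-tuple nat := [tuple mu i | i < n].
have p : perm_eq (sort geq t) t by rewrite perm_sort.
have [s hs] := tuple_permP p; exists s => i j ij.
have st : sorted geq (sort geq t) by apply: sort_sorted => x y; exact: leq_total.
have nE (k : 'I_n) : nth 0%N (sort geq t) k = mu (s k).
  by rewrite hs -tnth_nth !tnth_mktuple.
have sz : size (sort geq t) = n by rewrite size_sort size_tuple.
have : (mu (s j) <= mu (s i))%N.
  rewrite -!nE; apply: (@sorted_leq_nth _ geq _ _ 0%N _ st) => //; rewrite ?inE ?sz //.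
  - by move=> y x z /= xy yz; exact: leq_trans yz xy.
  - by move=> x /=.
  - exact: ltnW.
rewrite leq_eqVlt => /predU1P[/inj/perm_inj e|//].
by rewrite e ltnn in ij.
Qed.

End strictly_decreasing.

Section alternating_functions.
Variable R : realType.
Local Notation C := (Cplx R).
Variable n : nat.
Local Notation idx := {ffun 'I_1 * 'I_n -> nat}.
Implicit Types (F G : 'rV[C]_n -> C) (z : 'rV[C]_n) (s : 'S_n) (mu nu : 'I_n -> nat) (l : partitions n).

Definition alternant_fun mu z : C := alternant (fun i => z 0 i) mu.

Definition ridx mu : idx := [ffun p => mu p.2].

Lemma row_index_bij : {on [pred _ | true], bijective (fun j : 'I_n => (0 : 'I_1, j))}.
Proof. by exists snd => // -[i j] _; rewrite (ord1 i). Qed.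

Lemma mono_row (a : idx) z : mono a z = \prod_i z 0 i ^+ a (0, i).
Proof.
by rewrite /mono (reindex _ row_index_bij).
Qed.

Lemma mono_ridx mu z : mono (ridx mu) z = \prod_i z 0 i ^+ mu i.
Proof. by rewrite mono_row; apply: eq_bigr => i _; rewrite ffunE. Qed.

Lemma ffact_ridx mu : ffact (ridx mu) = mfact mu.
Proof.
rewrite /ffact /mfact (reindex _ row_index_bij).
by apply: eq_bigr => i _; rewrite ffunE.
Qed.

Lemma ridx_inj mu nu : ridx mu = ridx nu -> mu =1 nu.
Proof. by move=> h i; have := congr1 (fun f : idx => f (0, i)) h; rewrite !ffunE. Qed.

Lemma alternant_funE mu : alternant_fun mu = fun z => \sum_(s : 'S_n) (-1) ^+ s * mono (ridx (mu \o s)) z.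
Proof.
apply/funext => z; rewrite /alternant_fun alternantE; apply: eq_bigr => s _.
by rewrite mono_ridx.
Qed.

Lemma fock_alternant_fun mu : fock (alternant_fun mu).
Proof. by rewrite alternant_funE; apply: fock_sum => s; apply: fockZ; exact: fock_mono. Qed.

Lemma conj_sign s : ((-1) ^+ s : C)^* = (-1) ^+ s.
Proof. by rewrite rmorphXn rmorphN1. Qed.

(** Monomials are orthogonal, so permutations s and t contribute only if mu after s equals nu after
    t, which forces mu = nu and s = t. Each of the n! remaining terms is [mfact mu], its sign being
    squared. *)
Lemma inner_alternant_fun mu nu : sdec mu -> sdec nu ->
  inner (alternant_fun mu) (alternant_fun nu) = (n`! * mfact mu)%:R * (`[< mu =1 nu >])%:R.
Proof.
move=> hm hn; rewrite !alternant_funE inner_sum; try by move=> s; exact: fock_mono.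
under eq_bigr do under eq_bigr do rewrite inner_mono ffact_ridx.
have [/asboolP e|/asboolP ne] := boolP `[< mu =1 nu >]; last first.
  rewrite mulr0 big1 // => s _; rewrite big1 // => t _.
  case: eqP => [/ridx_inj h|_]; last by rewrite !mulr0.
  exfalso; apply: ne; apply: (@sdec_perm _ mu nu (t^-1 * s)%g) => // i.
  by rewrite /= permM -[mu _]/((mu \o s) _) h /= permKV.
have -> : nu = mu by apply/funext => i; rewrite e.
have mf s : mfact (mu \o s) = mfact mu by rewrite [RHS](reindex_inj (@perm_inj _ s)).
rewrite (eq_bigr (fun=> (mfact mu)%:R)) => [|s _].
  by rewrite sumr_const card_Sn mulr1 mulnC natrM mulr_natr.
rewrite (bigD1 s) //= big1 ?addr0 => [|t ts].
  by rewrite eqxx mulr1 mf conj_sign -signr_addb addbb mul1r.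
case: eqP => [/ridx_inj h|_]; last by rewrite !mulr0.
have /eqP : s = t by apply/permP => i; apply: (sdec_inj hm); exact: h.
by rewrite eq_sym (negbTE ts).
Qed.

(** The antisymmetrizer: it fixes alternating functions and does not increase norms, so
    approximations remain as good after it. *)
Definition asym F z : C := (n`!)%:R^-1 * \sum_(s : 'S_n) (-1) ^+ s * F (col_perm s z).

Lemma fock_col_perm F s : fock F -> fock (F \o col_perm s).
Proof.
move=> hF; apply/fockP; split.
  apply: (@holomorphic_comp_affine _ _ _ _ _ _ (col_perm s) (col_perm s) 1); first exact: hF.1.
  - by move=> z h; apply/matrixP => i j; rewrite !mxE.
  - by move=> a h1 h2; apply/matrixP => i j; rewrite !mxE.
  - move=> h; rewrite mul1r; apply: vnorm_le => [|i j]; first exact: vnorm_ge0.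
    by rewrite mxE cabs_entry_le.
rewrite /l2 l2w_invariant; [|exact: weight_gauss|exact: fock_cmeas|exact: mx_invariant_col_perm|].
  by case/fockP: hF.
by move=> z; rewrite !gaussE nsq_col_perm.
Qed.

Lemma fnorm_col_perm F s : fock F -> fnorm (F \o col_perm s) = fnorm F.
Proof.
move=> hF; rewrite !fnormE l2_invariant //; first exact: mx_invariant_col_perm.
exact: nsq_col_perm.
Qed.

Lemma asym_alt G : fock_alt R n G -> asym G = G.
Proof.
move=> [_ hG]; apply/funext => z; rewrite /asym (eq_bigr (fun=> G z)).
  rewrite sumr_const card_Sn -[G z *+ _]mulr_natl mulKf // pnatr_eq0.
move=> s _; rewrite (hG (s^-1)%g z) odd_permV invgK; congr (_ * G _).
by apply/rowP => i; rewrite !mxE.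
Qed.

Lemma fnorm_asym F : fock F -> fnorm (asym F) <= fnorm F.
Proof.
move=> hF.
have fs s : fock (fun z => (-1) ^+ s * F (col_perm s z)) by apply: fockZ; exact: fock_col_perm.
rewrite /asym fnormZ; last by apply: fock_sum.
have n0 : (n`!)%:R != 0 :> R by rewrite pnatr_eq0 -lt0n fact_gt0.
rewrite cabsV -RtoC_nat cabs_RtoC ger0_norm // ler_pdivrMl ?ltr0n ?fact_gt0 //.
rewrite (le_trans (fnorm_sum _ fs)) // (eq_bigr (fun=> fnorm F)).
  by rewrite sumr_const card_Sn mulr_natl.
move=> s _; rewrite fnormZ ?fnorm_col_perm; try exact: fock_col_perm; try by [].
by rewrite cabsX cabsN cabs1 expr1n mul1r.
Qed.

Lemma asym_span (r : seq (C * idx)) :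
  asym (fun z => \sum_(x <- r) x.1 * mono x.2 z) =
  fun z => \sum_(x <- r) x.1 * asym (mono x.2) z.
Proof.
apply/funext => z; rewrite /asym.
under eq_bigr do rewrite mulr_sumr.
rewrite exchange_big mulr_sumr; apply: eq_bigr => x _ /=.
rewrite [RHS]mulrCA [in RHS]mulr_sumr; congr (_ * _); apply: eq_bigr => s _.
by rewrite mulrCA.
Qed.

Lemma asymB F G : asym (fun z => F z - G z) = fun z => asym F z - asym G z.
Proof.
apply/funext => z; rewrite /asym -mulrBr; congr (_ * _); rewrite -sumrB.
by apply: eq_bigr => s _; rewrite mulrBr.
Qed.

Lemma asym_mono (a : idx) : asym (mono a) = fun z => (n`!)%:R^-1 * alternant_fun (fun i => a (0, i)) z.
Proof.
apply/funext => z; rewrite /asym /alternant_fun alternantE [in RHS](reindex_inj invg_inj); congr (_ * _).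
apply: eq_bigr => s _; rewrite odd_permV; congr (_ * _).
rewrite mono_row [RHS](reindex_inj (@perm_inj _ s)).
by apply: eq_bigr => i _; rewrite mxE permK.
Qed.

(** Distinct exponents are sorted at the cost of a sign. A repeated exponent gives 0, written with
    an arbitrary partition and the coefficient 0. *)
Lemma alternant_fun_partition mu : exists (c : C) l, alternant_fun mu = fun z => c * alternant_fun (add_delta l) z.
Proof.
have [inj|] := pselect (injective mu).
  have [s hs] := inj_sdec inj; have [l hl] := sdec_partition hs.
  exists ((-1) ^+ s), l; apply/funext => z.
  have <- : mu \o s = add_delta l by exact/funext.
  by rewrite /alternant_fun alternant_permmu mulrA -signr_addb addbb mul1r.
move=> ninj.
have [l _] : exists l : partitions n, True.
  have st : sorted geq (nseq_tuple n 0%N) by rewrite /=; elim: n => // -[].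
  by exists (exist _ (nseq_tuple n 0%N) st).
exists 0, l; apply/funext => z; rewrite mul0r.
suff [i [j [ij e]]] : exists i j, i != j /\ mu i = mu j by exact: alternant_eq0 ij e.
apply/not_existsP => h; apply: ninj => i j e; apply/eqP/negPn/negP => ij.
by apply: (h i); exists j.
Qed.

Definition psi_sign : C := (-1) ^+ (perm (@rev_ord_inj n)).

Definition psi_coef l : C :=
  RtoC (psi_const R n * Num.sqrt ((mfact (@delta n))%:R / (mfact (add_delta l))%:R)) * psi_sign.

Lemma psi_schur_basis l : psi (schur_basis l) = fun x => psi_coef l * alternant_fun (add_delta l) x.
Proof.
apply/funext => x; rewrite /psi /schur_basis chi_diag.
have -> : vandermonde x = psi_sign * alternant_fun (@delta n) x by exact: alternant_delta.
have <- : mpoly.meval (fun i => x 0 i) (schur R l) * alternant_fun (@delta n) x = alternant_fun (add_delta l) x.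
  have E mu : mpoly.meval (fun i => x 0 i) (alternant (@mpvar R n) mu) = alternant_fun mu x.
    rewrite alternant_rmorph; congr alternant; apply/funext => i.
    by rewrite /= mpoly.mevalXU.
  by rewrite -!E (schurP R l) mpoly.mevalM.
rewrite /psi_coef RtoCM; ring.
Qed.

(** The factorial of [delta] is the product of p! over p < n; the factor n! completes it to the
    product in [psi_const]. *)
Lemma psi_const_sqr : psi_const R n ^+ 2 * (n`! * mfact (@delta n))%:R = 1.
Proof.
have -> : (n`! * mfact (@delta n) = \prod_(1 <= p < n.+1) p`!)%N.
  have -> : mfact (@delta n) = (\prod_(0 <= p < n) p`!)%N.
    rewrite big_mkord /mfact (reindex_inj rev_ord_inj); apply: eq_bigr => i _.
    by rewrite /delta /= subnSK ?subKn // ltnW.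
  rewrite mulnC -[n in n`!]/(n) -big_nat_recr //= big_ltn // fact0 mul1n //.
have P0 : (0 < \prod_(1 <= p < n.+1) p`!)%N by apply: prodn_gt0 => p; exact: fact_gt0.
rewrite /psi_const exprVn sqr_sqrtr ?ler0n // mulVf // pnatr_eq0 -lt0n //.
Qed.

Lemma cabs_psi_coef l : cabs (psi_coef l) ^+ 2 * (n`! * mfact (add_delta l))%:R = 1.
Proof.
have f0 : (mfact (add_delta l))%:R != 0 :> R.
  by rewrite pnatr_eq0 -lt0n; apply: prodn_gt0 => i; exact: fact_gt0.
rewrite /psi_coef cabsM cabs_RtoC /psi_sign cabsX cabsN cabs1 expr1n mulr1 real_normK ?num_real //.
rewrite exprMn sqr_sqrtr ?divr_ge0 // -[RHS]psi_const_sqr !natrM; field. exact: f0.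
Qed.

Lemma inner_psi_schur_basis l l' :
  inner (psi (schur_basis l) : 'rV[C]_n -> C) (psi (schur_basis l')) = (l == l')%:R.
Proof.
set mu := add_delta l; set nu := add_delta l'.
transitivity (inner (fun x => psi_coef l * alternant_fun mu x) (fun x => psi_coef l' * alternant_fun nu x)).
  exact: (congr2 (@inner R 1 n) (psi_schur_basis l) (psi_schur_basis l')).
rewrite (innerZl (psi_coef l) (fock_alternant_fun mu) (fockZ (psi_coef l') (fock_alternant_fun nu))).
rewrite (innerZr (psi_coef l') (fock_alternant_fun mu) (fock_alternant_fun nu)).
rewrite (inner_alternant_fun (sdec_add_delta l) (sdec_add_delta l')).
have [<-|ne] := eqVneq l l'.
  rewrite (_ : `[< _ >]) ?mulr1; last exact/asboolP.
  by rewrite mulrA conjC_mul -RtoC_nat -RtoCM cabs_psi_coef.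
rewrite (_ : `[< _ >] = false) ?mulr0 //; apply/asboolP => /add_delta_inj /eqP.
by rewrite (negbTE ne).
Qed.

Lemma psi_coef_neq0 l : psi_coef l != 0.
Proof.
apply/eqP => h; have := cabs_psi_coef l; rewrite h cabs0 expr0n /= mul0r => /eqP.
by rewrite eq_sym oner_eq0.
Qed.

Lemma fock_psi_schur_basis l : fock (psi (schur_basis l) : 'rV[C]_n -> C).
Proof. by rewrite psi_schur_basis; apply: fockZ; exact: fock_alternant_fun. Qed.

Lemma psi_schur_basis_dense G : fock_alt R n G ->
  span_approx (fun l : partitions n => psi (schur_basis l)) G.
Proof.
move=> hG eps eps0; have [r hr] := mono_dense hG.1 eps0.
(* Antisymmetrizing a monomial yields an alternant, hence a possibly zero multiple of the image of
   one basis element; [g] records coefficient and index. *)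
have /choice[g hg] (a : idx) : exists y : C * partitions n,
    asym (mono a) = fun z => y.1 * psi (schur_basis y.2) z.
  have [c [l e]] := alternant_fun_partition (fun i => a (0, i)).
  exists ((n`!)%:R^-1 * c * (psi_coef l)^-1, l); rewrite asym_mono e psi_schur_basis /=.
  by apply/funext => z; field; rewrite psi_coef_neq0 pnatr_eq0 -lt0n fact_gt0.
exists [seq (x.1 * (g x.2).1, (g x.2).2) | x <- r].
have fr : fock (fun z => \sum_(x <- r) x.1 * mono x.2 z) by apply: fock_span; exact: fock_mono.
apply: le_lt_trans hr; apply: le_trans (fnorm_asym (fockB hG.1 fr)).
rewrite asymB asym_alt // asym_span le_eqVlt; apply/orP; left; apply/eqP; congr fnorm.
apply/funext => z; congr (_ - _); rewrite big_map; apply: eq_bigr => x _ /=.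
by rewrite hg mulrA.
Qed.

End alternating_functions.

(** * Transfer between the two spaces *)

Lemma ctends_ext (R : realType) (u v : nat -> Cplx R) l : (forall k, u k = v k) ->
  ctends u l -> ctends v l.
Proof. by move=> /funext ->. Qed.

Section span_transfer.
Variable R : realType.
Local Notation C := (Cplx R).
Variables (m n p q : nat) (I : eqType).
Variables (e : I -> 'M[C]_(m, n) -> C) (f : I -> 'M[C]_(p, q) -> C).
Hypotheses (he : forall i, fock (e i)) (hf : forall i, fock (f i)).
Hypothesis gram : forall i j, inner (e i) (e j) = inner (f i) (f j).

Lemma fnorm_span (r : seq (C * I)) :
  fnorm (fun x => \sum_(y <- r) y.1 * f y.2 x) = fnorm (fun z => \sum_(y <- r) y.1 * e y.2 z).
Proof.
rewrite /fnorm; congr (Num.sqrt (Cre _)).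
rewrite (@inner_sum _ _ _ _ _ r r (fun y => y.1) (fun y => y.1) (fun y => f y.2) (fun y => f y.2)) //.
rewrite (@inner_sum _ _ _ _ _ r r (fun y => y.1) (fun y => y.1) (fun y => e y.2) (fun y => e y.2)) //.
by apply: eq_bigr => y _; apply: eq_bigr => y' _; rewrite gram.
Qed.

Lemma fnorm_spanB (r s : seq (C * I)) :
  fnorm (fun x => \sum_(y <- r) y.1 * f y.2 x - \sum_(y <- s) y.1 * f y.2 x) =
  fnorm (fun z => \sum_(y <- r) y.1 * e y.2 z - \sum_(y <- s) y.1 * e y.2 z).
Proof.
have E m' n' (g : I -> 'M[C]_(m', n') -> C) z :
    \sum_(y <- r) y.1 * g y.2 z - \sum_(y <- s) y.1 * g y.2 z =
    \sum_(y <- r ++ [seq (- y.1, y.2) | y <- s]) y.1 * g y.2 z.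
  rewrite big_cat big_map /= -sumrN; congr (_ + _).
  by apply: eq_bigr => y _; rewrite mulNr.
rewrite (_ : (fun x => _) = fun x => \sum_(y <- r ++ [seq (- y.1, y.2) | y <- s]) y.1 * f y.2 x).
  by rewrite fnorm_span; congr fnorm; apply/funext => z; rewrite E.
by apply/funext => x; rewrite E.
Qed.

(** Equal Gram matrices make equal combinations of both families equally long, so combinations
    converging on one side converge on the other. The families are abstract because the lemma serves
    both directions, and convergence is stated pointwise so that limits can be compared through
    [psi]. *)
Lemma span_transfer F : fock F -> span_approx e F ->
  exists G (r : nat -> seq (C * I)), [/\ fock G, fnorm G = fnorm F,
    forall z, ctends (fun k => \sum_(y <- r k) y.1 * e y.2 z) (F z)
  & forall x, ctends (fun k => \sum_(y <- r k) y.1 * f y.2 x) (G x)].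
Proof.
move=> hF aF.
have h (k : nat) : exists r : seq (C * I), fnorm (fun z => F z - \sum_(x <- r) x.1 * e x.2 z) < 2^-1 ^+ k.
  by apply: aF; rewrite exprn_gt0 // invr_gt0.
have [r hr] := choice h.
pose P k z := \sum_(y <- r k) y.1 * e y.2 z.
pose Q k x := \sum_(y <- r k) y.1 * f y.2 x.
have fP k : fock (P k) by exact: fock_span.
have fQ k : fock (Q k) by exact: fock_span.
have small (c : R) : 0 < c -> exists N, forall k, (N <= k)%N -> fnorm (fun z => F z - P k z) <= c.
  move=> c0; have [N hN] := half_exp_small (ler01 : 0 <= 1 :> R) c0; exists N => k Nk.
  by rewrite (le_trans (ltW (hr k))) //; have := hN k Nk; rewrite mul1r.
have cau (c : R) : 0 < c -> exists N, forall i j, (N <= i)%N -> (N <= j)%N ->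
    fnorm (fun x => Q i x - Q j x) <= c.
  move=> c0; have [N hN] := small _ (divr_gt0 c0 (ltr0Sn R 1)); exists N => i j Ni Nj.
  have e1 : fnorm (fun x => Q i x - Q j x) = fnorm (fun z => P i z - P j z).
    exact: fnorm_spanB.
  rewrite e1; apply: le_trans (fnormB_le (fP i) hF (fP j)) _.
  by rewrite [c]splitr (fnormN (fP i) hF) lerD // hN.
have [G [fG QG hG]] := fock_cauchy_limit fQ cau.
exists G, r; split => //; last first.
  move=> z; have [E E0 hE] := evaluation_bound R m n.
  move=> c c0; pose W := E * expR (nsq z); have W0 : 0 < W by rewrite mulr_gt0 ?expR_gt0.
  have [N hN] := small _ (divr_gt0 c0 W0); exists N => k Nk.
  rewrite cabsC (le_trans (hE _ (fockB hF (fP k)) z)) // -/W mulrC -ler_pdivlMr //.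
  exact: hN.
have PQ k : fnorm (Q k) = fnorm (P k) by exact: fnorm_span.
apply/eqP; rewrite eq_le; apply/andP; split; apply/ler_addgt0Pr => c c0;
  have c2 : 0 < c / 2 by [rewrite divr_gt0];
  have [N hN] := small _ c2; have [N' hN'] := hG _ c2;
  have := hN (maxn N N') (leq_maxl _ _); have := hN' (maxn N N') (leq_maxr _ _);
  move: (maxn N N') => k h1 h2.
  have := fnorm_le_add fG (fQ k); have := fnorm_le_add (fP k) hF.
  rewrite fnormN // PQ; lra.
have := fnorm_le_add hF (fP k); have := fnorm_le_add (fQ k) fG.
rewrite fnormN // PQ; lra.
Qed.

End span_transfer.

(** Repeated indices are merged by adding their coefficients. *)
Lemma big_span_index (K : comNzRingType) (I : eqType) (r : seq (K * I)) :
  exists (s : seq I) (a : I -> K), forall g : I -> K,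
    \sum_(x <- r) x.1 * g x.2 = \sum_(i <- s) a i * g i.
Proof.
exists (undup [seq x.2 | x <- r]), (fun i => \sum_(x <- r | x.2 == i) x.1) => g.
under [RHS]eq_bigr do rewrite big_mkcond mulr_suml.
rewrite exchange_big /= big_seq [RHS]big_seq; apply: eq_bigr => x xr.
rewrite (bigD1_seq x.2) ?undup_uniq //=; last by rewrite mem_undup map_f.
rewrite eqxx big1 ?addr0 // => i; rewrite eq_sym => /negbTE ->.
by rewrite mul0r.
Qed.

(** * The map [psi] on invariant functions *)

Section psi_theory.
Variable R : realType.
Local Notation C := (Cplx R).
Variable n : nat.
Implicit Types (F G : 'M[C]_n -> C) (x : 'rV[C]_n) (s : 'S_n).

Lemma psi_lin (a : C) F G :
  psi (fun z => a * F z + G z) = (fun x => a * psi F x + psi G x).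
Proof. by apply/funext => x; rewrite /psi; ring. Qed.

Lemma fockU_lin (a : C) F G : fockU R n F -> fockU R n G -> fockU R n (fun z => a * F z + G z).
Proof.
move=> [hF iF] [hG iG]; split; first exact: fock_lin.
by move=> u uu z; rewrite iF // iG.
Qed.

Lemma fockU_span (r : seq (C * partitions n)) :
  fockU R n (fun z => \sum_(y <- r) y.1 * schur_basis y.2 z).
Proof.
split; first by apply: fock_span => l; exact: (fockU_schur_basis R l).1.
by move=> u uu z; apply: eq_bigr => y _; rewrite (fockU_schur_basis R y.2).2.
Qed.

Lemma psi_span (r : seq (C * partitions n)) :
  psi (fun z => \sum_(y <- r) y.1 * schur_basis y.2 z) =
  (fun x => \sum_(y <- r) y.1 * psi (schur_basis y.2) x).
Proof.
apply/funext => x; rewrite /psi mulr_sumr; apply: eq_bigr => y _; ring.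
Qed.

Lemma vandermonde_perm s x :
  vandermonde (\row_i x 0 (s i)) = (-1) ^+ s * vandermonde x.
Proof.
rewrite /vandermonde !alternant_delta [RHS]mulrCA -[in RHS](alternant_permx _ _ s); congr (_ * _).
apply: (congr1 (fun v => alternant v (@delta n))).
by apply/funext => i; rewrite mxE.
Qed.

Lemma unitary_perm_mx s : (perm_mx s : 'M[C]_n) \is unitarymx.
Proof.
apply/unitarymxP; rewrite tr_perm_mx map_perm_mx -perm_mxM mulgV perm_mx1 //.
Qed.

(** Permutation matrices are unitary, and conjugation by them permutes the diagonal. *)
Lemma fockU_perm_diag F s x : fockU R n F -> F (diag_mx (\row_i x 0 (s i))) = F (diag_mx x).
Proof.
move=> [_ h]; rewrite -(h _ (unitary_perm_mx s^-1) (diag_mx x)); congr F.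
have -> : invmx (perm_mx s^-1) = perm_mx s :> 'M[C]_n.
  apply: (can_inj (mulmxK (unitarymx_unit (unitary_perm_mx s^-1)))).
  by rewrite mulVmx ?unitarymx_unit ?unitary_perm_mx // -perm_mxM mulgV perm_mx1.
rewrite -row_permE -col_permE; apply/matrixP => i j; rewrite !mxE.
by rewrite (inj_eq (@perm_inj _ s)).
Qed.

Lemma psi_alternating F s x : fockU R n F ->
  psi F x = (-1) ^+ s * psi F (\row_i x 0 (s^-1%g i)).
Proof.
move=> hF; rewrite /psi fockU_perm_diag // vandermonde_perm odd_permV.
have : (-1) ^+ s * (-1) ^+ s = 1 :> C by rewrite -signr_addb addbb.
move: ((-1) ^+ s) (RtoC _) (vandermonde x) (F _) => w a b c ww.
by rewrite [RHS](_ : _ = w * w * (a * b * c)); [rewrite ww mul1r|ring].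
Qed.

Lemma psi_ctends (H : nat -> 'M[C]_n -> C) F : (forall z, ctends (H^~ z) (F z)) ->
  forall x, ctends (fun k => psi (H k) x) (psi F x).
Proof. by move=> h x; apply: ctendsM; [exact: ctends_cst|exact: h]. Qed.

(** Inner products are compared by polarization. A combination that approximates [psi F]
    approximates [F] equally well, by isometry applied to their difference. *)
Lemma unitary_psi_onb :
  (forall F, fockU R n F -> fock_alt R n (psi F)) ->
  unitary_map (fockU R n) (fock_alt R n) (@psi R n) ->
  is_onb (fockU R n) (@schur_basis R n).
Proof.
move=> wd [lin iso _].
have inn : forall F G, fockU R n F -> fockU R n G -> inner (psi F) (psi G) = inner F G.
  apply: (isometry_inner _ fockU_lin lin iso) => F hF.
  by split; [exact: hF.1|exact: (wd _ hF).1].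
split; first exact: fockU_schur_basis.
  move=> l l'; rewrite -inn; try exact: fockU_schur_basis.
  exact: inner_psi_schur_basis.
move=> F hF eps eps0; have [r hr] := psi_schur_basis_dense (wd _ hF) eps0.
have [s [a sa]] := big_span_index r; exists s, a.
apply: le_lt_trans hr; rewrite le_eqVlt; apply/orP; left; apply/eqP.
have hD := fockU_lin (-1) (fockU_span r) hF.
transitivity (fnorm (fun z => -1 * (\sum_(y <- r) y.1 * schur_basis y.2 z) + F z)).
  apply: (congr1 (@fnorm R n n)); apply/funext => z.
  by have := sa (fun l => schur_basis l z) => /= ->; rewrite mulN1r addrC.
rewrite -(iso _ hD) psi_lin psi_span; congr fnorm; apply/funext => x.
by rewrite mulN1r addrC.
Qed.

Lemma onb_unitary_psi : is_onb (fockU R n) (@schur_basis R n) ->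
  (forall F, fockU R n F -> fock_alt R n (psi F)) /\
  unitary_map (fockU R n) (fock_alt R n) (@psi R n).
Proof.
move=> [hU ort dense].
have fe l : fock (schur_basis l : 'M[C]_n -> C) by exact: (hU l).1.
pose f (l : partitions n) : 'rV[C]_n -> C := psi (schur_basis l).
have ff l : fock (f l) by exact: fock_psi_schur_basis.
have gram l l' : inner (schur_basis l : 'M[C]_n -> C) (schur_basis l') = inner (f l) (f l').
  by rewrite ort inner_psi_schur_basis.
have main F : fockU R n F -> fock (psi F) /\ fnorm (psi F) = fnorm F.
  move=> hF; have aF : span_approx (@schur_basis R n) F.
    move=> eps eps0; have [s [a h]] := dense _ hF _ eps0.
    by exists [seq (a i, i) | i <- s]; under eq_fun do rewrite big_map.
  (* The same combinations converge pointwise to [F] and, after [psi], to [G]. As [psi] respects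
     pointwise limits, [G] is [psi F]. *)
  have [G [r [fG GF PF QG]]] := span_transfer fe ff gram hF.1 aF.
  suff -> : psi F = G by [].
  apply/funext => x; apply: ctends_uniq (QG x).
  apply: ctends_ext (psi_ctends PF x) => k.
  exact: (congr1 (fun g => g x) (psi_span (r k))).
have wd F : fockU R n F -> fock_alt R n (psi F).
  move=> hF; split; first exact: (main F hF).1.
  by move=> s z; exact: psi_alternating.
split => //; split.
- by move=> a F G _ _; exact: psi_lin.
- by move=> F hF; exact: (main F hF).2.
move=> G hG.
have gram' l l' : inner (f l) (f l') = inner (schur_basis l : 'M[C]_n -> C) (schur_basis l').
  by rewrite gram.
have [F [r [fF _ QG PF]]] := span_transfer ff fe gram' hG.1 (psi_schur_basis_dense hG).
exists F.
  (* Each combination is invariant under conjugation, and invariance passes to the pointwise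
     limit. *)
  split => // u uu z; apply: ctends_uniq (PF z).
  apply: ctends_ext (PF (invmx u *m z *m u)) => k.
  exact: (fockU_span (r k)).2 u uu z.
apply/funext => x; apply: ctends_uniq (QG x).
apply: ctends_ext (psi_ctends PF x) => k.
exact: (congr1 (fun g => g x) (psi_span (r k))).
Qed.

End psi_theory.

Theorem proposition4p5 (R : realType) (n : nat) (hn : (0 < n)%N) :
  (forall l : partitions n, fockU R n (schur_basis l)) /\
  (((forall F, fockU R n F -> fock_alt R n (psi F)) /\
      unitary_map (fockU R n) (fock_alt R n) (@psi R n)) ->
   is_onb (fockU R n) (@schur_basis R n)) /\
  (is_onb (fockU R n) (@schur_basis R n) ->
   (forall F, fockU R n F -> fock_alt R n (psi F)) /\
     unitary_map (fockU R n) (fock_alt R n) (@psi R n)).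
Proof.
split; first exact: fockU_schur_basis.
by split=> [[]|]; [exact: unitary_psi_onb|exact: onb_unitary_psi].
Qed.
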